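(* Let $p\ge2$. Assume that $u_0\in L^p(\Omega;\dot{\mathbb H}^1)$ and $v_0\in L^p(\Omega;L^2(\mathcal O))$. Let $\tilde u$ be the mild solution of the regularized stochastic wave equation $\partial_{tt}\tilde u-\partial_{xx}\tilde u=b(\tilde u)+\tilde\xi$ with $\tilde u(0)=u_0$, $\partial_t\tilde u(0)=v_0$, and for $N\in\mathbb N_+$ let $\tilde u_N$ be its spectral Galerkin approximation. Then there exists a constant $C$, depending only on $p,T,H,u_0,v_0$ (and on the fixed function $b$), and not on $N,m,n$, such that $$\sup_{t\in I}\Big(\mathbb E\big[\|\tilde u(t)-\tilde u_N(t)\|_{L^2(\mathcal O)}^p\big]\Big)^{1/p}\le C\,N^{-1}h^{H-1}.$$
   Context: Setting. $T>0$, $I=[0,T]$, $\mathcal O=(0,1)$, $0<H\le 1/2$, $b:\mathbb R\to\mathbb R$ is a fixed Lipschitz continuous function, and the homogeneous Dirichlet boundary condition is imposed. Noise. On a stochastic basis $(\Omega,\mathscr F,(\mathscr F_t)_{t\in I},\mathbb P)$, $W=\{W(t,x)\}_{(t,x)\in I\times\overline{\mathcal O}}$ is a centered Gaussian field with $\mathbb E[W(s,x)W(t,y)]=(s\wedge t)\,\frac{x^{2H}+y^{2H}-|x-y|^{2H}}{2}$, and $\xi=\frac{\partial^2W}{\partial t\,\partial x}$; thus for a rectangle, $\int_{(a,a']}\int_{(c,c']}\xi(ds,dy)=W(a',c')-W(a,c')-W(a',c)+W(a,c)$. Wong-Zakai approximation. For $m,n\in\mathbb N_+$ let $k=T/m$,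 $h=1/n$, $I_i=(ik,(i+1)k]$ ($0\le i\le m-1$), $\mathcal O_j=(jh,(j+1)h]$ ($0\le j\le n-1$), $\chi_{i,j}$ the indicator function of $I_i\times\mathcal O_j$, and $\tilde\xi(t,x)=\sum_{i=0}^{m-1}\sum_{j=0}^{n-1}\big[\frac1{kh}\int_{I_i}\int_{\mathcal O_j}\xi(ds,dy)\big]\chi_{i,j}(t,x)$. Spaces and mild solution. For $\alpha\in\mathbb N_+$, $\lambda_\alpha=(\alpha\pi)^2$, $\varphi_\alpha(x)=\sqrt2\sin(\sqrt{\lambda_\alpha}x)$; $\dot{\mathbb H}^\beta$ ($\beta\in\mathbb R$) has norm $\|v\|_\beta=\big(\sum_{\alpha\ge1}\lambda_\alpha^\beta(v,\varphi_\alpha)^2\big)^{1/2}$; $(\cdot,\cdot)$ is the inner product of $L^2(\mathcal O)$. With $\phi_\alpha(t)=\sin(\sqrt{\lambda_\alpha}t)/\sqrt{\lambda_\alpha}$ and $G_t(x,y)=\sum_{\alpha\ge1}\phi_\alpha(t)\varphi_\alpha(x)\varphi_\alpha(y)$, $\tilde u$ is the solution of $$\tilde u(t,x)=\int_{\mathcal O}G_t(x,y)v_0(y)\,dy+\int_{\mathcal O}\partial_tG_t(x,y)u_0(y)\,dy+\int_0^t\int_{\mathcal O}G_{t-s}(x,y)\big(b(\tilde u(s,y))+\tilde\xi(s,y)\big)dy\,ds,$$ with $\int_{\mathcal O}\partial_tG_t(x,y)u_0(y)\,dy$ understood as $\sum_\alpha\phi_\alpha'(t)(u_0,\varphi_\alpha)\varphi_\alpha(x)$.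 Spectral Galerkin approximation. $V_N=\mathrm{span}\{\varphi_\alpha\}_{\alpha=1}^N$ and $P_N:L^2(\mathcal O)\to V_N$ is the orthogonal projection. $\tilde u_N(t)\in V_N$ satisfies $\tilde u_N(0)=P_Nu_0$ and, for all $t>0$ (in $I$) and $v\in V_N$, $$(\partial_t\tilde u_N(t),v)=(P_Nv_0,v)+\int_0^t(\tilde u_N(s),\Delta v)\,ds+\int_0^t(b(\tilde u_N(s))+\tilde\xi(s),v)\,ds.$$ *)

(* Defs.v *)
From HB Require Import structures.
From mathcomp Require Import all_boot all_order all_algebra.
From mathcomp Require Import all_classical all_reals all_analysis.

Set Implicit Arguments.
Unset Strict Implicit.
Unset Printing Implicit Defensive.

Import Order.TTheory GRing.Theory Num.Theory.
Import numFieldNormedType.Exports.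

Local Open Scope classical_set_scope.
Local Open Scope ring_scope.

(* Elements of L^2(0,1) are represented by functions R -> R, of which only   *)
(* the values on (0,1) matter; inner products and norms do not distinguish    *)
(* functions equal a.e. on (0,1).  Elements of V_N are taken to be equal      *)
(* everywhere on (0,1) to a combination of eigenfunctions.                    *)

Section Spaces.
Context {R : realType}.
Implicit Types (v w d : R -> R) (a N : nat) (t x y beta : R).

Definition dom : set R := `]0, 1[.

Definition l2norm v : \bar R :=
  ('N[lebesgue_measure]_2%:E[EFin \o (v \_ dom)])%E.

Definition L2 : set (R -> R) :=
  [set v | measurable_fun dom v /\ (l2norm v < +oo)%E].

Definition ip v w : R := \int[lebesgue_measure]_(x in dom) (v x * w x).

Definition eigval a : R := (a%:R * pi) ^+ 2.

Definition eigfun a x : R := Num.sqrt 2 * sin (Num.sqrt (eigval a) * x).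

Definition hnorm beta v : \bar R :=
  ((\sum_(1 <= a <oo) (eigval a `^ beta * ip v (eigfun a) ^+ 2)%:E)
     `^ 2^-1)%E.

(* Only meant for 0 <= beta, where the space is contained in L^2. *)
Definition Hdot beta : set (R -> R) :=
  [set v | L2 v /\ (hnorm beta v < +oo)%E].

Definition wave_phi a t : R := sin (Num.sqrt (eigval a) * t) / Num.sqrt (eigval a).

(* The partial sums converge for all t, x, y (Dirichlet's test). *)
Definition wave_green t x y : R :=
  \big[+%R/0]_(1 <= a <oo) (wave_phi a t * eigfun a x * eigfun a y).

Definition wave_dgreen t v x : R :=
  \big[+%R/0]_(1 <= a <oo) (derive1 (wave_phi a) t * ip v (eigfun a) * eigfun a x).

Definition VN N : set (R -> R) :=
  [set v | exists c : nat -> R,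
     forall x, dom x -> v x = \sum_(1 <= a < N.+1) c a * eigfun a x].

(* The orthogonal projection of L^2 onto V_N, in the orthonormal basis of the *)
(* eigenfunctions.                                                            *)
Definition projN N v : R -> R :=
  fun x => \sum_(1 <= a < N.+1) ip v (eigfun a) * eigfun a x.

(* For a curve v : R -> L^2 restricted to the set J of times: continuity at t *)
(* and derivative d at t, in the L^2 norm (one-sided at an endpoint of J).    *)
Definition l2_continuous_at (J : set R) (v : R -> R -> R) t : Prop :=
  l2norm (fun x => v s x - v t x) @[s --> within J (nbhs t)] --> 0%E.

Definition l2_derive_at (J : set R) (v : R -> R -> R) t d : Prop :=
  l2norm (fun x => (v s x - v t x) / (s - t) - d x) @[s --> within J (t^')]
    --> 0%E.

End Spaces.

Section Randomness.
Context {d : measure_display} {Omega : measurableType d} {R : realType}.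
Variable P : probability Omega R.

(* U is open for the norm nrm, as far as elements of the space S are          *)
(* concerned.                                                                 *)
Definition norm_open (S : set (R -> R)) (nrm : (R -> R) -> \bar R)
    (U : set (R -> R)) : Prop :=
  forall v, S v -> U v -> exists2 e : R, 0 < e &
    forall w, S w -> (nrm (fun x => (w x - v x)%R) < e%:E)%E -> U w.

(* X belongs to L^p(Omega; S): it is a Borel measurable map into S with a     *)
(* finite p-th moment.  All the spaces S considered are separable.            *)
Definition LpOmega (p : R) (S : set (R -> R)) (nrm : (R -> R) -> \bar R)
    (X : Omega -> R -> R) : Prop :=
  [/\ forall w, S (X w),
      forall U, norm_open S nrm U -> measurable (X @^-1` U)
    & ('N[P]_p%:E[(nrm \o X)] < +oo)%E].

(* The library's normal_prob m 0 is the uniform law on [0, 1], whence the     *)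
(* separate clause for constants.                                             *)
Definition gaussian (X : Omega -> R) : Prop :=
  measurable_fun setT X /\
  exists m s : R, 0 <= s /\
    forall A : set R, measurable A ->
      P (X @^-1` A) = if s == 0 then \d_m A else normal_prob m s A.

Definition fractional_cov (H s x t y : R) : R :=
  Num.min s t * ((x `^ (2 * H) + y `^ (2 * H) - `|x - y| `^ (2 * H)) / 2).

(* W w t x for (t, x) in [0, T] x [0, 1] is a centered Gaussian field. *)
Definition fractional_noise (T H : R) (W : Omega -> R -> R -> R) : Prop :=
  let D : set (R * R) := `[0, T] `*` `[0, 1] in
  [/\ forall (k : nat) (c : 'I_k -> R) (q : 'I_k -> R * R),
        (forall i, D (q i)) ->
        gaussian (fun w => \sum_(i < k) c i * W w (q i).1 (q i).2),
      forall t x, D (t, x) -> ('E_P[(fun w => W w t x)] = 0)%E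
    & forall s x t y, D (s, x) -> D (t, y) ->
        ('E_P[(fun w => (W w s x * W w t y)%R)] = (fractional_cov H s x t y)%:E)%E].

(* Joint measurability on Omega x [0, T] x (0, 1). *)
Definition measurable_field (T : R) (u : Omega -> R -> R -> R) : Prop :=
  measurable_fun ([set: Omega] `*` (`[0, T] `*` dom))
    (fun z : Omega * (R * R) => u z.1 z.2.1 z.2.2).

End Randomness.

Section Wave.
Context {d : measure_display} {Omega : measurableType d} {R : realType}.
Variable P : probability Omega R.

Definition rect_incr (W : R -> R -> R) (a a' c c' : R) : R :=
  W a' c' - W a c' - W a' c + W a c.

(* The Wong-Zakai noise built from one path W of the field. *)
Definition wz_noise (T : R) (m n : nat) (W : R -> R -> R) (t x : R) : R :=
  let k := T / m%:R in
  let h := n%:R^-1 in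
  \sum_(0 <= i < m) \sum_(0 <= j < n)
    (k * h)^-1 * rect_incr W (i%:R * k) (i.+1%:R * k) (j%:R * h) (j.+1%:R * h)
    * \1_(`]i%:R * k, i.+1%:R * k] `*` `]j%:R * h, j.+1%:R * h]) (t, x).

Definition mild_solution (T : R) (b : R -> R) (u0 v0 : Omega -> R -> R)
    (xi : Omega -> R -> R -> R) (u : Omega -> R -> R -> R) : Prop :=
  [/\ measurable_field T u,
      {ae P, forall w, (lebesgue_measure \x lebesgue_measure)%E.-integrable
        (`[0, T] `*` dom) (fun z : R * R => (u w z.1 z.2)%:E)}
    & forall t x : R, 0 <= t <= T -> dom x -> {ae P, forall w,
        u w t x =
          \int[lebesgue_measure]_(y in dom) (wave_green t x y * v0 w y)
          + wave_dgreen t (u0 w) x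
          + \int[lebesgue_measure]_(s in `[0, t])
              \int[lebesgue_measure]_(y in dom)
                (wave_green (t - s) x y * (b (u w s y) + xi w s y))}].

Definition galerkin_solution (T : R) (b : R -> R) (N : nat)
    (u0 v0 : Omega -> R -> R) (xi : Omega -> R -> R -> R)
    (uN : Omega -> R -> R -> R) : Prop :=
  measurable_field T uN /\
  {ae P, forall w,
    [/\ forall t : R, 0 <= t <= T ->
          VN N (uN w t) /\ l2_continuous_at `[0, T] (uN w) t,
        forall x, dom x -> uN w 0 x = projN N (u0 w) x
      & forall t : R, 0 < t <= T -> exists duN : R -> R,
          [/\ VN N duN,
              l2_derive_at `[0, T] (uN w) t duN
            & forall v, VN N v ->
                ip duN v =
                  ip (projN N (v0 w)) v
                  + \int[lebesgue_measure]_(s in `[0, t]) ip (uN w s) (derive1n 2 v)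
                  + \int[lebesgue_measure]_(s in `[0, t])
                      ip (fun x => b (uN w s x) + xi w s x) v]]}.

End Wave.

(* Main.v *)
Require Import Defs.
From HB Require Import structures.
From mathcomp Require Import all_boot all_order all_algebra.
From mathcomp Require Import all_classical all_reals all_analysis.
From mathcomp Require Import measurable_realfun ring lra.

Set Implicit Arguments.
Unset Strict Implicit.
Unset Printing Implicit Defensive.

Import Order.TTheory GRing.Theory Num.Theory.
Import numFieldNormedType.Exports.

Local Open Scope classical_set_scope.
Local Open Scope ring_scope.

(** For almost every path, mild and Galerkin solution both have explicit sine
    coefficients, given by variation of constants; for the mild solution this
    uses that the series of the Green function converges boundedly (Abel
    summation), so that it may be integrated term by term.  Their difference is
    the tail [a > N] of the mild series plus a term which is Lipschitz in the
    error.  The tail costs a factor [N^-1] against the [Hdot 1] norm, in which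
    each Fourier coefficient gains [a pi] from the wave propagator, so that a
    Gronwall argument in time bounds the squared error by [N^-2] times
    [1 + |u0|_1^2 + |v0|^2 + Z(t) + \int_0^T Z], where [Z(t)] is the squared
    [Hdot 1] norm of the stochastic convolution of the Wong-Zakai noise.

    The coefficients of that convolution are Gaussian.  The increments of the
    field over distinct time steps are uncorrelated, so that the variances are
    at most [T] times those of a single time step, normalized to unit length;
    Bessel's inequality, applied to each path of the piecewise constant noise
    of that step, bounds the sum of the latter by a multiple of
    [h^-1 \sum_j E(\Delta_j W)^2], that is by [h^(2H-2)].  Moments of order [p]
    follow from the equivalence of Gaussian moments and Minkowski's inequality
    in [L^(p/2)]. *)

(** * The sine series with coefficients [1 / a]: bounded partial sums and convergence *)

Section SineSums.
Context {R : realType}.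
Implicit Types (t x y th : R) (a m n : nat).

(** The mild equation holds at each point [(t, x)] outside a null set of paths that depends on the
    point, whereas the energy argument runs along one path at almost all times. Failure of the sine
    series is therefore encoded as a single measurable set in path, time and space, and null sets
    are exchanged by Tonelli. This forces joint measurability of the coefficients, hence an iterated
    form of them.

    The mild solution is only assumed integrable in time and space. Gronwall needs a finite integral
    of squares, and obtains it from the uniform bound on the Green function. Since the inequality
    between energies is known at almost every time only, Gronwall is used in a form integrated in
    time.

    The noise is never measured in [L^2]: its mean square on a cell is [h^(2H-2) / k], which depends
    on the time step [k]. Its Duhamel term is kept whole as an energy, while the nonlinearity is
    estimated by its [L^2] norm. The terms free of noise are of order 1, and fit into the final rate
    because [h^(2H-2) >= 1]. *)

Lemma norm_sin_natM a th : `|sin (a%:R * th)| <= a%:R * `|sin th|.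
Proof.
elim: a => [|a IH]; first by rewrite !mul0r sin0 normr0.
rewrite -natr1 !mulrDl !mul1r sinD (le_trans (ler_normD _ _))// lerD//.
  rewrite normrM (le_trans _ IH)// ler_piMr// ?normr_ge0//.
  exact: cos_max.
by rewrite normrM ler_piMl// cos_max.
Qed.

(** Summation by parts: the weights [1 / a] decrease, so the differences of consecutive weights are
    nonnegative and telescope. *)
Lemma abel_le2 (D : nat -> R) m n : (0 < m)%N -> (forall a, `|D a| <= 1) ->
  `|\sum_(m <= a < n) (D a - D a.+1) / a%:R| <= 2 / m%:R.
Proof.
move=> m0 D1; have [nm|mn] := leqP n m.
  by rewrite big_geq// normr0 divr_ge0.
(* With the boundary term added, one more summand only contributes [d'] times the difference of two
   consecutive reciprocals; the right-hand side grows by exactly that difference. *)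
have key : forall k, `|\sum_(m <= a < m + k) (D a - D a.+1) / a%:R
     + D (m + k)%N / (m + k)%:R| <= 2 / m%:R - 1 / (m + k)%:R.
  elim=> [|k IH].
    rewrite addn0 big_geq// add0r normrM normfV normr_nat.
    have -> : 2 / m%:R - 1 / m%:R = 1 / m%:R :> R by rewrite -mulrBl; congr (_ / _); ring.
    by rewrite ler_pM2r ?invr_gt0 ?ltr0n.
  rewrite addnS big_nat_recr/=; last by rewrite leq_addr.
  set S := \sum_(_ <= _ < _) _ in IH *.
  set d := D (m + k)%N in IH *; set d' := D (m + k).+1.
  have mk0 : (0:R) < (m + k)%:R by rewrite ltr0n addn_gt0 m0.
  have mk1 : (0:R) < (m + k).+1%:R by rewrite ltr0n.
  have -> : S + (d - d') / (m + k)%:R + d' / (m + k).+1%:R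
     = (S + d / (m + k)%:R) - d' * (1 / (m + k)%:R - 1 / (m + k).+1%:R) by ring.
  rewrite (le_trans (ler_normB _ _))//.
  have p : 0 <= 1 / (m + k)%:R - 1 / (m + k).+1%:R :> R.
    by rewrite !div1r subr_ge0 lef_pV2 ?posrE// ler_nat.
  have q : `|d' * (1 / (m + k)%:R - 1 / (m + k).+1%:R)| <= 1 / (m + k)%:R - 1 / (m + k).+1%:R.
    by rewrite normrM (ger0_norm p) ler_piMl// D1.
  move: IH q; set i1 := 1 / (m + k)%:R; set i2 := 1 / (m + k).+1%:R; set i := 2 / m%:R.
  by set e1 := `|_|; set e2 := `|_| => *; lra.
have := key (n - m)%N; rewrite subnKC; last exact: ltnW.
set S := \sum_(_ <= _ < _) _ => H.
have n0 : (0:R) < n%:R by rewrite ltr0n (leq_trans _ mn).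
have := lerB_normD S (D n / n%:R) => H2.
have H3 : `|D n / n%:R| <= 1 / n%:R.
  by rewrite normrM normfV normr_nat ler_pM2r ?invr_gt0.
lra.
Qed.

(** The factor [sin (th / 2)] turns each numerator into half a difference of consecutive cosines, at
    half-odd multiples of [th], to which [abel_le2] applies. It stays on the left because it may
    vanish. *)
Lemma sin_sum_tail th m n : (0 < m)%N ->
  `|\sum_(m <= a < n) sin (a%:R * th) / a%:R| * `|sin (th / 2)| <= 1 / m%:R.
Proof.
move=> m0; pose D a := cos ((a%:R - 1 / 2) * th).
have DE a : sin (a%:R * th) * sin (th / 2) = (D a - D a.+1) / 2.
  rewrite /D -[a.+1%:R]natr1.
  have -> : (a%:R - 1 / 2) * th = a%:R * th - th / 2 by ring.
  have -> : (a%:R + 1 - 1 / 2) * th = a%:R * th + th / 2 by field.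
  by rewrite cosB cosD; field.
have : `|\sum_(m <= a < n) (D a - D a.+1) / a%:R| <= 2 / m%:R.
  by apply: abel_le2 => // a; exact: cos_max.
have -> : \sum_(m <= a < n) (D a - D a.+1) / a%:R =
    2 * (\sum_(m <= a < n) sin (a%:R * th) / a%:R * sin (th / 2)).
  rewrite mulr_sumr; apply: eq_bigr => a _.
  have := DE a; set u := sin _; set v := sin _; set i := a%:R^-1 => E.
  by rewrite (_ : 2 * (u * i * v) = 2 * (u * v) * i); [rewrite E; field|ring].
rewrite -mulr_suml !normrM normr_nat => H.
have : 2 * (`|\sum_(m <= a < n) sin (a%:R * th) / a%:R| * `|sin (th / 2)|)
  <= 2 * (1 / m%:R) by rewrite mul1r.
by rewrite ler_pM2l.
Qed.

Lemma norm_sin_div_le a th : `|sin (a%:R * th) / a%:R| <= 2 * `|sin (th / 2)|.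
Proof.
case: a => [|a]; first by rewrite invr0 mulr0 normr0 mulr_ge0.
rewrite normrM normfV normr_nat ler_pdivrMr ?ltr0n//.
rewrite (le_trans (norm_sin_natM _ _))// mulrC ler_wpM2r// ?ler0n//.
have -> : sin th = 2 * (cos (th / 2) * sin (th / 2)).
  by rewrite mulr_natl -sin_mulr2n -mulr_natr; congr sin; field.
rewrite !normrM normr_nat ler_pM2l// ler_piMl//.
exact: cos_max.
Qed.

(** The sum is cut at about [1 / s], where [s] is the modulus of [sin (th / 2)]. Before the cut
    there are at most [1 / s] terms of size at most [2 * s]; after it, the tail bound gives at most
    1. If [s] vanishes, so does every term. *)
Lemma norm_sin_sum_le th n : `|\sum_(1 <= a < n) sin (a%:R * th) / a%:R| <= 3.
Proof.
have [s0|s0] := eqVneq (sin (th / 2)) 0.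
  rewrite big1 ?normr0// => a _; apply/eqP; rewrite -normr_le0.
  by rewrite (le_trans (norm_sin_div_le _ _))// s0 normr0 mulr0.
set s := `|sin (th / 2)|; have sp : 0 < s by rewrite normr_gt0.
have [K /andP[K1 K2]] : exists K : nat, K%:R <= s^-1 < K.+1%:R.
  exists (Num.truncn s^-1); apply: truncn_itv.
  by rewrite invr_ge0 ltW.
have head k : (k <= K.+1)%N -> `|\sum_(1 <= a < k) sin (a%:R * th) / a%:R| <= 2.
  move=> kK; rewrite (le_trans (ler_norm_sum _ _ _))//.
  rewrite (@le_trans _ _ (\sum_(1 <= a < k) 2 * s))//.
    by apply: ler_sum => a _; exact: norm_sin_div_le.
  rewrite sumr_const_nat -[leLHS]mulr_natl.
  rewrite (@le_trans _ _ (K%:R * (2 * s)))//.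
    apply: ler_wpM2r; first by rewrite mulr_ge0// ltW.
    by rewrite ler_nat leq_subLR add1n.
  have Ks : K%:R * s <= 1 by rewrite -ler_pdivlMr// div1r.
  by rewrite mulrCA; lra.
have [nK|Kn] := leqP n K.+1; first by rewrite (le_trans (head _ nK))// ler_nat.
rewrite (big_cat_nat (n := K.+1))//=; last exact: ltnW.
rewrite (le_trans (ler_normD _ _))//.
rewrite (_ : 3 = 2 + 1 :> R); last by ring.
rewrite lerD ?head//.
have := @sin_sum_tail th K.+1 n isT; rewrite -/s -ler_pdivlMr// => /le_trans; apply.
rewrite div1r -invfM invf_le1; last by rewrite mulr_gt0 ?ltr0n.
by move: K2; rewrite -(ltr_pM2r sp) mulVf ?gt_eqF// => /ltW.
Qed.

Lemma is_cvg_sin_sum th : cvgn (fun n => \sum_(1 <= a < n) sin (a%:R * th) / a%:R).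
Proof.
rewrite (_ : (fun n => _) = series (fun a => sin (a%:R * th) / a%:R)); last first.
  apply/funext => n; rewrite /series/=; case: n => [|n]; first by rewrite !big_geq.
  by rewrite [RHS]big_ltn// mul0r sin0 mul0r add0r.
have [s0|s0] := eqVneq (sin (th / 2)) 0.
  apply/cvg_ex; exists 0; rewrite (_ : series _ = cst 0); first exact: cvg_cst.
  apply/funext => n; rewrite /series/= big1// => a _; apply/eqP; rewrite -normr_le0.
  by rewrite (le_trans (norm_sin_div_le _ _))// s0 normr0 mulr0.
set s := `|sin (th / 2)|; have sp : 0 < s by rewrite normr_gt0.
apply/cauchy_cvgP/cauchy_seriesP => e e0.
pose M := (Num.truncn (1 / (s * e))).+1.
exists (`[M, +oo[, `[M, +oo[)%classic; first by split; exists M => // k /=; rewrite in_itv/= andbT.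
move=> [i j] /= []; rewrite !in_itv/= !andbT => Mi _.
have i0 : (0 < i)%N by rewrite (leq_trans _ Mi).
have := @sin_sum_tail th i j i0; rewrite -/s -ler_pdivlMr// => /le_lt_trans; apply.
rewrite div1r -invfM invf_plt ?posrE ?mulr_gt0 ?ltr0n//.
rewrite -ltr_pdivrMr// (@lt_le_trans _ _ M%:R)//.
  rewrite -invfM mulrC -div1r /M; exact: truncnS_gt.
by rewrite ler_nat.
Qed.

End SineSums.

(** * The Green function as a boundedly convergent series *)

Section Green.
Context {R : realType}.
Implicit Types (t x y : R) (a n : nat).

Lemma sqrt_eigval a : Num.sqrt (@eigval R a) = a%:R * pi.
Proof. by rewrite /eigval sqrtr_sqr ger0_norm// mulr_ge0 ?ler0n ?pi_ge0. Qed.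

Lemma wave_phiE a t : wave_phi a t = sin (a%:R * pi * t) / (a%:R * pi).
Proof. by rewrite /wave_phi sqrt_eigval. Qed.

Lemma eigfunE a x : eigfun a x = Num.sqrt 2 * sin (a%:R * pi * x).
Proof. by rewrite /eigfun sqrt_eigval. Qed.

Definition green_sum n t x y : R :=
  \sum_(1 <= a < n) wave_phi a t * eigfun a x * eigfun a y.

(** Four times a product of three sines is a signed sum of four sines. This reduces the kernel to
    sine series in one angle, with bounds uniform in [t], [x] and [y]. *)
Lemma green_sumE n t x y : green_sum n t x y = (2 * pi)^-1 *
  ((\sum_(1 <= a < n) sin (a%:R * (pi * (t + x - y))) / a%:R) +
  (\sum_(1 <= a < n) sin (a%:R * (pi * (t + y - x))) / a%:R) +
  (\sum_(1 <= a < n) sin (a%:R * (pi * (x + y - t))) / a%:R) -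
  (\sum_(1 <= a < n) sin (a%:R * (pi * (t + x + y))) / a%:R)).
Proof.
rewrite /green_sum -!big_split/= -sumrB mulr_sumr.
rewrite big_nat_cond [RHS]big_nat_cond; apply: eq_bigr => a /andP[/andP[a1 _] _].
rewrite wave_phiE !eigfunE.
set A := a%:R * pi * t; set B := a%:R * pi * x; set C := a%:R * pi * y.
have -> : a%:R * (pi * (t + x - y)) = A + B - C by rewrite /A /B /C; ring.
have -> : a%:R * (pi * (t + y - x)) = A + C - B by rewrite /A /B /C; ring.
have -> : a%:R * (pi * (x + y - t)) = B + C - A by rewrite /A /B /C; ring.
have -> : a%:R * (pi * (t + x + y)) = A + B + C by rewrite /A /B /C; ring.
have -> : sin A / (a%:R * pi) * (Num.sqrt 2 * sin B) * (Num.sqrt 2 * sin C)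
   = (Num.sqrt 2 ^+ 2) * (sin A * sin B * sin C) / (a%:R * pi).
  by rewrite expr2; ring.
rewrite sqr_sqrtr//.
have a0 : (a%:R : R) != 0 by rewrite pnatr_eq0 -lt0n.
have p0 : (pi : R) != 0 by rewrite gt_eqF// pi_gt0.
have -> : sin (A + B - C) / a%:R + sin (A + C - B) / a%:R + sin (B + C - A) / a%:R
  - sin (A + B + C) / a%:R = 4 * (sin A * sin B * sin C) / a%:R.
  by rewrite !(sinD, cosD, sinN, cosN); field.
move: (sin A * _ * _) (pi : R) p0 => S q q0; field.
by rewrite q0 a0.
Qed.

Lemma norm_green_sum n t x y : `|green_sum n t x y| <= 6.
Proof.
rewrite green_sumE; set A := \sum_(_ <= _ < _) _; set B := \sum_(_ <= _ < _) _.
set C := \sum_(_ <= _ < _) _; set D := \sum_(_ <= _ < _) _.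
have A3 : `|A| <= 3 by exact: norm_sin_sum_le.
have B3 : `|B| <= 3 by exact: norm_sin_sum_le.
have C3 : `|C| <= 3 by exact: norm_sin_sum_le.
have D3 : `|D| <= 3 by exact: norm_sin_sum_le.
have p2 := @pi_ge2 R.
have p0 : 0 <= 2 * pi :> R by lra.
rewrite normrM normfV (ger0_norm p0) mulrC ler_pdivrMr; last lra.
rewrite (@le_trans _ _ 12)//; last lra.
move: A3 B3 C3 D3; rewrite !ler_norml => /andP[? ?] /andP[? ?] /andP[? ?] /andP[? ?].
apply/andP; split; lra.
Qed.

Lemma cvg_green_sum t x y : green_sum n t x y @[n --> \oo] --> wave_green t x y.
Proof.
have : cvgn (fun n => green_sum n t x y).
  under eq_fun do rewrite green_sumE.
  apply: is_cvgM; first exact: is_cvg_cst.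
  by apply: is_cvgB; [apply: is_cvgD; [apply: is_cvgD|]|]; exact: is_cvg_sin_sum.
by [].
Qed.

Lemma norm_wave_green t x y : `|wave_green t x y| <= 6.
Proof.
have := @cvg_green_sum t x y => /cvg_norm.
move/(@cvg_lim _ (@Rhausdorff R)) => <-.
apply: limr_le; first by apply: is_cvg_norm; apply/cvg_ex; exists (wave_green t x y); exact: cvg_green_sum.
by near=> n; exact: norm_green_sum.
Unshelve. all: by end_near. Qed.

End Green.

(** * Real-valued integrals, Bessel's inequality and Cauchy-Schwarz *)

Section IntegrationToolkit.
Context {d} {T : measurableType d} {R : realType}.
Implicit Types (mu : {measure set T -> \bar R}) (f g : T -> R).

Lemma le_integrableR mu f g : measurable_fun setT f ->
  (forall x, `|f x| <= g x) -> mu.-integrable setT (EFin \o g) ->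
  mu.-integrable setT (EFin \o f).
Proof.
move=> mf fg ig; apply: le_integrable ig => //; first exact/measurable_EFinP.
by move=> x _ /=; rewrite lee_fin (le_trans (fg x))// ler_norm.
Qed.

Lemma integrableDR mu f g : mu.-integrable setT (EFin \o f) ->
  mu.-integrable setT (EFin \o g) -> mu.-integrable setT (EFin \o (fun x => f x + g x)).
Proof. by move=> fi gi; exact: (integrableD measurableT fi gi). Qed.

Lemma integrableBR mu f g : mu.-integrable setT (EFin \o f) ->
  mu.-integrable setT (EFin \o g) -> mu.-integrable setT (EFin \o (fun x => f x - g x)).
Proof. by move=> fi gi; exact: (integrableB measurableT fi gi). Qed.

Lemma integrableZR mu k f : mu.-integrable setT (EFin \o f) ->
  mu.-integrable setT (EFin \o (fun x => k * f x)).
Proof. by move=> fi; exact: (integrableZl measurableT k fi). Qed.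

Lemma integrableM_bnd mu f g M : mu.-integrable setT (EFin \o f) ->
  measurable_fun setT g -> (forall x, `|g x| <= M) ->
  mu.-integrable setT (EFin \o (fun x => f x * g x)).
Proof.
move=> fi mg gM; have mf : measurable_fun setT f.
  by apply/measurable_EFinP; exact: (measurable_int mu).
have : mu.-integrable setT (EFin \o (fun x => M * `|f x|)).
  by apply: integrableZR; exact: integrable_norm.
apply: le_integrableR; first exact: measurable_funM.
by move=> x; rewrite normrM mulrC ler_wpM2r.
Qed.

Lemma integrable_bnd (mu : {finite_measure set T -> \bar R}) g M :
  measurable_fun setT g -> (forall x, `|g x| <= M) ->
  mu.-integrable setT (EFin \o g).
Proof.
move=> mg gM; apply: (le_integrableR (g := cst M)) => //.
exact: finite_measure_integrable_cst.
Qed.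

Lemma Rintegral_sumr mu (I : eqType) (r : seq I) (F : I -> T -> R) :
  (forall i, i \in r -> mu.-integrable setT (EFin \o F i)) ->
  \int[mu]_x (\sum_(i <- r) F i x) = \sum_(i <- r) \int[mu]_x F i x.
Proof.
move=> Fi.
suff [] : mu.-integrable setT (EFin \o (fun x => \sum_(i <- r) F i x)) /\
   \int[mu]_x (\sum_(i <- r) F i x) = \sum_(i <- r) \int[mu]_x F i x by [].
elim: r Fi => [|i r IH] Fi.
  split; last by rewrite big_nil; under eq_Rintegral do rewrite big_nil;
    rewrite /Rintegral integral0.
  rewrite (_ : EFin \o _ = cst 0%E); first exact: integrable0.
  by apply/funext => x/=; rewrite big_nil.
have [ri rE] : mu.-integrable setT (EFin \o (fun x => \sum_(i <- r) F i x)) /\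
   \int[mu]_x (\sum_(i <- r) F i x) = \sum_(i <- r) \int[mu]_x F i x.
  by apply: IH => j jr; apply: Fi; rewrite in_cons jr orbT.
have ii : mu.-integrable setT (EFin \o F i) by apply: Fi; rewrite mem_head.
split.
  under eq_fun do rewrite big_cons.
  exact: integrableDR.
under eq_Rintegral do rewrite big_cons.
by rewrite RintegralD// rE big_cons.
Qed.

Lemma integrable_sumr mu (I : eqType) (r : seq I) (F : I -> T -> R) :
  (forall i, i \in r -> mu.-integrable setT (EFin \o F i)) ->
  mu.-integrable setT (EFin \o (fun x => \sum_(i <- r) F i x)).
Proof.
elim: r => [|i r IH] Fi.
  rewrite (_ : EFin \o _ = cst 0%E); first exact: integrable0.
  by apply/funext => x/=; rewrite big_nil.
under eq_fun do rewrite big_cons.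
apply: integrableDR => //; first by apply: Fi; rewrite mem_head.
by apply: IH => j jr; apply: Fi; rewrite in_cons jr orbT.
Qed.

Lemma Rintegral_dominated mu (f_ : nat -> T -> R) f g :
  (forall n, measurable_fun setT (f_ n)) ->
  (forall x, f_ n x @[n --> \oo] --> f x) ->
  mu.-integrable setT (EFin \o g) -> (forall n x, `|f_ n x| <= g x) ->
  mu.-integrable setT (EFin \o f) /\
  \int[mu]_x f_ n x @[n --> \oo] --> \int[mu]_x f x.
Proof.
move=> mf cf gi fg.
have mlim : measurable_fun setT f.
  by apply: (measurable_fun_cvg mf) => x _; exact: cf.
have [] := @dominated_convergence _ _ _ mu setT measurableT (fun n => EFin \o f_ n) (EFin \o f) (EFin \o g).
- by move=> n; exact/measurable_EFinP.
- exact/measurable_EFinP.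
- by apply: aeW => x _; apply: cvg_EFin; [exact: nearW|exact: cf].
- exact: gi.
- by apply: aeW => x n _ /=; rewrite lee_fin.
move=> fi _ H; split=> //; rewrite /Rintegral.
apply: fine_cvg; rewrite fineK//; exact: integrable_fin_num.
Qed.

Lemma Rintegral_sqr_ge mu f : \int[mu]_x (f x ^+ 2) >= 0.
Proof. by apply: Rintegral_ge0 => x _; exact: sqr_ge0. Qed.

(** Kept in the extended reals, so that an estimate can be stated before the finiteness of either
    side is known. *)
Definition sqint mu f : \bar R := (\int[mu]_x ((f x) ^+ 2)%:E)%E.

Lemma sqint_ge0 mu f : (0 <= sqint mu f)%E.
Proof. by apply: integral_ge0 => x _; rewrite lee_fin sqr_ge0. Qed.

Lemma sqint_integrable_sqr mu f : measurable_fun setT f -> (sqint mu f < +oo)%E ->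
  mu.-integrable setT (EFin \o (fun x => f x ^+ 2)).
Proof.
move=> mf fo; apply/integrableP; split.
  by apply/measurable_EFinP; exact: measurable_funX.
rewrite (le_lt_trans _ fo)//; under eq_integral => x _ do rewrite /= ger0_norm ?sqr_ge0//.
exact: lexx.
Qed.

Lemma sqint_integrable (mu : {finite_measure set T -> \bar R}) f :
  measurable_fun setT f -> (sqint mu f < +oo)%E -> mu.-integrable setT (EFin \o f).
Proof.
move=> mf fo.
have : mu.-integrable setT (EFin \o (fun x => 1 + f x ^+ 2)).
  apply: integrableDR; first exact: (finite_measure_integrable_cst _ 1).
  exact: sqint_integrable_sqr.
apply: le_integrableR => // x.
have := sqr_ge0 (`|f x| - 1); rewrite -[f x ^+ 2]real_normK ?num_real//.
have := normr_ge0 (f x); set u := `|_| => u0; nra.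
Qed.

Section Bessel.
Variables (mu : {finite_measure set T -> \bar R}) (e : nat -> T -> R) (M : R).
Hypothesis me : forall a, measurable_fun setT (e a).
Hypothesis eM : forall a x, `|e a x| <= M.
Variable r : seq nat.
Hypothesis ur : uniq r.
Hypothesis ort : {in r &, forall i j, \int[mu]_x (e i x * e j x) = (i == j)%:R}.

Lemma measurable_lincomb (c : nat -> R) :
  measurable_fun setT (fun x => \sum_(a <- r) c a * e a x).
Proof. by apply: measurable_sum => a; apply: measurable_funM. Qed.

Lemma bnd_lincomb (c : nat -> R) x :
  `|\sum_(a <- r) c a * e a x| <= \sum_(a <- r) `|c a| * M.
Proof.
rewrite (le_trans (ler_norm_sum _ _ _))//; apply: ler_sum => a _.
by rewrite normrM ler_wpM2l.
Qed.

Lemma Rintegral_lincomb f (c : nat -> R) : mu.-integrable setT (EFin \o f) ->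
  \int[mu]_x (f x * \sum_(a <- r) c a * e a x) =
  \sum_(a <- r) c a * \int[mu]_x (f x * e a x).
Proof.
move=> fi.
have H a : mu.-integrable setT (EFin \o (fun x => f x * e a x)).
  exact: (integrableM_bnd (M := M)).
rewrite (_ : (fun x => _) = (fun x => \sum_(a <- r) c a * (f x * e a x))); last first.
  by apply/funext => x; rewrite mulr_sumr; apply: eq_bigr => a _; rewrite mulrCA.
rewrite Rintegral_sumr; last first.
  by move=> a _; exact: integrableZR.
by apply: eq_bigr => a _; rewrite RintegralZl.
Qed.

Lemma Rintegral_sqr_lincomb (c : nat -> R) :
  \int[mu]_x ((\sum_(a <- r) c a * e a x) ^+ 2) = \sum_(a <- r) c a ^+ 2.
Proof.
under eq_Rintegral do rewrite expr2.
rewrite Rintegral_lincomb; last first.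
  by apply: integrable_bnd; [exact: measurable_lincomb|exact: bnd_lincomb].
apply: eq_big_seq => a ar; rewrite expr2; congr (_ * _).
under eq_Rintegral do rewrite mulrC.
rewrite Rintegral_lincomb; last by apply: integrable_bnd.
rewrite (bigD1_seq a)//= ort// eqxx mulr1 big1_seq ?addr0//.
by move=> b /andP[ba br]; rewrite ort// eq_sym (negbTE ba) mulr0.
Qed.

Lemma sqint_lincomb (c : nat -> R) :
  sqint mu (fun x => \sum_(a <- r) c a * e a x) = (\sum_(a <- r) c a ^+ 2)%:E.
Proof.
rewrite -Rintegral_sqr_lincomb /Rintegral fineK//.
apply: integrable_fin_num => //.
apply: (@integrable_bnd mu _ ((\sum_(a <- r) `|c a| * M) ^+ 2)).
  by apply: measurable_funX; exact: measurable_lincomb.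
move=> x; rewrite normrX lerXn2r ?nnegrE//; last exact: bnd_lincomb.
by rewrite (le_trans _ (bnd_lincomb c x)).
Qed.

(** Expand the integral of [(f - w) ^+ 2 >= 0], where [w] is the projection of [f] onto the family;
    an infinite right-hand side is trivial. *)
Lemma bessel f : measurable_fun setT f ->
  ((\sum_(a <- r) (\int[mu]_x (f x * e a x)) ^+ 2)%:E <= sqint mu f)%E.
Proof.
move=> mf; have [fo|] := ltP (sqint mu f) +oo%E; last by rewrite leye_eq => /eqP ->; rewrite leey.
set c := fun a => \int[mu]_x (f x * e a x).
pose w x := \sum_(a <- r) c a * e a x.
have fi := sqint_integrable mf fo.
have f2i := sqint_integrable_sqr mf fo.
have mw : measurable_fun setT w by exact: measurable_lincomb.
have wb x : `|w x| <= \sum_(a <- r) `|c a| * M by exact: bnd_lincomb.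
have wi : mu.-integrable setT (EFin \o w) by exact: (@integrable_bnd mu w _ mw wb).
have w2i : mu.-integrable setT (EFin \o (fun x => w x ^+ 2)).
  by under eq_fun do rewrite expr2; exact: (integrableM_bnd wi mw wb).
have fwi : mu.-integrable setT (EFin \o (fun x => f x * w x)) by exact: (integrableM_bnd fi mw wb).
have H : 0 <= \int[mu]_x ((f x - w x) ^+ 2) by exact: Rintegral_sqr_ge.
have E : \int[mu]_x ((f x - w x) ^+ 2) = \int[mu]_x (f x ^+ 2 - (2 * (f x * w x) - w x ^+ 2)).
  by apply: eq_Rintegral => x _; ring.
have i2 : mu.-integrable setT (EFin \o (fun x => 2 * (f x * w x))).
  exact: integrableZR.
have i3 : mu.-integrable setT (EFin \o (fun x => 2 * (f x * w x) - w x ^+ 2)).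
  exact: integrableBR.
rewrite E RintegralB// RintegralB// RintegralZl// Rintegral_sqr_lincomb Rintegral_lincomb// in H.
rewrite -[sqint _ _]fineK; last by rewrite ge0_fin_numE ?sqint_ge0.
rewrite lee_fin -/(Rintegral mu setT (fun x => f x ^+ 2)).
have EE : \sum_(a <- r) c a * \int[mu]_x (f x * e a x) = \sum_(a <- r) c a ^+ 2.
  by apply: eq_bigr => a _; rewrite expr2.
rewrite EE in H.
by move: H; rewrite /c; lra.
Qed.

End Bessel.

(** Cauchy-Schwarz against a constant: expand the integral of [(f x - c) ^+ 2 >= 0] at [c = I / M].
    An upper bound [M] of the total mass suffices. *)
Lemma sqr_Rintegral_le (mu : {finite_measure set T -> \bar R}) (f : T -> R) (M : R) :
  0 < M -> (mu setT <= M%:E)%E -> measurable_fun setT f ->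
  (((\int[mu]_x f x) ^+ 2)%:E <= M%:E * sqint mu f)%E.
Proof.
move=> M0 muM mf.
have [fo|] := ltP (sqint mu f) +oo%E; last first.
  by rewrite leye_eq => /eqP ->; rewrite gt0_muley ?lte_fin// leey.
have fi := sqint_integrable mf fo.
have f2i := sqint_integrable_sqr mf fo.
set I := \int[mu]_x f x; set c := I / M.
have ci : mu.-integrable setT (EFin \o cst (c ^+ 2)) by exact: finite_measure_integrable_cst.
have i2 : mu.-integrable setT (EFin \o (fun x => (2 * c) * f x)) by exact: integrableZR.
have H : 0 <= \int[mu]_x ((f x - c) ^+ 2) by exact: Rintegral_sqr_ge.
have E : \int[mu]_x ((f x - c) ^+ 2) = \int[mu]_x (f x ^+ 2 - ((2 * c) * f x - c ^+ 2)).
  by apply: eq_Rintegral => x _; ring.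
rewrite E RintegralB// in H; last exact: integrableBR.
rewrite RintegralB// RintegralZl// Rintegral_cst// -/I in H.
rewrite -[sqint _ _]fineK; last by rewrite ge0_fin_numE ?sqint_ge0.
rewrite -EFinM lee_fin (_ : fine _ = \int[mu]_x (f x ^+ 2))//.
have muR : fine (mu setT) <= M.
  by rewrite -lee_fin fineK//; exact: fin_num_measure.
have H2 : c ^+ 2 * fine (mu setT) <= c ^+ 2 * M by rewrite ler_wpM2l// sqr_ge0.
have cM : c * M = I by rewrite /c divfK// gt_eqF.
set J := \int[mu]_x _ in H *.
have H3 : 2 * c * I <= J + c ^+ 2 * M by lra.
have H4 : c * I <= J by move: H3; rewrite -cM; nra.
by rewrite expr2 -{1}cM -mulrA mulrCA ler_pM2l.
Qed.

End IntegrationToolkit.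

(** * Restricted measures, parametric integrals and Fubini *)

Definition frestr d (T : measurableType d) (R : realType)
    (mu : {measure set T -> \bar R}) D (mD : measurable D) (fD : (mu D < +oo)%E) :
  {finite_measure set T -> \bar R} := mfrestr mD fD.

Section RestrictedMeasure.
Context {d} {T : measurableType d} {R : realType}.
Variables (mu : {measure set T -> \bar R}) (D : set T) (mD : measurable D).
Hypothesis moo : (mu D < +oo)%E.
Local Notation muD := (frestr mD moo).

Lemma frestr_ae : {ae muD, forall x, D x}.
Proof.
exists (~` D); split; first exact: measurableC.
  by rewrite /frestr /= /mfrestr /mrestr setICl measure0.
by [].
Qed.

Lemma integral_frestr_in (f : T -> \bar R) :
  (\int[mu]_(x in D) f x = \int[muD]_(x in D) f x)%E.
Proof.
apply: eq_measure_integral => A mA AD.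
by transitivity (mu (A `&` D)) => //; rewrite setIidl.
Qed.

Lemma integral_frestr (f : T -> \bar R) : measurable_fun setT f ->
  (\int[mu]_(x in D) f x = \int[muD]_x f x)%E.
Proof.
move=> mf; rewrite integral_frestr_in [LHS]integral_mkcond.
apply: ae_eq_integral => //.
  by apply/(measurable_restrictT f mD); exact: measurable_funTS.
have := frestr_ae; apply: filterS => x Dx _.
by rewrite patchE mem_set.
Qed.

Lemma Rintegral_frestr (f : T -> R) : measurable_fun setT f ->
  \int[mu]_(x in D) f x = \int[muD]_x f x.
Proof.
by move=> mf; rewrite /Rintegral integral_frestr//; exact/measurable_EFinP.
Qed.

Lemma Rintegral_frestr_patch (f : T -> R) : measurable_fun D f ->
  \int[mu]_(x in D) f x = \int[muD]_x (f \_ D) x.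
Proof.
move=> mf; rewrite Rintegral_mkcond -Rintegral_frestr; last exact/(measurable_restrictT _ mD).
rewrite [RHS]Rintegral_mkcond; apply: eq_Rintegral => x _.
by rewrite !patchE; case: ifPn.
Qed.

End RestrictedMeasure.

Section ParametricIntegral.
Context {d1 d2} {X : measurableType d1} {Y : measurableType d2} {R : realType}.
Variable m2 : {sigma_finite_measure set Y -> \bar R}.

(** The positive and negative parts are measurable in the parameter by Tonelli; where the difference
    of their integrals is infinite, [fine] gives the value 0. *)
Lemma measurable_fun_Rintegral (f : X * Y -> R) : measurable_fun setT f ->
  measurable_fun setT (fun x => \int[m2]_y f (x, y)).
Proof.
move=> mf; rewrite /Rintegral.
apply: (@measurableT_comp _ _ _ _ _ _ (fine : \bar R -> R)) => //.
rewrite (_ : (fun x => _) = (fun x => \int[m2]_y ((EFin \o f)^\+ (x, y)))%E \- (fun x => \int[m2]_y ((EFin \o f)^\- (x, y)))%E)%E; last first.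
  apply/funext => x; rewrite integralE; congr (_ - _)%E; apply: eq_integral => y _.
    by rewrite !funeposE.
  by rewrite !funenegE.
have mEf : measurable_fun setT (EFin \o f) by exact/measurable_EFinP.
apply: emeasurable_funB.
  by apply: (@measurable_fun_fubini_tonelli_F _ _ _ _ _ m2 ((EFin \o f)^\+)%E) => //;
     exact: measurable_funepos.
by apply: (@measurable_fun_fubini_tonelli_F _ _ _ _ _ m2 ((EFin \o f)^\-)%E) => //;
   exact: measurable_funeneg.
Qed.

End ParametricIntegral.

Section FubiniReal.
Context {d1 d2} {X : measurableType d1} {Y : measurableType d2} {R : realType}.
Variables (m1 : {sigma_finite_measure set X -> \bar R}) (m2 : {sigma_finite_measure set Y -> \bar R}).

(** The inner real integral equals the extended one only where the latter is finite, that is on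
    almost every section, so the two outer integrands are compared almost everywhere. *)
Lemma Rintegral_fubini1 (f : X * Y -> R) : (m1 \x m2)%E.-integrable setT (EFin \o f) ->
  \int[(m1 \x m2)%E]_z f z = \int[m1]_x \int[m2]_y f (x, y).
Proof.
move=> fi; rewrite /Rintegral; congr fine.
rewrite -(integral12_prod_meas1 fi).
have mF := measurable_fubini_F fi.
apply: ae_eq_integral => //.
  apply/measurable_EFinP.
  by apply: (@measurable_fun_Rintegral _ _ _ _ _ m2); apply/measurable_EFinP; exact: (measurable_int _ fi).
have := ae_integrable1 fi; apply: filterS => x xi _ /=.
by rewrite fineK//; exact: integrable_fin_num.
Qed.

Lemma Rintegral_fubini2 (f : X * Y -> R) : (m1 \x m2)%E.-integrable setT (EFin \o f) ->
  \int[(m1 \x m2)%E]_z f z = \int[m2]_y \int[m1]_x f (x, y).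
Proof.
move=> fi; rewrite /Rintegral; congr fine.
rewrite -(integral21_prod_meas1 fi).
have mG := measurable_fubini_G fi.
apply: ae_eq_integral => //.
  apply/measurable_EFinP.
  have mf : measurable_fun setT f by apply/measurable_EFinP; exact: (measurable_int _ fi).
  apply: (@measurable_fun_Rintegral _ _ _ _ _ m1 (f \o (fun z => (z.2, z.1)))).
  by apply: measurableT_comp => //; exact: measurable_fun_pair.
have := ae_integrable2 fi; apply: filterS => x xi _ /=.
by rewrite fineK//; exact: integrable_fin_num.
Qed.

Lemma integrable_fubini_Rintegral (f : X * Y -> R) : (m1 \x m2)%E.-integrable setT (EFin \o f) ->
  m1.-integrable setT (EFin \o (fun x => \int[m2]_y f (x, y))).
Proof.
move=> fi; have mf : measurable_fun setT f by apply/measurable_EFinP; exact: (measurable_int _ fi).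
have mF : measurable_fun setT (EFin \o (fun x => \int[m2]_y f (x, y))).
  by apply/measurable_EFinP; exact: measurable_fun_Rintegral.
have := integrable_fubini_F fi => /integrableP[mF' Fo].
apply/integrableP; split => //; rewrite (le_lt_trans _ Fo)//.
rewrite (@ae_eq_integral _ _ _ m1 setT (fun x => `|fubini_F m2 (EFin \o f) x|)%E)//.
- by apply: measurableT_comp.
- by apply: measurableT_comp.
have := ae_integrable1 fi; apply: filterS => x xi _ /=.
transitivity (`|(\int[m2]_y f (x, y))%:E|%E) => //.
by rewrite /fubini_F fineK//; exact: integrable_fin_num.
Qed.

(** Integrating the measures of the sections in either direction gives the same value, by Tonelli
    for the indicator of [A], and here this value is 0. The lemma trades exceptional sets that
    depend on a point [y] for a single exceptional set of points [x]. *)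
Lemma ae_prod1 (A : set (X * Y)) : measurable A -> {ae m2, forall y, m1 (ysection A y) = 0%E} ->
  {ae m1, forall x, {ae m2, forall y, ~ A (x, y)}}.
Proof.
move=> mA A0.
have E : (\int[m1]_x (m2 (xsection A x)) = \int[m2]_y (m1 (ysection A y)))%E.
  have := @indic_fubini_tonelli _ _ _ _ _ m1 m2 A mA.
  rewrite (@indic_fubini_tonelli_FE _ _ _ _ _ m2 A mA).
  by rewrite (@indic_fubini_tonelli_GE _ _ _ _ _ m1 A mA).
have : ae_eq m1 setT (fun x => m2 (xsection A x)) (cst 0%E).
  apply/ae_eq_integral_abs => //; first exact: measurable_fun_xsection.
  under eq_integral do rewrite gee0_abs//.
  rewrite E (@ae_eq_integral _ _ _ m2 setT (cst 0%E))//=.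
  - by rewrite integral0.
  - exact: measurable_fun_ysection.
  - by move: A0; apply: filterS => y /=.
apply: filterS => x /= /(_ I) x0.
exists (xsection A x); split => //; first exact: measurable_xsection.
by move=> y /= /contrapT Axy; rewrite /xsection/= inE.
Qed.

End FubiniReal.

Section RintegralScale.
Context {d} {T : measurableType d} {R : realType}.

(** If [f] is not integrable, its extended integral is infinite ([+oo - +oo] being [-oo]), and so is
    that of a nonzero multiple; [fine] then makes both sides 0. *)
Lemma RintegralZl_measurable (mu : {measure set T -> \bar R}) (k : R) (f : T -> R) :
  measurable_fun setT f -> \int[mu]_x (k * f x) = k * \int[mu]_x f x.
Proof.
move=> mf; have [->|k0] := eqVneq k 0.
  rewrite mul0r; under eq_Rintegral do rewrite mul0r.
  by rewrite /Rintegral integral0.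
have [fi|nfi] := pselect (mu.-integrable setT (EFin \o f)); first by rewrite RintegralZl.
have nint g : measurable_fun setT g -> ~ mu.-integrable setT (EFin \o g) ->
    \int[mu]_x g x = 0.
  move=> mg ng; rewrite /Rintegral.
  have : ~~ ((\int[mu]_x (g x)%:E)%E \is a fin_num).
    apply/negP => H; apply: ng; apply/integrableP; split; first exact/measurable_EFinP.
    by have := integral_fin_num_abs mu measurableT mg; rewrite H.
  by rewrite fin_numEn => /orP[] /eqP ->.
rewrite !nint// ?mulr0//; first exact: measurable_funM.
move=> kfi; apply: nfi.
have := integrableZR k^-1 kfi.
by apply: eq_integrable => // x _ /=; rewrite mulKf.
Qed.

End RintegralScale.

(** * The space and time domains, and orthonormality of the sine basis *)

Section Domains.
Context {R : realType}.
Local Notation leb := (@lebesgue_measure R).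

Lemma lebesgue_itv_lty (a b : R) (x y : bool) :
  (leb [set` Interval (BSide x a) (BSide y b)] < +oo)%E.
Proof.
by rewrite lebesgue_measure_itv /=; case: ifP => // _; rewrite -EFinD ltry.
Qed.

Lemma measurable_dom : measurable (@dom R).
Proof. exact: measurable_itv. Qed.

(* Lebesgue measure restricted to [(0, 1)] and to [[0, T]], as measures on the
   whole line, so that all integrals can be taken over [setT]. *)
Definition lebO : {finite_measure set (measurableTypeR R) -> \bar R} :=
  @frestr _ _ _ leb _ measurable_dom (lebesgue_itv_lty 0 1 false true).

Definition lebI (T : R) : {finite_measure set (measurableTypeR R) -> \bar R} :=
  @frestr _ _ _ leb _ (measurable_itv `[0, T]) (lebesgue_itv_lty 0 T true false).

#[global] Instance lebO_ae_filter : Filter (nbhs (almost_everywhere lebO)).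
Proof. exact: ae_filter_ringOfSetsType. Qed.

#[global] Instance lebI_ae_filter T : Filter (nbhs (almost_everywhere (lebI T))).
Proof. exact: ae_filter_ringOfSetsType. Qed.

Lemma lebO_setT : lebO setT = 1%E.
Proof.
rewrite /lebO /= /mfrestr /mrestr setTI /dom lebesgue_measure_itv /= lte01.
by rewrite oppr0 adde0.
Qed.

Lemma lebI_setT T : 0 < T -> lebI T setT = T%:E.
Proof.
move=> T0; rewrite /lebI /= /mfrestr /mrestr setTI lebesgue_measure_itv /= lte_fin T0.
by rewrite oppr0 adde0.
Qed.

Lemma lebO_ae : {ae lebO, forall x, dom x}.
Proof. exact: frestr_ae. Qed.

Lemma lebI_ae T : {ae lebI T, forall t, 0 <= t <= T}.
Proof.
have : {ae lebI T, forall t, `[0, T]%classic t} by exact: frestr_ae.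
by apply: filterS => t /=; rewrite in_itv.
Qed.

Lemma Rintegral_lebO (f : R -> R) : measurable_fun setT f ->
  \int[leb]_(x in dom) f x = \int[lebO]_x f x.
Proof. exact: (@Rintegral_frestr _ _ _ leb). Qed.

Lemma Rintegral_lebI T (f : R -> R) : measurable_fun setT f ->
  \int[leb]_(x in `[0, T]) f x = \int[lebI T]_x f x.
Proof. exact: (@Rintegral_frestr _ _ _ leb). Qed.

(* Turns an integral over [[0, t]] into one over the fixed interval [[0, T]]. *)
Definition upto (t s : R) : R := if s <= t then 1 else 0.

Lemma upto01 t s : 0 <= upto t s <= 1.
Proof. by rewrite /upto; case: ifP => _; rewrite ?ler01 ?lexx. Qed.

Lemma norm_upto t s : `|upto t s| <= 1.
Proof. by rewrite /upto; case: ifP => _; rewrite ?normr1 ?normr0 ?ler01. Qed.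

Lemma measurable_upto d (X : measurableType d) (f g : X -> R) :
  measurable_fun setT f -> measurable_fun setT g ->
  measurable_fun setT (fun x => upto (f x) (g x)).
Proof. by move=> mf mg; apply: measurable_fun_ifT => //; exact: measurable_fun_ler. Qed.

Lemma Rintegral_upto T t (f : R -> R) : 0 <= t <= T -> measurable_fun setT f ->
  \int[leb]_(s in `[0, t]) f s = \int[lebI T]_s (upto t s * f s).
Proof.
move=> /andP[t0 tT] mf; rewrite -Rintegral_lebI; last first.
  by apply: measurable_funM => //; exact: measurable_upto.
rewrite Rintegral_mkcond [RHS]Rintegral_mkcond; apply: eq_Rintegral => s _.
rewrite !patchE /upto; case: ifPn.
  rewrite inE/= in_itv/= => /andP[s0 st].
  by rewrite ifT ?st ?mul1r// inE/= in_itv/= s0 (le_trans st).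
case: ifPn => //; rewrite inE/= in_itv/= => /andP[s0 sT].
rewrite notin_setE/= in_itv/= s0/= => /negP; rewrite -ltNge => st.
by rewrite leNgt st mul0r.
Qed.


Lemma is_derive_sin_lin (k c x : R) :
  is_derive x 1 (fun y => sin (k * y + c)) (k * cos (k * x + c)).
Proof.
have H : is_derive x 1 (fun y : R => k * y + c) k.
  by apply: is_derive_eq; rewrite ?scaler1 ?scale0r ?addr0 ?add0r ?mulr1 /GRing.scale/= ?mulr1.
rewrite mulrC; have := @is_derive1_comp R sin (fun y => k * y + c) x _ _ _ H; exact.
Qed.

Lemma is_derive_cos_lin (k c x : R) :
  is_derive x 1 (fun y => cos (k * y + c)) (- k * sin (k * x + c)).
Proof.
have H : is_derive x 1 (fun y : R => k * y + c) k.
  by apply: is_derive_eq; rewrite ?scaler1 ?scale0r ?addr0 ?add0r ?mulr1 /GRing.scale/= ?mulr1.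
rewrite mulNr mulrC -mulNr.
have := @is_derive1_comp R cos (fun y => k * y + c) x _ _ _ H; exact.
Qed.

Lemma continuous_sin_lin (k c : R) : continuous (fun x => sin (k * x + c)).
Proof.
move=> x; apply: differentiable_continuous; apply/derivable1_diffP.
by apply: ex_derive; exact: is_derive_sin_lin.
Qed.

Lemma continuous_cos_lin (k c : R) : continuous (fun x => cos (k * x + c)).
Proof.
move=> x; apply: differentiable_continuous; apply/derivable1_diffP.
by apply: ex_derive; exact: is_derive_cos_lin.
Qed.

Lemma continuous_sin_kernel (k t : R) : continuous (fun s => sin (k * (t - s))).
Proof.
rewrite (_ : (fun s => _) = (fun s => sin (- k * s + k * t))); first exact: continuous_sin_lin.
by apply/funext => s; congr sin; ring.
Qed.

Lemma Rintegral_FTC2 (f F : R -> R) (a b : R) : a < b -> continuous f ->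
  (forall x : R, is_derive x 1 F (f x)) ->
  \int[leb]_(x in `[a, b]) f x = F b - F a.
Proof.
move=> ab cf dF; rewrite /Rintegral (continuous_FTC2 (F := F) ab)//.
- exact: continuous_subspaceT.
- have cF : continuous F.
    move=> x; apply: differentiable_continuous; apply/derivable1_diffP.
    by have [] := dF x.
  split; first by move=> x _; have [] := dF x.
    by apply: cvg_at_right_filter; exact: cF.
  by apply: cvg_at_left_filter; exact: cF.
- by move=> x _; rewrite derive1E; have := dF x => H; exact: derive_val.
Qed.

Lemma sin_natpi k : sin (k%:R * pi) = 0 :> R.
Proof.
elim: k => [|k IH]; first by rewrite mul0r sin0.
by rewrite -natr1 mulrDl mul1r sinDpi IH oppr0.
Qed.

Lemma continuous_measurable (f : R -> R) : continuous f -> measurable_fun setT f.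
Proof. exact: continuous_measurable_fun. Qed.

Lemma Rintegral_dom_cc (f : R -> R) : measurable_fun setT f ->
  \int[lebO]_x f x = \int[leb]_(x in `[0, 1]) f x.
Proof.
move=> mf; rewrite -Rintegral_lebO// /Rintegral /dom; congr fine.
by rewrite [RHS]integral_itv_bndoo//; apply/measurable_EFinP; exact: measurable_funTS.
Qed.

Lemma Rintegral_cos k : (0 < k)%N -> \int[lebO]_x cos (k%:R * pi * x) = 0.
Proof.
move=> k0.
have kp : k%:R * pi != 0 :> R by rewrite mulf_neq0 ?gt_eqF ?pi_gt0 ?ltr0n.
have cc : continuous (fun x : R => cos (k%:R * pi * x)).
  by have := @continuous_cos_lin (k%:R * pi) 0; under eq_fun do rewrite addr0.
rewrite Rintegral_dom_cc; last exact: continuous_measurable.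
pose F x := (k%:R * pi)^-1 * sin (k%:R * pi * x) : R.
have dF : forall x : R, is_derive x 1 F (cos (k%:R * pi * x)); last first.
  by rewrite (Rintegral_FTC2 ltr01 cc dF) /F mulr1 sin_natpi !mulr0 sin0 mulr0 subr0.
move=> x; have := @is_derive_sin_lin (k%:R * pi) 0 x.
under eq_fun do rewrite addr0.
rewrite addr0 => H; apply: is_derive_eq.
by rewrite /GRing.scale/= mulKf.
Qed.

Lemma continuous_eigfun a : continuous (@eigfun R a).
Proof.
rewrite (_ : eigfun a = (fun x => Num.sqrt 2 * sin (a%:R * pi * x + 0))); last first.
  by apply/funext => x; rewrite eigfunE addr0.
by move=> x; apply: cvgM; [exact: cvg_cst|exact: continuous_sin_lin].
Qed.

Lemma measurable_eigfun a : measurable_fun setT (@eigfun R a).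
Proof. by apply: continuous_measurable; exact: continuous_eigfun. Qed.

Lemma norm_eigfun a x : `|@eigfun R a x| <= 2.
Proof.
rewrite eigfunE normrM ger0_norm// (@le_trans _ _ (Num.sqrt 2 * 1))//.
  by rewrite ler_wpM2l// sin_max.
rewrite mulr1 -[leRHS]ger0_norm// -sqrtr_sqr ler_wsqrtr//.
by rewrite expr2 ler_peMr// ler1n.
Qed.

Lemma eigfun_orthonormal a b : (0 < a)%N -> (0 < b)%N ->
  \int[lebO]_x (@eigfun R a x * eigfun b x) = (a == b)%:R.
Proof.
(* With this order the truncated subtraction [a - b] of natural numbers is a true one in the
   product-to-sum formula. *)
wlog ab : a b / (b <= a)%N.
  move=> H a0 b0; have [|ab] := leqP b a; first by move=> ?; exact: H.
  under eq_Rintegral do rewrite mulrC.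
  by rewrite H// 1?ltnW// eq_sym.
move=> a0 b0.
have E x : @eigfun R a x * eigfun b x = cos ((a - b)%N%:R * pi * x) - cos ((a + b)%:R * pi * x).
  rewrite !eigfunE natrB// natrD !(mulrBl, mulrDl) cosB cosD.
  rewrite mulrACA -expr2 sqr_sqrtr//; ring.
under eq_Rintegral do rewrite E.
have ci k : lebO.-integrable setT (EFin \o (fun x : R => cos (k%:R * pi * x))).
  apply: (@integrable_bnd _ _ _ _ _ 1); last by move=> x; exact: cos_max.
  apply: continuous_measurable.
  by have := @continuous_cos_lin (k%:R * pi) 0; under eq_fun do rewrite addr0.
rewrite RintegralB// (@Rintegral_cos (a + b)) ?addn_gt0 ?a0// subr0.
have [->|nab] := eqVneq a b; last first.
  by rewrite Rintegral_cos// subn_gt0 ltn_neqAle eq_sym nab.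
rewrite subnn; under eq_Rintegral do rewrite !mul0r cos0.
transitivity (1 * fine (lebO setT)); first exact: Rintegral_cst.
by rewrite lebO_setT mulr1.
Qed.

Lemma eigfun_orthonormal_iota m n : (0 < m)%N ->
  {in index_iota m n &, forall i j, \int[lebO]_x (@eigfun R i x * eigfun j x) = (i == j)%:R}.
Proof.
move=> m0 i j; rewrite !mem_index_iota => /andP[mi _] /andP[mj _].
by apply: eigfun_orthonormal; exact: leq_trans m0 _.
Qed.

Lemma bessel_eigfun m n (f : R -> R) : (0 < m)%N -> measurable_fun setT f ->
  ((\sum_(m <= a < n) (\int[lebO]_x (f x * eigfun a x)) ^+ 2)%:E <= sqint lebO f)%E.
Proof.
move=> m0; apply: (@bessel _ _ _ lebO (@eigfun R) 2).
- exact: measurable_eigfun.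
- exact: norm_eigfun.
- exact: iota_uniq.
- exact: eigfun_orthonormal_iota.
Qed.

Lemma sqint_eigsum m n (c : nat -> R) : (0 < m)%N ->
  sqint lebO (fun x => \sum_(m <= a < n) c a * eigfun a x) = (\sum_(m <= a < n) c a ^+ 2)%:E.
Proof.
move=> m0; apply: (@sqint_lincomb _ _ _ lebO (@eigfun R) 2).
- exact: measurable_eigfun.
- exact: norm_eigfun.
- exact: iota_uniq.
- exact: eigfun_orthonormal_iota.
Qed.

End Domains.

(** * Measurability and elementary bounds of the wave kernels *)

Section KernelMeasurability.
Context {R : realType} {d : measure_display} {X : measurableType d}.
Implicit Types (f g h : X -> R) (a n : nat).

Lemma continuous_wave_phi a : continuous (@wave_phi R a).
Proof.
rewrite (_ : wave_phi a = (fun t => sin (a%:R * pi * t + 0) / (a%:R * pi))); last first.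
  by apply/funext => x; rewrite wave_phiE addr0.
by move=> x; apply: cvgM; [exact: continuous_sin_lin|exact: cvg_cst].
Qed.

Lemma measurable_wave_phi a f : measurable_fun setT f ->
  measurable_fun setT (fun u => wave_phi a (f u)).
Proof.
move=> mf; apply: (@measurableT_comp _ _ _ _ _ _ (wave_phi a)) => //.
by apply: continuous_measurable; exact: continuous_wave_phi.
Qed.

Lemma measurable_eigfun_comp a f : measurable_fun setT f ->
  measurable_fun setT (fun u => eigfun a (f u)).
Proof.
move=> mf; apply: (@measurableT_comp _ _ _ _ _ _ (eigfun a)) => //.
exact: measurable_eigfun.
Qed.

Lemma measurable_green_sum n f g h : measurable_fun setT f -> measurable_fun setT g ->
  measurable_fun setT h -> measurable_fun setT (fun u => green_sum n (f u) (g u) (h u)).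
Proof.
move=> mf mg mh; apply: measurable_sum => a.
apply: measurable_funM; last exact: measurable_eigfun_comp.
by apply: measurable_funM; [exact: measurable_wave_phi|exact: measurable_eigfun_comp].
Qed.

Lemma measurable_wave_green f g h : measurable_fun setT f -> measurable_fun setT g ->
  measurable_fun setT h -> measurable_fun setT (fun u => wave_green (f u) (g u) (h u)).
Proof.
move=> mf mg mh.
apply: (@measurable_fun_cvg _ _ _ _ (fun n u => green_sum n (f u) (g u) (h u))).
  by move=> n; exact: measurable_green_sum.
by move=> u _; exact: cvg_green_sum.
Qed.

End KernelMeasurability.

Section WavePhi.
Context {R : realType}.
Implicit Types (t : R) (a : nat).

Lemma natpi_wave_phi a t : a%:R * pi * wave_phi a t = sin (a%:R * pi * t).
Proof.
rewrite wave_phiE; case: a => [|a]; first by rewrite !mul0r sin0.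
by rewrite mulrC divfK// mulf_neq0 ?gt_eqF ?pi_gt0 ?ltr0n.
Qed.

Lemma eigval_ge1 a : (0 < a)%N -> 1 <= @eigval R a.
Proof.
move=> a0; rewrite /eigval expr_ge1// ?mulr_ge0 ?pi_ge0//.
rewrite (@le_trans _ _ (1 * pi))//; last by rewrite ler_wpM2r ?pi_ge0// ler1n.
by rewrite mul1r (le_trans _ (@pi_ge2 R))// ler1n.
Qed.

Lemma eigval_ge0 a : 0 <= @eigval R a.
Proof. exact: sqr_ge0. Qed.

Lemma norm_wave_phi a t : `|wave_phi a t| <= 1.
Proof.
case: a => [|a]; first by rewrite wave_phiE !mul0r sin0 mul0r normr0.
rewrite wave_phiE normrM normfV ler_pdivrMr; last first.
  by rewrite normr_gt0 mulf_neq0 ?gt_eqF ?pi_gt0 ?ltr0n.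
rewrite mul1r (le_trans (sin_max _))//.
rewrite ger0_norm ?mulr_ge0 ?pi_ge0//.
by have := @eigval_ge1 a.+1 isT; rewrite /eigval expr_ge1// mulr_ge0 ?pi_ge0.
Qed.

End WavePhi.

(** * Duhamel integrals and their sine coefficients *)

Section Duhamel.
Context {R : realType} (T : R).
Hypothesis T0 : 0 < T.
Local Notation RR := (measurableTypeR R).
Local Notation mI := (lebI T).
Local Notation mO := (@lebO R).
Local Notation mP := (mI \x mO)%E.
Implicit Types (F G : RR * RR -> R) (a n : nat) (t x s y : R).

Definition mode a F s : R := \int[mO]_y (F (s, y) * eigfun a y).

(** One integral over the product rather than an iterated one: linearity in [F] and domination then
    require only that [F] be integrable. The iterated form is [duhamelE]. *)
Definition duhamel a F t : R :=
  \int[mP]_z (upto t z.1 * wave_phi a (t - z.1) * (F z * eigfun a z.2)).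

Lemma measurable_fst_R : measurable_fun setT (fst : RR * RR -> R).
Proof. exact: measurable_fst. Qed.

Lemma measurable_snd_R : measurable_fun setT (snd : RR * RR -> R).
Proof. exact: measurable_snd. Qed.

Lemma measurable_integrableR F : mP.-integrable setT (EFin \o F) -> measurable_fun setT F.
Proof. by move=> Fi; apply/measurable_EFinP; exact: (measurable_int _ Fi). Qed.

Lemma measurable_mode a F : measurable_fun setT F -> measurable_fun setT (mode a F).
Proof.
move=> mF; apply: (@measurable_fun_Rintegral _ _ RR RR R mO (fun z : RR * RR => F z * eigfun a z.2)).
by apply: measurable_funM => //; apply: measurable_eigfun_comp; exact: measurable_snd_R.
Qed.

Lemma measurable_duhamel_kernel a t :
  measurable_fun setT (fun z : RR * RR => upto t z.1 * wave_phi a (t - z.1) * eigfun a z.2).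
Proof.
have m1 := measurable_fst_R; have m2 := measurable_snd_R.
apply: measurable_funM; last exact: measurable_eigfun_comp.
apply: measurable_funM; first exact: measurable_upto.
by apply: measurable_wave_phi; exact: measurable_funB.
Qed.

Lemma duhamel_integrable a F t : mP.-integrable setT (EFin \o F) ->
  mP.-integrable setT (EFin \o (fun z => upto t z.1 * wave_phi a (t - z.1) * (F z * eigfun a z.2))).
Proof.
move=> Fi.
rewrite (_ : (fun z => _) = (fun z => F z * (upto t z.1 * wave_phi a (t - z.1) * eigfun a z.2))); last first.
  by apply/funext => z; ring.
apply: (integrableM_bnd (M := 2)) => //; first exact: measurable_duhamel_kernel.
move=> z; rewrite normrM -[leRHS]mul1r ler_pM ?norm_eigfun//.
by rewrite normrM -[leRHS]mul1r ler_pM ?norm_upto ?norm_wave_phi.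
Qed.

Lemma duhamelE a F t : mP.-integrable setT (EFin \o F) ->
  duhamel a F t = \int[mI]_s (upto t s * wave_phi a (t - s) * mode a F s).
Proof.
move=> Fi; rewrite /duhamel Rintegral_fubini1; last exact: duhamel_integrable.
apply: eq_Rintegral => s _ /=; rewrite RintegralZl_measurable//.
apply: measurable_funM; last exact: measurable_eigfun.
by apply: measurable_fun_pair2; exact: measurable_integrableR.
Qed.

Lemma duhamelD a F G t : mP.-integrable setT (EFin \o F) -> mP.-integrable setT (EFin \o G) ->
  duhamel a (fun z => F z + G z) t = duhamel a F t + duhamel a G t.
Proof.
move=> Fi Gi; rewrite /duhamel -RintegralD//; try exact: duhamel_integrable.
by apply: eq_Rintegral => z _; ring.
Qed.

Lemma duhamelB a F G t : mP.-integrable setT (EFin \o F) -> mP.-integrable setT (EFin \o G) ->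
  duhamel a (fun z => F z - G z) t = duhamel a F t - duhamel a G t.
Proof.
move=> Fi Gi; rewrite /duhamel -RintegralB//; try exact: duhamel_integrable.
by apply: eq_Rintegral => z _; ring.
Qed.

Definition green_duhamel F t x : R :=
  \int[mP]_z (upto t z.1 * wave_green (t - z.1) x z.2 * F z).

Lemma duhamel_sumE F t x n : mP.-integrable setT (EFin \o F) ->
  \sum_(1 <= a < n) duhamel a F t * eigfun a x =
  \int[mP]_z (upto t z.1 * green_sum n (t - z.1) x z.2 * F z).
Proof.
move=> Fi.
transitivity (\int[mP]_z (\sum_(1 <= a < n) eigfun a x *
   (upto t z.1 * wave_phi a (t - z.1) * (F z * eigfun a z.2)))); last first.
  apply: eq_Rintegral => z _; rewrite /green_sum mulr_sumr mulr_suml; apply: eq_bigr => a _; ring.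
rewrite Rintegral_sumr; last by move=> a _; apply: integrableZR; exact: duhamel_integrable.
apply: eq_bigr => a _; rewrite RintegralZl//; last exact: duhamel_integrable.
by rewrite mulrC.
Qed.

Lemma measurable_green_kernel t x :
  measurable_fun setT (fun z : RR * RR => upto t z.1 * wave_green (t - z.1) x z.2).
Proof.
have m1 := measurable_fst_R; have m2 := measurable_snd_R.
apply: measurable_funM; first exact: measurable_upto.
by apply: measurable_wave_green => //; exact: measurable_funB.
Qed.

Lemma norm_green_kernel t x (z : RR * RR) : `|upto t z.1 * wave_green (t - z.1) x z.2| <= 6.
Proof. by rewrite normrM -[leRHS]mul1r ler_pM// ?norm_upto ?norm_wave_green. Qed.

Lemma green_duhamel_integrable F t x : mP.-integrable setT (EFin \o F) ->
  mP.-integrable setT (EFin \o (fun z => upto t z.1 * wave_green (t - z.1) x z.2 * F z)).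
Proof.
move=> Fi; under eq_fun do rewrite mulrC.
by apply: (integrableM_bnd (M := 6)) => //;
  [exact: measurable_green_kernel|exact: norm_green_kernel].
Qed.

(** Dominated convergence with the majorant [6 * |F|], which the bound on the partial Green sums
    provides. *)
Lemma cvg_green_duhamel F t x : mP.-integrable setT (EFin \o F) ->
  \sum_(1 <= a < n) duhamel a F t * eigfun a x @[n --> \oo] --> green_duhamel F t x.
Proof.
move=> Fi; under eq_fun do rewrite duhamel_sumE//.
have m1 := measurable_fst_R; have m2 := measurable_snd_R.
have mF := measurable_integrableR Fi.
have [||||_ H] := @Rintegral_dominated _ _ _ mP (fun n z => upto t z.1 * green_sum n (t - z.1) x z.2 * F z)
  (fun z => upto t z.1 * wave_green (t - z.1) x z.2 * F z) (fun z => 6 * `|F z|); last exact: H.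
- move=> n; apply: measurable_funM => //; apply: measurable_funM; first exact: measurable_upto.
  by apply: measurable_green_sum => //; exact: measurable_funB.
- move=> z; apply: cvgM; last exact: cvg_cst.
  by apply: cvgM; [exact: cvg_cst|exact: cvg_green_sum].
- by apply: integrableZR; exact: integrable_norm.
- move=> n z; rewrite normrM ler_wpM2r// normrM -[leRHS]mul1r.
  by rewrite ler_pM// ?norm_upto ?norm_green_sum.
Qed.

Lemma green_duhamelE F t x : mP.-integrable setT (EFin \o F) ->
  green_duhamel F t x =
  \int[mI]_s (upto t s * \int[mO]_y (wave_green (t - s) x y * F (s, y))).
Proof.
move=> Fi; rewrite /green_duhamel Rintegral_fubini1; last exact: green_duhamel_integrable.
apply: eq_Rintegral => s _ /=; rewrite -RintegralZl_measurable.
  by apply: eq_Rintegral => y _; rewrite mulrA.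
apply: measurable_funM; first exact: measurable_wave_green.
by apply: measurable_fun_pair2; exact: measurable_integrableR.
Qed.

Lemma norm_green_duhamel F t x : mP.-integrable setT (EFin \o F) ->
  `|green_duhamel F t x| <= 6 * \int[mP]_z `|F z|.
Proof.
move=> Fi; rewrite -RintegralZl//; last exact: integrable_norm.
apply: le_trans; first by apply: le_normr_Rintegral => //; exact: green_duhamel_integrable.
apply: le_Rintegral => //.
- by apply: integrable_norm; exact: green_duhamel_integrable.
- by apply: integrableZR; exact: integrable_norm.
- by move=> z _; rewrite normrM ler_wpM2r// norm_green_kernel.
Qed.

Definition sqsec F s : \bar R := sqint mO (fun y => F (s, y)).

Lemma measurable_sqsec F : measurable_fun setT F -> measurable_fun setT (sqsec F).
Proof.
move=> mF; apply: (@measurable_fun_fubini_tonelli_F _ _ RR RR R mO (fun z => ((F z) ^+ 2)%:E)).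
  by apply/measurable_EFinP; exact: measurable_funX.
by move=> z; rewrite lee_fin sqr_ge0.
Qed.

(** The weight [eigval a] turns [wave_phi] into a sine. Cauchy-Schwarz in time costs the factor [T];
    the squared kernel is at most [upto t s], which stays in the bound for Gronwall to use; Bessel
    in each time slice sums the modes. *)
Lemma duhamel_energy F t n : mP.-integrable setT (EFin \o F) ->
  ((\sum_(1 <= a < n) eigval a * duhamel a F t ^+ 2)%:E <=
   T%:E * \int[mI]_s ((upto t s)%:E * sqsec F s))%E.
Proof.
move=> Fi; have mF := measurable_integrableR Fi.
pose k a s := upto t s * sin (a%:R * pi * (t - s)).
have mk a : measurable_fun setT (k a).
  apply: measurable_funM; first exact: measurable_upto.
  apply: (@measurableT_comp _ _ _ _ _ _ sin) => //.
    by apply: continuous_measurable; exact: continuous_sin.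
  by apply: measurable_funM => //; exact: measurable_funB.
have E a : eigval a * duhamel a F t ^+ 2 = (\int[mI]_s (k a s * mode a F s)) ^+ 2.
  rewrite duhamelE// /eigval -exprMn; congr (_ ^+ 2).
  rewrite -RintegralZl_measurable.
    by apply: eq_Rintegral => s _; rewrite /k -natpi_wave_phi; ring.
  apply: measurable_funM; last exact: measurable_mode.
  apply: measurable_funM; first exact: measurable_upto.
  by apply: measurable_wave_phi; exact: measurable_funB.
rewrite -sumEFin.
apply: (@le_trans _ _ (\sum_(1 <= a < n) T%:E * \int[mI]_s ((upto t s)%:E * (mode a F s ^+ 2)%:E)))%E.
  apply: lee_sum => a _; rewrite E.
  have mkm : measurable_fun setT (fun s : RR => k a s * mode a F s).
    by apply: measurable_funM; [exact: mk|exact: measurable_mode].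
  have muT : (mI setT <= T%:E)%E by rewrite lebI_setT.
  apply: le_trans; first exact: (@sqr_Rintegral_le _ _ _ mI _ T T0 muT mkm).
  apply: lee_wpmul2l; first by rewrite lee_fin ltW.
  apply: ge0_le_integral => //.
  - by move=> s _; rewrite lee_fin sqr_ge0.
  - by apply/measurable_EFinP; exact: measurable_funX.
  - under eq_fun do rewrite -EFinM; apply/measurable_EFinP; apply: measurable_funM.
      exact: measurable_upto.
    by apply: measurable_funX; exact: measurable_mode.
  - move=> s _; rewrite -EFinM lee_fin exprMn ler_wpM2r ?sqr_ge0// /k exprMn.
    rewrite /upto; case: ifP => _; last by rewrite expr0n mul0r.
    by rewrite expr1n mul1r -[_ ^+ 2]real_normK ?num_real// exprn_ile1 ?sin_max.
rewrite -ge0_sume_distrr; last first.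
  move=> a _; apply: integral_ge0 => s _; rewrite -EFinM lee_fin mulr_ge0 ?sqr_ge0//.
  by case/andP: (upto01 t s).
apply: lee_wpmul2l; first by rewrite lee_fin ltW.
have u0 s : (0 <= (upto t s)%:E)%E by rewrite lee_fin; case/andP: (upto01 t s).
rewrite -ge0_integral_sum//; first last.
- by move=> a s _; rewrite mule_ge0// lee_fin sqr_ge0.
- move=> a; under eq_fun do rewrite -EFinM; apply/measurable_EFinP; apply: measurable_funM.
    exact: measurable_upto.
  by apply: measurable_funX; exact: measurable_mode.
apply: ge0_le_integral => //.
- by move=> s _; apply: sume_ge0 => a _; rewrite mule_ge0// lee_fin sqr_ge0.
- apply: emeasurable_sum => a.
  under eq_fun do rewrite -EFinM; apply/measurable_EFinP; apply: measurable_funM.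
    exact: measurable_upto.
  by apply: measurable_funX; exact: measurable_mode.
- apply: emeasurable_funM; last exact: measurable_sqsec.
  by apply/measurable_EFinP; exact: measurable_upto.
- move=> s _; rewrite -ge0_sume_distrr; last by move=> a _; rewrite lee_fin sqr_ge0.
  apply: lee_wpmul2l => //; rewrite sumEFin; apply: bessel_eigfun => //.
  exact: measurable_fun_pair2.
Qed.

End Duhamel.

(** * Square integrals of pointwise convergent sine series *)

Section FatouSq.
Context {d} {X : measurableType d} {R : realType}.

Lemma ae_imp (mu : {measure set X -> \bar R}) (P Q : X -> Prop) : (forall x, P x -> Q x) ->
  {ae mu, forall x, P x} -> {ae mu, forall x, Q x}.
Proof. by move=> PQ; apply: filterS. Qed.

Lemma limn_einf_le (v : (\bar R)^nat) (M : \bar R) :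
  (forall n, (v n <= M)%E) -> (limn_einf v <= M)%E.
Proof.
move=> vM; rewrite limn_einf_lim; apply: lime_le; first exact: is_cvg_einfs.
apply: nearW => n; apply: le_trans (vM n).
by apply: ereal_inf_lbound; exists n => //=.
Qed.

Lemma sqint_fatou (mu : {measure set X -> \bar R}) (f_ : nat -> X -> R) (f : X -> R) (M : \bar R) :
  (forall n, measurable_fun setT (f_ n)) -> measurable_fun setT f ->
  {ae mu, forall x, f_ n x @[n --> \oo] --> f x} ->
  (forall n, (sqint mu (f_ n) <= M)%E) -> (sqint mu f <= M)%E.
Proof.
move=> mf_ mf cf fM.
have m2 n : measurable_fun setT (fun x => ((f_ n x) ^+ 2)%:E).
  by apply/measurable_EFinP; exact: measurable_funX.
apply: (@le_trans _ _ (\int[mu]_x limn_einf (fun n => ((f_ n x) ^+ 2)%:E))%E); last first.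
  apply: le_trans.
    by apply: (fatou mu measurableT) => // n x _; rewrite lee_fin sqr_ge0.
  exact: limn_einf_le.
rewrite le_eqVlt; apply/orP; left; apply/eqP; apply: ae_eq_integral => //.
- by apply/measurable_EFinP; exact: measurable_funX.
- rewrite (_ : (fun x => _) = (fun x => - limn_esup (fun n => - ((f_ n x) ^+ 2)%:E)))%E; last first.
    by apply/funext => x; rewrite -[LHS]oppeK -limn_esupN.
  apply: measurableT_comp => //.
  by apply: measurable_fun_limn_esup => n; exact: measurableT_comp.
- move: cf; apply: filterS => x cx _.
  have : ((f_ n x) ^+ 2)%:E @[n --> \oo] --> ((f x) ^+ 2)%:E.
    apply: cvg_EFin; first exact: nearW.
    by rewrite expr2; under eq_fun do rewrite expr2; exact: cvgM.
  by move/cvg_limn_einf_sup => [-> _].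
Qed.

Lemma nneseries_le (f : nat -> R) m (M : \bar R) : (forall n, 0 <= f n) ->
  (forall n, ((\sum_(m <= a < n) f a)%:E <= M)%E) -> (\sum_(m <= a <oo) (f a)%:E <= M)%E.
Proof.
move=> f0 fM; apply: lime_le.
  by apply: is_cvg_nneseries => n _ _; rewrite lee_fin.
by apply: nearW => n; rewrite sumEFin.
Qed.

Lemma le_nneseries (f : nat -> R) m n : (forall n, 0 <= f n) ->
  ((\sum_(m <= a < n) f a)%:E <= \sum_(m <= a <oo) (f a)%:E)%E.
Proof.
by move=> f0; rewrite -sumEFin; apply: nneseries_lim_ge => k _ _; rewrite lee_fin.
Qed.

End FatouSq.

Section SeriesNorm.
Context {R : realType}.
Local Notation RR := (measurableTypeR R).
Local Notation mO := (@lebO R).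

(** The differences of partial sums and finite sum have square integrals known exactly by
    orthonormality; Fatou carries the bound over to the almost everywhere limit. *)
Lemma sqint_series_le (u : RR -> R) (c e : nat -> R) N : measurable_fun setT u ->
  {ae mO, forall x, \sum_(1 <= a < n) c a * eigfun a x @[n --> \oo] --> u x} ->
  (sqint mO (fun x => (u x - \sum_(1 <= a < N.+1) e a * eigfun a x)%R) <=
   (\sum_(1 <= a < N.+1) (c a - e a) ^+ 2)%:E + \sum_(N.+1 <= a <oo) (c a ^+ 2)%:E)%E.
Proof.
move=> mu cu.
pose D a := c a - (if (a < N.+1)%N then e a else 0).
(* The shift by [N.+1] makes every partial sum contain the whole range of the finite sum. *)
have DE n x : \sum_(1 <= a < n + N.+1) c a * eigfun a x - \sum_(1 <= a < N.+1) e a * eigfun a x =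
    \sum_(1 <= a < n + N.+1) D a * eigfun a x.
  have n1 : (1 <= N.+1)%N by [].
  have n2 : (N.+1 <= n + N.+1)%N by exact: leq_addl.
  rewrite (big_cat_nat n1 n2) [in RHS](big_cat_nat n1 n2)/= addrAC -sumrB; congr (_ + _).
    apply: eq_big_nat => a /andP[_ aN]; rewrite /D aN; ring.
  apply: eq_big_nat => a /andP[Na _]; rewrite /D ltnNge Na/= subr0//.
have ms (k : nat -> R) n : measurable_fun setT (fun x : RR => \sum_(1 <= a < n) k a * eigfun a x).
  by apply: measurable_sum => a; apply: measurable_funM => //; exact: measurable_eigfun.
apply: (@sqint_fatou _ RR R mO (fun n (x : RR) => \sum_(1 <= a < n + N.+1) D a * eigfun a x)).
- by move=> n; exact: ms.
- by apply: measurable_funB => //; exact: ms.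
- apply: (@ae_imp _ RR R mO _ _ _ cu) => x cx.
  rewrite (_ : (fun n => _) = (fun n => \sum_(1 <= a < n + N.+1) c a * eigfun a x -
    \sum_(1 <= a < N.+1) e a * eigfun a x)); last by apply/funext => n; rewrite DE.
  move: (cx); rewrite -(cvg_shiftn N.+1) => cx'.
  by apply: cvgB; [exact: cx'|exact: cvg_cst].
move=> n; rewrite sqint_eigsum//.
have n1 : (1 <= N.+1)%N by [].
have n2 : (N.+1 <= n + N.+1)%N by exact: leq_addl.
rewrite (big_cat_nat n1 n2)/= EFinD; apply: leeD.
  rewrite lee_fin le_eqVlt; apply/orP; left; apply/eqP.
  by apply: eq_big_nat => a /andP[_ aN]; rewrite /D aN.
apply: le_trans (@le_nneseries _ (fun a => c a ^+ 2) N.+1 (n + N.+1) _); last by move=> k; exact: sqr_ge0.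
rewrite lee_fin le_eqVlt; apply/orP; left; apply/eqP.
by apply: eq_big_nat => a /andP[Na _]; rewrite /D ltnNge Na/= subr0.
Qed.

End SeriesNorm.

(** * Gronwall's inequality, integrated in time *)

Section Gronwall.
Context {R : realType} (T : R).
Hypothesis T0 : 0 < T.
Local Notation RR := (measurableTypeR R).
Local Notation mI := (lebI T).
Local Notation leb := (@lebesgue_measure R).

Lemma exp_weight (be s : R) : 0 < be -> 0 <= s <= T ->
  \int[mI]_t (upto t s * expR (- be * t)) <= expR (- be * s) / be.
Proof.
move=> be0 /andP[s0 sT].
have ce : continuous (fun t : R => expR (- be * t)).
  move=> t; apply: (@continuous_comp _ _ _ (fun t : R => - be * t) expR).
    by apply: cvgM; [exact: cvg_cst|exact: cvg_id].
  exact: continuous_expR.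
have me : measurable_fun setT (fun t : RR => expR (- be * t)) by exact: continuous_measurable.
have E : \int[mI]_t (upto t s * expR (- be * t)) = \int[leb]_(t in `[s, T]) expR (- be * t).
  rewrite -Rintegral_lebI; last by apply: measurable_funM => //; exact: measurable_upto.
  rewrite Rintegral_mkcond [RHS]Rintegral_mkcond; apply: eq_Rintegral => t _.
  rewrite !patchE /upto !mem_setE/= !in_itv/=.
  have [st|ts] := leP s t; last by rewrite mul0r; case: ifP.
  by rewrite (le_trans s0 st)/= mul1r.
rewrite E; move: sT; rewrite le_eqVlt => /predU1P[->|sT].
  rewrite set_itv1 Rintegral_set1 divr_ge0 ?expR_ge0 ?ltW//.
have dF : forall x : R, is_derive x 1 (fun t => - be^-1 * expR (- be * t)) (expR (- be * x)).
  move=> x; have H : is_derive x 1 (fun t : R => - be * t) (- be).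
    by apply: is_derive_eq; rewrite /GRing.scale/= ?mulr1 ?mulr0 ?addr0.
  have H2 := @is_derive1_comp R expR (fun t => - be * t) x _ _ _ H.
  apply: is_derive_eq; rewrite /GRing.scale/=.
  by rewrite mulrC -mulrA mulrNN divff ?mulr1// gt_eqF.
rewrite (Rintegral_FTC2 sT ce dF).
have := expR_ge0 (- be * T); set e := expR _ => e0.
rewrite !mulNr opprK addrC -subr_ge0 (_ : _ - _ = be^-1 * e); last by rewrite -/e; ring.
by rewrite mulr_ge0// invr_ge0 ltW.
Qed.

(** Integrate the inequality against the weight [expR (- be * t)]. After exchanging the integrals,
    the memory term is at most [B / be] times the weighted integral [J] of [f], hence at most half
    of it by the choice [be = 2 * B + 1]. As [J] is finite it can be absorbed, which gives the
    factor 2; removing the weight costs [expR (be * T)]. *)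
Lemma gronwall_integral (f A : RR -> \bar R) (B : R) : 0 <= B ->
  measurable_fun setT f -> measurable_fun setT A ->
  (forall t, 0 <= f t)%E -> (forall t, 0 <= A t)%E ->
  (\int[mI]_t f t < +oo)%E ->
  {ae mI, forall t, (f t <= A t + B%:E * \int[mI]_s ((upto t s)%:E * f s))%E} ->
  (\int[mI]_t f t <= (2 * expR ((2 * B + 1) * T))%:E * \int[mI]_t A t)%E.
Proof.
move=> B0 mf mA f0 A0 foo fA; set be := 2 * B + 1.
have be0 : 0 < be by rewrite /be ltr_wpDl// mulr_ge0.
have bn : be != 0 by rewrite gt_eqF.
pose w t := expR (- be * t).
have w0 t : (0 <= (w t)%:E)%E by rewrite lee_fin expR_ge0.
have mw : measurable_fun setT (fun t : RR => w t).
  apply: continuous_measurable => t; apply: (@continuous_comp _ _ _ (fun t : R => - be * t) expR).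
    by apply: cvgM; [exact: cvg_cst|exact: cvg_id].
  exact: continuous_expR.
have mEw : measurable_fun setT (fun t : RR => (w t)%:E) by exact/measurable_EFinP.
have mw1E : measurable_fun setT (fun z : RR * RR => (w z.1)%:E).
  exact: (measurableT_comp mEw measurable_fst).
have w1 : {ae mI, forall t, w t <= 1}.
  have := lebI_ae T; apply: filterS => t /andP[t0 _].
  by rewrite /w -expR0 ler_expR mulNr oppr_le0 mulr_ge0// ltW.
have u0 t s : (0 <= (upto t s)%:E :> \bar R)%E by rewrite lee_fin; case/andP: (upto01 t s).
set J := (\int[mI]_t ((w t)%:E * f t))%E.
have J0 : (0 <= J)%E by apply: integral_ge0 => t _; rewrite mule_ge0.
have Jf : (J <= \int[mI]_t f t)%E.
  apply: ae_ge0_le_integral => //.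
  - by move=> t _; rewrite mule_ge0.
  - exact: emeasurable_funM.
  - move: w1; apply: filterS => t wt _.
    by rewrite -[leRHS]mul1e lee_wpmul2r// lee_fin.
have Joo : (J < +oo)%E by exact: le_lt_trans Jf foo.
have Jfin : J \is a fin_num by rewrite ge0_fin_numE.
pose g t := (\int[mI]_s ((upto t s)%:E * f s))%E.
have mk : measurable_fun setT (fun z : RR * RR => (upto z.1 z.2)%:E : \bar R).
  apply/measurable_EFinP; apply: measurable_upto; [exact: measurable_fst|exact: measurable_snd].
have mf2 : measurable_fun setT (fun z : RR * RR => f z.2).
  by apply: measurableT_comp => //; exact: measurable_snd.
have g0 t : (0 <= g t)%E by apply: integral_ge0 => s _; rewrite mule_ge0.
have mg : measurable_fun setT (g : RR -> \bar R).
  apply: (@measurable_fun_fubini_tonelli_F _ _ RR RR R mI (fun z : RR * RR => (upto z.1 z.2)%:E * f z.2)%E).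
    exact: emeasurable_funM.
  by move=> z; rewrite mule_ge0.
have J1 : (J <= \int[mI]_t A t + B%:E * \int[mI]_t ((w t)%:E * g t))%E.
  rewrite -ge0_integralZl//; first last.
  - by move=> t _; rewrite mule_ge0.
  - exact: emeasurable_funM.
  rewrite -ge0_integralD//; first last.
  - by apply: measurable_funeM; exact: emeasurable_funM.
  - by move=> t _; rewrite !mule_ge0// lee_fin.
  apply: ae_ge0_le_integral => //.
  - by move=> t _; rewrite mule_ge0.
  - exact: emeasurable_funM.
  - by move=> t _; rewrite adde_ge0// !mule_ge0// lee_fin.
  - by apply: emeasurable_funD => //; apply: measurable_funeM; exact: emeasurable_funM.
  - move: fA w1; apply: filterS2 => t ft wt _.
    apply: le_trans; first exact: (lee_wpmul2l (w0 t) ft).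
    rewrite ge0_muleDr//; last by apply: mule_ge0 => //; exact: g0.
    apply: leeD; first by rewrite -[leRHS]mul1e lee_wpmul2r// lee_fin.
    by rewrite muleCA.
have J2 : (\int[mI]_t ((w t)%:E * g t) <= (be^-1)%:E * J)%E.
  have -> : (\int[mI]_t ((w t)%:E * g t) =
     \int[mI]_t \int[mI]_s ((w t)%:E * ((upto t s)%:E * f s)))%E.
    apply: eq_integral => t _; rewrite ge0_integralZl//.
      by apply: emeasurable_funM => //; apply/measurable_EFinP; exact: measurable_upto.
    by move=> s _; rewrite mule_ge0.
  rewrite (@fubini_tonelli _ _ RR RR R mI mI (fun z : RR * RR => (w z.1)%:E * ((upto z.1 z.2)%:E * f z.2))%E); last 2 first.
    apply: emeasurable_funM; last exact: emeasurable_funM.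
    exact: mw1E.
    by move=> z; rewrite !mule_ge0.
  rewrite -ge0_integralZl//; first last.
  - by rewrite lee_fin invr_ge0 ltW.
  - by move=> t _; rewrite mule_ge0.
  - exact: emeasurable_funM.
  apply: ae_ge0_le_integral => //.
  - by move=> s _; apply: integral_ge0 => t _; rewrite !mule_ge0.
  - apply: (@measurable_fun_fubini_tonelli_G _ _ RR RR R mI (fun z : RR * RR => (w z.1)%:E * ((upto z.1 z.2)%:E * f z.2))%E).
      apply: emeasurable_funM; last exact: emeasurable_funM.
      exact: mw1E.
    by move=> z; rewrite !mule_ge0.
  - by move=> s _; rewrite !mule_ge0// lee_fin invr_ge0 ltW.
  - by apply: measurable_funeM; exact: emeasurable_funM.
  - have := lebI_ae T; apply: filterS => s sT _ /=.
    have -> : (\int[mI]_t ((w t)%:E * ((upto t s)%:E * f s)) = \int[mI]_t (upto t s * w t)%:E * f s)%E.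
      rewrite -ge0_integralZr//.
      - by apply: eq_integral => t _; rewrite EFinM muleA (muleC (w t)%:E).
      - by apply/measurable_EFinP; apply: measurable_funM => //; exact: measurable_upto.
      - by move=> t _; rewrite EFinM mule_ge0.
    rewrite muleA; apply: lee_wpmul2r => //.
    have : mI.-integrable setT (EFin \o (fun t => upto t s * w t)).
      apply/integrableP; split.
        by apply/measurable_EFinP; apply: measurable_funM => //; exact: measurable_upto.
      rewrite (@le_lt_trans _ _ (\int[mI]_t cst 1%E t)%E)//.
        apply: ae_ge0_le_integral => //.
        + apply: measurableT_comp => //; apply/measurable_EFinP; apply: measurable_funM => //.
          exact: measurable_upto.
        + move: w1; apply: filterS => t wt _ /=; rewrite lee_fin normrM -[leRHS]mulr1.
          by rewrite ler_pM ?norm_upto// ger0_norm// expR_ge0.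
      by apply: (integrable_lty measurableT); exact: (finite_measure_integrable_cst mI (1 : R) measurableT).
    move=> ti; rewrite -[leLHS]fineK; last exact: integrable_fin_num.
    rewrite -EFinM lee_fin.
    by have := exp_weight be0 sT; rewrite mulrC.
have J3 : (J <= 2%:E * \int[mI]_t A t)%E.
  have [Aoo|Aoo] := eqVneq (\int[mI]_t A t)%E +oo%E.
    by rewrite Aoo gt0_muley ?leey// lte_fin.
  have Afin : (\int[mI]_t A t)%E \is a fin_num.
    by rewrite ge0_fin_numE ?ltey// integral_ge0.
  have H : (J <= \int[mI]_t A t + B%:E * ((be^-1)%:E * J))%E.
    by apply: le_trans J1 _; rewrite leeD2l// lee_wpmul2l// lee_fin.
  move: H; rewrite -(fineK Jfin) -(fineK Afin) -!EFinM -EFinD !lee_fin.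
  have J0' : 0 <= fine J by rewrite fine_ge0.
  set a := fine (integral _ _ _); set j := fine J in J0' *.
  have Bb : B * (be^-1 * j) <= j / 2.
    rewrite mulrA [leRHS]mulrC ler_wpM2r// ler_pdivrMr// /be; lra.
  lra.
have J4 : ((expR (- be * T))%:E * \int[mI]_t f t <= J)%E.
  rewrite -ge0_integralZl; [|by []|by []|by []|by rewrite lee_fin expR_ge0].
  apply: ae_ge0_le_integral => //.
  - by move=> t _; rewrite mule_ge0// lee_fin expR_ge0.
  - exact: measurable_funeM.
  - by move=> t _; rewrite mule_ge0.
  - exact: emeasurable_funM.
  - have := lebI_ae T; apply: filterS => t /andP[_ tT] _.
    apply: lee_wpmul2r => //; rewrite lee_fin ler_expR !mulNr lerN2.
    by rewrite ler_pM2l.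
have -> : (\int[mI]_t f t = (expR (be * T))%:E * ((expR (- be * T))%:E * \int[mI]_t f t))%E.
  by rewrite muleA -EFinM -expRD mulNr subrr expR0 mul1e.
rewrite (mulrC 2) EFinM -muleA; apply: lee_wpmul2l; first by rewrite lee_fin expR_ge0.
exact: le_trans J4 J3.
Qed.

End Gronwall.

(** * Bookkeeping in the extended reals, and bounded functions on the product *)

Section ExtendedRealMultiples.
Context {R : realType}.
Implicit Types (x y X : \bar R) (c : R).

Lemma lee_multD x y X c1 c2 : (0 <= X)%E -> 0 <= c1 -> 0 <= c2 ->
  (x <= c1%:E * X)%E -> (y <= c2%:E * X)%E -> (x + y <= (c1 + c2)%:E * X)%E.
Proof.
move=> X0 c10 c20 xX yX; rewrite EFinD ge0_muleDl ?lee_fin//.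
exact: leeD.
Qed.

Lemma lee_multZ x X k c : 0 <= k -> (x <= c%:E * X)%E -> (k%:E * x <= (k * c)%:E * X)%E.
Proof. by move=> k0 xX; rewrite EFinM -muleA lee_wpmul2l// lee_fin. Qed.

Lemma lee_mult1 x X : (x <= X)%E -> (x <= 1%:E * X)%E.
Proof. by rewrite mul1e. Qed.

End ExtendedRealMultiples.

Section SumsAndConstants.
Context {R : realType}.

Lemma integral_lebO_cst (k : R) : (\int[@lebO R]_y k%:E = k%:E)%E.
Proof.
transitivity (k%:E * @lebO R setT)%E; first exact: integral_cst.
by rewrite lebO_setT mule1.
Qed.

Lemma measurable_nneseries d (X : measurableType d) (h : nat -> X -> R) m :
  (forall a x, 0 <= h a x) -> (forall a, measurable_fun setT (h a)) ->
  measurable_fun setT (fun x => \sum_(m <= a <oo) (h a x)%:E)%E.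
Proof.
move=> h0 mh.
apply: (@emeasurable_fun_cvg _ _ _ _ (fun n x => \sum_(m <= a < n) (h a x)%:E)%E).
  by move=> n; apply: emeasurable_sum => a; exact/measurable_EFinP.
move=> x _; apply: is_cvg_nneseries => a _ _; by rewrite lee_fin.
Qed.

Lemma sin2_le1 (x : R) : sin x ^+ 2 <= 1.
Proof. by rewrite -(cos2Dsin2 x) lerDr sqr_ge0. Qed.

Lemma cos2_le1 (x : R) : cos x ^+ 2 <= 1.
Proof. by rewrite -(cos2Dsin2 x) lerDl sqr_ge0. Qed.

End SumsAndConstants.

Section ProductBounded.
Context {R : realType} (T : R).
Hypothesis T0 : 0 < T.
Local Notation RR := (measurableTypeR R).
Local Notation mI := (lebI T).
Local Notation mO := (@lebO R).
Local Notation mP := (mI \x mO)%E.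
Implicit Types (F G : RR * RR -> R).

Lemma integrable_prod_bnd F K : measurable_fun setT F -> (forall z, `|F z| <= K) ->
  mP.-integrable setT (EFin \o F).
Proof.
move=> mF FK; apply/integrable12ltyP; first exact/measurable_EFinP.
have mc : mI.-integrable setT (EFin \o (fun _ : RR => K)).
  exact: finite_measure_integrable_cst.
apply: le_lt_trans (integrable_lty measurableT mc).
apply: ge0_le_integral => //.
- by move=> x _; exact: integral_ge0.
- apply: (@measurable_fun_fubini_tonelli_F _ _ RR RR R mO (fun z => `|(F z)%:E|)%E) => //.
  by apply: measurableT_comp => //; exact/measurable_EFinP.
- by apply/measurable_EFinP.
- move=> x _; rewrite /= -integral_lebO_cst; apply: ge0_le_integral => //.
  + apply/measurable_EFinP; apply: measurableT_comp => //.
    exact: measurable_fun_pair2.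
  + by move=> y _ /=; rewrite lee_fin.
Qed.

Lemma integrable_ae_bnd_sq F K : measurable_fun setT F ->
  {ae mI, forall s, {ae mO, forall y, `|F (s, y)| <= K}} ->
  (\int[mI]_s sqsec F s < +oo)%E.
Proof.
move=> mF FK.
have mc : mI.-integrable setT (EFin \o (fun _ : RR => K ^+ 2)).
  exact: finite_measure_integrable_cst.
apply: le_lt_trans (integrable_lty measurableT mc).
apply: ae_ge0_le_integral => //.
- by move=> x _; exact: sqint_ge0.
- exact: measurable_sqsec.
- by move=> s _ /=; rewrite lee_fin sqr_ge0.
- by apply/measurable_EFinP.
- apply: (@ae_imp _ RR R mI _ _ _ FK) => s sK _.
  rewrite /= -integral_lebO_cst; apply: ae_ge0_le_integral => //.
  + by move=> y _; rewrite lee_fin sqr_ge0.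
  + by apply/measurable_EFinP; apply: measurable_funX; exact: measurable_fun_pair2.
  + by move=> y _; rewrite lee_fin sqr_ge0.
  + apply: (@ae_imp _ RR R mO _ _ _ sK) => y yK _ /=; rewrite lee_fin.
    by rewrite -[leLHS]real_normK ?num_real// lerXn2r ?nnegrE// (le_trans _ yK).
Qed.

End ProductBounded.

(** * The error estimate for deterministic data and forcing *)

Section Deterministic.
Context {R : realType} (T : R).
Hypothesis T0 : 0 < T.
Local Notation RR := (measurableTypeR R).
Local Notation mI := (lebI T).
Local Notation mO := (@lebO R).
Local Notation mP := (mI \x mO)%E.
Implicit Types (F G : RR * RR -> R).
Variables (b : R -> R) (L : R).
Hypothesis L0 : 0 <= L.
Hypothesis bL : forall x y, `|b x - b y| <= L * `|x - y|.

(** Variation of constants in mode [a]: [wave_phi a] propagates the velocity coefficient [be a], and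
    its derivative, the cosine, the position coefficient [al a]. *)
Definition wave_coef (al be : nat -> R) F a t : R :=
  cos (a%:R * pi * t) * al a + wave_phi a t * be a + duhamel T a F t.

Lemma measurable_b : measurable_fun setT b.
Proof.
apply: continuous_measurable => x; apply/cvgrPdist_le => /= e e0.
near=> y; rewrite (le_trans (bL _ _))//.
rewrite (@le_trans _ _ ((L + 1) * `|x - y|))//; first by rewrite ler_wpM2r// lerDl.
rewrite mulrC -ler_pdivlMr ?ltr_wpDl//.
near: y; apply: (@cvgr_dist_le _ _ _ _ _ id) => //.
by rewrite divr_gt0// ltr_wpDl.
Unshelve. all: by end_near. Qed.

Lemma measurable_bcomp F : measurable_fun setT F -> measurable_fun setT (fun z => b (F z)).
Proof. by move=> mF; exact: (measurableT_comp measurable_b mF). Qed.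

Lemma norm_b x : `|b x| <= `|b 0| + L * `|x|.
Proof.
have := bL x 0; rewrite subr0; have := lerB_dist (b x) (b 0); lra.
Qed.

Lemma integrable_bcomp F : mP.-integrable setT (EFin \o F) ->
  mP.-integrable setT (EFin \o (fun z => b (F z))).
Proof.
move=> Fi; apply: (le_integrableR (g := fun z => `|b 0| + L * `|F z|)).
- by apply: measurable_bcomp; exact: measurable_integrableR Fi.
- by move=> z; exact: norm_b.
apply: integrableDR; last by apply: integrableZR; exact: integrable_norm.
by have := @integrable_prod_bnd R T (fun=> `|b 0|) `|b 0|; apply => // z; rewrite ger0_norm.
Qed.

Lemma sqsec_bcomp F s : measurable_fun setT F ->
  (sqsec (fun z => b (F z)) s <= (2 * b 0 ^+ 2)%:E + (2 * L ^+ 2)%:E * sqsec F s)%E.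
Proof.
move=> mF; have ms : measurable_fun setT (fun y : RR => F (s, y)) by exact: measurable_fun_pair2.
rewrite /sqsec /sqint -ge0_integralZl//; last 3 first.
  by apply/measurable_EFinP; exact: measurable_funX.
  by move=> y _; rewrite lee_fin sqr_ge0.
  by rewrite lee_fin mulr_ge0// sqr_ge0.
rewrite -[X in (_ <= X + _)%E]integral_lebO_cst -ge0_integralD//; first last.
- by apply: measurable_funeM; apply/measurable_EFinP; exact: measurable_funX.
- by move=> y _; rewrite -EFinM lee_fin mulr_ge0 ?sqr_ge0// mulr_ge0 ?sqr_ge0.
- by move=> y _ /=; rewrite lee_fin mulr_ge0 ?sqr_ge0.
apply: ge0_le_integral => //.
- by move=> y _; rewrite lee_fin sqr_ge0.
- apply/measurable_EFinP; apply: measurable_funX; exact: (measurableT_comp measurable_b ms).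
- apply: emeasurable_funD => //.
  by apply: measurable_funeM; apply/measurable_EFinP; exact: measurable_funX.
- move=> y _; rewrite /= -EFinM -EFinD lee_fin; set x := F (s, y).
  have := norm_b x; rewrite -[b x ^+ 2]real_normK ?num_real// -[b 0 ^+ 2]real_normK ?num_real//.
  rewrite -[x ^+ 2]real_normK ?num_real//; set p := `|b x|; set q := `|b 0|; set r := `|x|.
  move=> pq; have p0 : 0 <= p by rewrite /p normr_ge0. have q0 : 0 <= q by rewrite /q normr_ge0. have r0 : 0 <= r by rewrite /r normr_ge0.
  have pq2 : p ^+ 2 <= (q + L * r) ^+ 2 by rewrite lerXn2r ?nnegrE// addr_ge0// mulr_ge0.
  rewrite (le_trans pq2)//; have := sqr_ge0 (q - L * r); rewrite -subr_ge0; nra.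
Qed.

Lemma sqsec_lip F G s : measurable_fun setT F -> measurable_fun setT G ->
  (sqsec (fun z => (b (F z) - b (G z))%R) s <= (L ^+ 2)%:E * sqsec (fun z => (F z - G z)%R) s)%E.
Proof.
move=> mF mG.
have ms : measurable_fun setT (fun y : RR => F (s, y)) by exact: measurable_fun_pair2.
have mt : measurable_fun setT (fun y : RR => G (s, y)) by exact: measurable_fun_pair2.
have md : measurable_fun setT (fun y : RR => F (s, y) - G (s, y)) by exact: measurable_funB.
rewrite /sqsec /sqint -ge0_integralZl//; last 3 first.
  by apply/measurable_EFinP; exact: measurable_funX.
  by move=> y _; rewrite lee_fin sqr_ge0.
  by rewrite lee_fin sqr_ge0.
apply: ge0_le_integral => //.
- by move=> y _; rewrite lee_fin sqr_ge0.
- apply/measurable_EFinP; apply: measurable_funX; apply: measurable_funB.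
    exact: (measurableT_comp measurable_b ms).
  exact: (measurableT_comp measurable_b mt).
- by apply: measurable_funeM; apply/measurable_EFinP; exact: measurable_funX.
- move=> y _; rewrite -EFinM lee_fin -exprMn.
  rewrite -[leLHS]real_normK ?num_real// -[leRHS]real_normK ?num_real//.
  by rewrite lerXn2r ?nnegrE// normrM (ger0_norm L0).
Qed.

Lemma measurable_duhamel a F : mP.-integrable setT (EFin \o F) ->
  measurable_fun setT (duhamel T a F).
Proof.
move=> Fi; rewrite (_ : duhamel T a F = (fun t : RR => \int[mI]_s (upto t s * wave_phi a (t - s) * mode a F s))); last first.
  by apply/funext => t; rewrite duhamelE.
have mF := measurable_integrableR Fi.
have m1 := @measurable_fst_R R; have m2 := @measurable_snd_R R.
apply: (@measurable_fun_Rintegral _ _ RR RR R mI (fun z : RR * RR => upto z.1 z.2 * wave_phi a (z.1 - z.2) * mode a F z.2)).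
apply: measurable_funM; last by apply: (measurableT_comp (measurable_mode a mF)).
apply: measurable_funM; first exact: measurable_upto.
by apply: measurable_wave_phi; exact: measurable_funB.
Qed.

(** The squared [Hdot 1] norm, at time [t], of the solution of the linear wave equation with zero
    data and forcing [F]. *)
Definition energy F t : \bar R := (\sum_(1 <= a <oo) (eigval a * duhamel T a F t ^+ 2)%:E)%E.

Lemma energy_term_ge0 F t a : 0 <= eigval a * duhamel T a F t ^+ 2.
Proof. by rewrite mulr_ge0 ?eigval_ge0 ?sqr_ge0. Qed.

Lemma energy_ge0 F t : (0 <= energy F t)%E.
Proof. by apply: nneseries_ge0 => a _ _; rewrite lee_fin energy_term_ge0. Qed.

Lemma measurable_energy F : mP.-integrable setT (EFin \o F) -> measurable_fun setT (energy F).
Proof.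
move=> Fi; apply: (@measurable_nneseries _ _ RR (fun a t => eigval a * duhamel T a F t ^+ 2)).
  by move=> a t; exact: energy_term_ge0.
move=> a; apply: measurable_funM => //.
by apply: measurable_funX; exact: measurable_duhamel.
Qed.

(** The squared [Hdot 1] norm of the initial position plus the squared [L^2] norm of the initial
    velocity, in coefficients. *)
Definition data_energy (al be : nat -> R) : \bar R :=
  (\sum_(1 <= a <oo) (eigval a * al a ^+ 2 + be a ^+ 2)%:E)%E.

Lemma data_term_ge0 (al be : nat -> R) a : 0 <= eigval a * al a ^+ 2 + be a ^+ 2.
Proof. by rewrite addr_ge0 ?sqr_ge0// mulr_ge0 ?eigval_ge0 ?sqr_ge0. Qed.

Definition coef_energy al be F t : \bar R :=
  (\sum_(1 <= a <oo) (eigval a * wave_coef al be F a t ^+ 2)%:E)%E.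

Lemma coef_term_ge0 al be F t a : 0 <= eigval a * wave_coef al be F a t ^+ 2.
Proof. by rewrite mulr_ge0 ?eigval_ge0 ?sqr_ge0. Qed.

(** The factor 4 comes from squaring a sum of four terms: position, velocity and two Duhamel parts.
    They are treated differently: [F] will be the nonlinearity, bounded through its [L^2] norm, and
    [G] the noise, kept as an energy. *)
Lemma coef_energy_le al be F G t :
  mP.-integrable setT (EFin \o F) -> mP.-integrable setT (EFin \o G) ->
  (coef_energy al be (fun z => (F z + G z)%R) t <=
   4%:E * (data_energy al be + T%:E * \int[mI]_s ((upto t s)%:E * sqsec F s) + energy G t))%E.
Proof.
move=> Fi Gi; apply: nneseries_le => [a|n]; first exact: coef_term_ge0.
apply: (@le_trans _ _ (4%:E * ((\sum_(1 <= a < n) (eigval a * al a ^+ 2 + be a ^+ 2))%:E +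
  (\sum_(1 <= a < n) (eigval a * duhamel T a F t ^+ 2))%:E +
  (\sum_(1 <= a < n) (eigval a * duhamel T a G t ^+ 2))%:E)))%E; last first.
  apply: lee_wpmul2l => //; apply: leeD; last first.
    by apply: le_nneseries => a; exact: energy_term_ge0.
  apply: leeD; last exact: duhamel_energy.
  by apply: le_nneseries => a; exact: data_term_ge0.
rewrite -!EFinD -EFinM lee_fin -!big_split/= mulr_sumr; apply: ler_sum => a _.
rewrite /wave_coef duhamelD//.
set f := duhamel _ _ _ _; set g := duhamel _ _ _ _.
have [c0 cb] : 0 <= @eigval R a /\ eigval a * (wave_phi a t * be a) ^+ 2 <= be a ^+ 2.
  split; first exact: eigval_ge0.
  rewrite /eigval -exprMn mulrA natpi_wave_phi exprMn ler_piMl ?sqr_ge0// sin2_le1.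
have cc : (cos (a%:R * pi * t) * al a) ^+ 2 <= al a ^+ 2.
  by rewrite exprMn ler_piMl ?sqr_ge0// cos2_le1.
move: cb cc; set p := cos _ * _; set q := wave_phi _ _ * _; set e := eigval a in c0 *.
move=> cb cc.
have h : e * (p + q + (f + g)) ^+ 2 <= e * (4 * (p ^+ 2 + q ^+ 2 + f ^+ 2 + g ^+ 2)).
  apply: ler_wpM2l => //.
  have := sqr_ge0 (p - q); have := sqr_ge0 (p - f); have := sqr_ge0 (p - g).
  have := sqr_ge0 (q - f); have := sqr_ge0 (q - g); have := sqr_ge0 (f - g).
  rewrite !expr2; lra.
have h2 : e * p ^+ 2 <= e * al a ^+ 2 by apply: ler_wpM2l.
by apply: le_trans h _; lra.
Qed.


(** The summand 1 in the bracket takes up the constant [c], which stems from [b 0]; this produces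
    the shape of [errA] and [errB]. *)
Lemma coef_energy_affine (a z i : \bar R) (c k : R) :
  (0 <= a)%E -> (0 <= z)%E -> (0 <= i)%E -> 0 <= c -> 0 <= k ->
  (4%:E * (a + T%:E * (c%:E + k%:E * i) + z) <=
   (4 + 4 * T * c)%:E * (1 + a + z) + (4 * T * k)%:E * i)%E.
Proof.
move=> a0 z0 i0 c0 k0; have T0' := ltW T0.
have e4 : (0 <= 4%:E :> \bar R)%E by rewrite lee_fin.
have eT : (0 <= T%:E)%E by rewrite lee_fin.
have ek : (0 <= k%:E * i)%E by rewrite mule_ge0// lee_fin.
have ec : (0 <= c%:E)%E by rewrite lee_fin.
have ea : (0 <= 1 + a)%E by rewrite adde_ge0.
have eb : (0 <= 1 + a + z)%E by rewrite adde_ge0.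
have -> : (4%:E * (a + T%:E * (c%:E + k%:E * i) + z) =
   (4%:E * (a + z) + (4 * T * c)%:E) + (4 * T * k)%:E * i)%E.
  rewrite (ge0_muleDr T%:E ec ek) addeAC ge0_muleDr ?adde_ge0// ?mule_ge0//.
  rewrite [X in (_ + X)%E = _]ge0_muleDr ?mule_ge0// addeA.
  by rewrite !EFinM !muleA.
apply: leeD => //; rewrite (EFinD 4) ge0_muleDl ?lee_fin ?mulr_ge0//.
apply: leeD.
  by apply: lee_wpmul2l => //; rewrite -addeA leeDr.
rewrite -[leLHS]mule1; apply: lee_wpmul2l; first by rewrite lee_fin !mulr_ge0.
by rewrite -addeA leeDl// adde_ge0.
Qed.

Lemma upto_integral_le (f : RR -> \bar R) t : measurable_fun setT f -> (forall s, 0 <= f s)%E ->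
  (\int[mI]_s ((upto t s)%:E * f s) <= \int[mI]_s f s)%E.
Proof.
move=> mf f0; apply: ge0_le_integral => //.
- by move=> s _; rewrite mule_ge0// lee_fin; case/andP: (upto01 t s).
- by apply: emeasurable_funM => //; apply/measurable_EFinP; exact: measurable_upto.
- move=> s _; rewrite -[leRHS]mul1e lee_wpmul2r// lee_fin.
  by case/andP: (upto01 t s).
Qed.

Lemma measurable_upto_mul (f : RR -> \bar R) t : measurable_fun setT f ->
  measurable_fun setT (fun s : RR => (upto t s)%:E * f s)%E.
Proof.
by move=> mf; apply: emeasurable_funM => //; apply/measurable_EFinP; exact: measurable_upto.
Qed.

Lemma upto_integral_scale (f g : RR -> \bar R) c k t :
  measurable_fun setT f -> measurable_fun setT g -> (forall s, 0 <= f s)%E ->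
  (forall s, 0 <= g s)%E -> 0 <= c -> 0 <= k ->
  (forall s, g s <= c%:E + k%:E * f s)%E ->
  (\int[mI]_s ((upto t s)%:E * g s) <=
     (c * T)%:E + k%:E * \int[mI]_s ((upto t s)%:E * f s))%E.
Proof.
move=> mf mg f0 g0 c0 k0 gf.
have u0 s : (0 <= (upto t s)%:E :> \bar R)%E by rewrite lee_fin; case/andP: (upto01 t s).
have cT : (\int[mI]_s (cst c%:E s) = (c * T)%:E)%E.
  transitivity (c%:E * mI setT)%E; first exact: integral_cst.
  by rewrite lebI_setT.
rewrite -cT -ge0_integralZl//; last 2 first.
  exact: measurable_upto_mul.
  by move=> s _; rewrite mule_ge0.
rewrite -ge0_integralD//; first last.
- by apply: measurable_funeM; exact: measurable_upto_mul.
- by move=> s _; rewrite !mule_ge0// lee_fin.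
apply: ge0_le_integral => //.
- by move=> s _; rewrite mule_ge0.
- exact: measurable_upto_mul.
- by apply: emeasurable_funD => //; apply: measurable_funeM; exact: measurable_upto_mul.
- move=> s _ /=; apply: le_trans; first exact: (lee_wpmul2l (u0 s) (gf s)).
  rewrite ge0_muleDr ?mule_ge0// ?lee_fin//; apply: leeD; last by rewrite muleCA.
  by rewrite -EFinM lee_fin ler_piMl//; case/andP: (upto01 t s).
Qed.

(* With [Y] the [Hdot 1] energy of the exact solution, [Z] the energy of the noise
   and [A = errA (1 + data + Z)], one has [Y t <= A t + errB \int_0^t Y] and
   [|e|^2 t <= N^-2 Y t + errB2 \int_0^t |e|^2]; [errK1] and [errK2] are the
   corresponding constants of [gronwall_integral], and [errYb] and [errYi] the
   resulting constants for [Y t] and [\int_0^T Y]. *)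
Definition errB : R := 4 * T * (2 * L ^+ 2).
Definition errK1 : R := 2 * expR ((2 * errB + 1) * T).
Definition errA : R := 4 + 4 * T * (2 * b 0 ^+ 2 * T).
Definition errB2 : R := T * L ^+ 2.
Definition errK2 : R := 2 * expR ((2 * errB2 + 1) * T).
Definition errYb : R := errA + errB * errK1 * (errA * (T + 1)).
Definition errYi : R := errA * (T + 1) + errB * errK1 * (errA * (T + 1)) * T.
Definition errC : R := errYb + errB2 * (errK2 * errYi).

Lemma errB_ge0 : 0 <= errB. Proof. by rewrite /errB !mulr_ge0 ?sqr_ge0// ltW. Qed.
Lemma errK1_ge0 : 0 <= errK1. Proof. by rewrite mulr_ge0 ?expR_ge0. Qed.
Lemma errK2_ge0 : 0 <= errK2. Proof. by rewrite mulr_ge0 ?expR_ge0. Qed.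
Lemma errB2_ge0 : 0 <= errB2. Proof. by rewrite mulr_ge0 ?sqr_ge0// ltW. Qed.
Lemma errA_ge0 : 0 <= errA.
Proof.
rewrite /errA addr_ge0// mulr_ge0//; first by rewrite mulr_ge0// ltW.
by rewrite mulr_ge0 ?(ltW T0)// mulr_ge0 ?sqr_ge0.
Qed.
Lemma errAT_ge0 : 0 <= errA * (T + 1).
Proof. by rewrite mulr_ge0 ?errA_ge0// addr_ge0// ltW. Qed.
Lemma errYb_ge0 : 0 <= errYb.
Proof.
by rewrite addr_ge0 ?errA_ge0// mulr_ge0 ?errAT_ge0// mulr_ge0 ?errB_ge0 ?errK1_ge0.
Qed.
Lemma errYi_ge0 : 0 <= errYi.
Proof.
rewrite addr_ge0 ?errAT_ge0// mulr_ge0 ?(ltW T0)// mulr_ge0 ?errAT_ge0//.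
by rewrite mulr_ge0 ?errB_ge0 ?errK1_ge0.
Qed.
Lemma errC_ge0 : 0 <= errC.
Proof.
by rewrite addr_ge0 ?errYb_ge0// mulr_ge0 ?errB2_ge0// mulr_ge0 ?errK2_ge0 ?errYi_ge0.
Qed.

Section Error.
Variables (al be : nat -> R) (u uN xi : RR * RR -> R) (N : nat) (K KN : R).
Hypothesis N0 : (0 < N)%N.
Hypothesis mu : measurable_fun setT u.
Hypothesis muN : measurable_fun setT uN.
Hypothesis ui : mP.-integrable setT (EFin \o u).
Hypothesis uNi : mP.-integrable setT (EFin \o uN).
Hypothesis xii : mP.-integrable setT (EFin \o xi).
Hypothesis uK : {ae mI, forall s, {ae mO, forall y, `|u (s, y)| <= K}}.
Hypothesis uNK : forall s y, `|uN (s, y)| <= KN.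
Let c a t := wave_coef al be (fun z => b (u z) + xi z) a t.
Let cN a t := wave_coef al be (fun z => b (uN z) + xi z) a t.
Hypothesis u_series : {ae mI, forall s, {ae mO, forall y,
  \sum_(1 <= a < n) c a s * eigfun a y @[n --> \oo] --> u (s, y)}}.
Hypothesis uN_series : {ae mI, forall s, {ae mO, forall y,
  uN (s, y) = \sum_(1 <= a < N.+1) cN a s * eigfun a y}}.

Let A0 := data_energy al be.
Let Z := energy xi.
Let Y t := coef_energy al be (fun z => b (u z) + xi z) t.
Let U s := sqsec u s.
Let A s : \bar R := (errA%:E * (1 + A0 + Z s))%E.
Let Yb t : \bar R := (A t + (errB * errK1)%:E * \int[mI]_s A s)%E.
Let E s := sqsec (fun z => u z - uN z) s.

Let A0_ge0 : (0 <= A0)%E.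
Proof. by apply: nneseries_ge0 => a _ _; rewrite lee_fin data_term_ge0. Qed.

Let Z_ge0 s : (0 <= Z s)%E. Proof. exact: energy_ge0. Qed.

Let mZ : measurable_fun setT (Z : RR -> \bar R). Proof. exact: measurable_energy. Qed.

Let A_ge0 s : (0 <= A s)%E.
Proof. by rewrite /A mule_ge0 ?lee_fin ?errA_ge0// !adde_ge0. Qed.

Let mA : measurable_fun setT (A : RR -> \bar R).
Proof. by apply: measurable_funeM; apply: emeasurable_funD. Qed.

Let mU : measurable_fun setT (U : RR -> \bar R). Proof. exact: measurable_sqsec. Qed.

Let U_ge0 s : (0 <= U s)%E. Proof. exact: sqint_ge0. Qed.

Let mE : measurable_fun setT (E : RR -> \bar R).
Proof. by apply: measurable_sqsec; exact: measurable_funB. Qed.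

Let E_ge0 s : (0 <= E s)%E. Proof. exact: sqint_ge0. Qed.

Let bui : mP.-integrable setT (EFin \o (fun z => b (u z))).
Proof. exact: integrable_bcomp. Qed.

Let buNi : mP.-integrable setT (EFin \o (fun z => b (uN z))).
Proof. exact: integrable_bcomp. Qed.

Lemma coef_energy_gronwall t : (Y t <= A t + errB%:E * \int[mI]_s ((upto t s)%:E * U s))%E.
Proof.
apply: le_trans; first exact: (coef_energy_le al be t bui xii).
set i := (\int[mI]_s ((upto t s)%:E * U s))%E.
have i0 : (0 <= i)%E.
  by apply: integral_ge0 => s _; rewrite mule_ge0// lee_fin; case/andP: (upto01 t s).
have c0 : 0 <= 2 * b 0 ^+ 2 * T by rewrite mulr_ge0 ?(ltW T0)// mulr_ge0 ?sqr_ge0.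
have k0 : 0 <= 2 * L ^+ 2 by rewrite mulr_ge0 ?sqr_ge0.
apply: le_trans (coef_energy_affine A0_ge0 (Z_ge0 t) i0 c0 k0).
apply: lee_wpmul2l => //; apply: leeD => //; apply: leeD => //.
apply: lee_wpmul2l; first by rewrite lee_fin ltW.
apply: upto_integral_scale => //.
- by apply: measurable_sqsec; exact: measurable_bcomp.
- by move=> s; exact: sqint_ge0.
- by rewrite mulr_ge0 ?sqr_ge0.
- by move=> s; exact: sqsec_bcomp.
Qed.

Lemma coef_sq_le t n : ((\sum_(1 <= a < n) c a t ^+ 2)%:E <= Y t)%E.
Proof.
apply: le_trans (le_nneseries 1 n (coef_term_ge0 al be _ t)).
rewrite lee_fin; apply: ler_sum_nat => a /andP[a1 _].
by rewrite ler_peMl ?sqr_ge0// eigval_ge1.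
Qed.

(** In a time slice the squared [L^2] norm of [u] is at most its [Hdot 1] energy, as
    [eigval a >= 1], so [coef_energy_gronwall] becomes a closed inequality for [U]. The bound [uK]
    supplies the finiteness that Gronwall requires. *)
Lemma sol_integral_bound : (\int[mI]_s U s <= errK1%:E * \int[mI]_s A s)%E.
Proof.
apply: gronwall_integral => //; first exact: errB_ge0.
  exact: integrable_ae_bnd_sq uK.
apply: (@ae_imp _ RR R mI _ _ _ u_series) => s us.
apply: le_trans (coef_energy_gronwall s).
have ms : measurable_fun setT (fun y : RR => u (s, y)) by exact: measurable_fun_pair2.
(* Taken with [N = 0]: the finite sum is empty and the norm of [u] itself is bounded. *)
have := @sqint_series_le R (fun y => u (s, y)) (c ^~ s) (fun=> 0) 0 ms us.
rewrite big_geq// add0e => H.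
apply: le_trans; last by apply: (@nneseries_le R (fun a => c a s ^+ 2) 1 (Y s)) => [a|n]; [exact: sqr_ge0|exact: coef_sq_le].
apply: le_trans H; rewrite le_eqVlt; apply/orP; left; apply/eqP.
by apply: eq_integral => y _; rewrite big_geq// subr0.
Qed.

Lemma coef_energy_bound t : (Y t <= Yb t)%E.
Proof.
apply: le_trans (coef_energy_gronwall t) _; apply: leeD => //.
rewrite (EFinM errB) -muleA; apply: lee_wpmul2l; first by rewrite lee_fin errB_ge0.
apply: le_trans sol_integral_bound; exact: upto_integral_le.
Qed.

(** Stated for a slice [ut] with its own convergence hypothesis: the final estimate concerns every
    time [t], while [u_series] speaks of almost every time only. *)
Lemma error_gronwall t (ut : RR -> R) : measurable_fun setT ut ->
  {ae mO, forall y, \sum_(1 <= a < n) c a t * eigfun a y @[n --> \oo] --> ut y} ->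
  (sqint mO (fun y => (ut y - \sum_(1 <= a < N.+1) cN a t * eigfun a y)%R) <=
   (N%:R ^- 2)%:E * Yb t + errB2%:E * \int[mI]_s ((upto t s)%:E * E s))%E.
Proof.
move=> mut cut; apply: le_trans; first exact: (@sqint_series_le R ut (c ^~ t) (cN ^~ t) N mut cut).
rewrite addeC; apply: leeD.
  apply: nneseries_le => [a|n]; first exact: sqr_ge0.
  apply: (@le_trans _ _ ((N%:R ^- 2)%:E * Y t))%E; last first.
    by apply: lee_wpmul2l; [rewrite lee_fin invr_ge0 sqr_ge0|exact: coef_energy_bound].
  apply: (@le_trans _ _ ((N%:R ^- 2)%:E * (\sum_(1 <= a < n) eigval a * c a t ^+ 2)%:E))%E; last first.
    apply: lee_wpmul2l; first by rewrite lee_fin invr_ge0 sqr_ge0.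
    exact: (le_nneseries 1 n (coef_term_ge0 al be _ t)).
  rewrite -EFinM lee_fin mulr_sumr.
  have NN : (0 : R) < N%:R ^+ 2 by rewrite exprn_gt0// ltr0n.
  have [nN|Nn] := leqP n N.+1.
    rewrite (big_geq nN); apply: sumr_ge0 => a _; rewrite mulr_ge0 ?invr_ge0 ?sqr_ge0//.
    exact: coef_term_ge0.
  have N1 : (1 <= N.+1)%N by [].
  rewrite [leRHS](big_cat_nat N1 (ltnW Nn))/= ler_wpDl//.
    by apply: sumr_ge0 => a _; rewrite mulr_ge0 ?invr_ge0 ?sqr_ge0// coef_term_ge0.
  (* Beyond the cut-off, [a > N] gives [eigval a >= N%:R ^+ 2], which is the source of the rate. *)
  apply: ler_sum_nat => a /andP[Na _].
  rewrite mulrA ler_peMl ?sqr_ge0// -[leLHS](mulVf (lt0r_neq0 NN)).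
  apply: ler_wpM2l; first by rewrite invr_ge0 sqr_ge0.
  rewrite /eigval lerXn2r ?nnegrE ?mulr_ge0 ?pi_ge0//.
  rewrite (@le_trans _ _ (a%:R * 1))//.
    by rewrite mulr1 ler_nat ltnW.
  by rewrite ler_wpM2l// (le_trans _ (@pi_ge2 R))// ler1n.
have bd : mP.-integrable setT (EFin \o (fun z => b (u z) - b (uN z))) by exact: integrableBR.
(* In the modes kept by the Galerkin method, data and noise cancel; only the difference of the
   nonlinear forcings is left. *)
have DE a : c a t - cN a t = duhamel T a (fun z => b (u z) - b (uN z)) t.
  rewrite /c /cN /wave_coef (duhamelD a t bui xii) (duhamelD a t buNi xii) (duhamelB a t bui buNi); ring.
apply: le_trans (_ : (_ <= (\sum_(1 <= a < N.+1) eigval a * duhamel T a (fun z => b (u z) - b (uN z)) t ^+ 2)%:E)%E) _.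
  rewrite lee_fin; apply: ler_sum_nat => a /andP[a1 _]; rewrite DE.
  by rewrite ler_peMl ?sqr_ge0// eigval_ge1.
apply: le_trans; first exact: duhamel_energy.
rewrite /errB2 EFinM -muleA; apply: lee_wpmul2l; first by rewrite lee_fin ltW.
apply: le_trans; first apply: (@upto_integral_scale E _ 0 (L ^+ 2)) => //.
- by apply: measurable_sqsec; apply: measurable_funB; exact: measurable_bcomp.
- by move=> s; exact: sqint_ge0.
- exact: sqr_ge0.
- by move=> s; rewrite add0e; exact: sqsec_lip.
by rewrite mul0r add0e.
Qed.

Theorem error_bound t (ut : RR -> R) : measurable_fun setT ut ->
  {ae mO, forall y, \sum_(1 <= a < n) c a t * eigfun a y @[n --> \oo] --> ut y} ->
  (sqint mO (fun y => (ut y - \sum_(1 <= a < N.+1) cN a t * eigfun a y)%R) <=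
   (errC * N%:R ^- 2)%:E * (1 + A0 + Z t + \int[mI]_s Z s))%E.
Proof.
move=> mut cut; apply: le_trans; first exact: error_gronwall.
have Nge : (0 <= (N%:R ^- 2)%:E :> \bar R)%E by rewrite lee_fin invr_ge0 sqr_ge0.
have bk0 : 0 <= errB * errK1 by rewrite mulr_ge0 ?errB_ge0 ?errK1_ge0.
have IA0 : (0 <= \int[mI]_s A s)%E by exact: integral_ge0.
have Yb0 s : (0 <= Yb s)%E by rewrite adde_ge0// mule_ge0.
have mYb : measurable_fun setT (Yb : RR -> \bar R) by exact: emeasurable_funD.
(* Every quantity below is bounded by a real multiple of this one, so that the constants add and
   multiply as real numbers. *)
set X := (1 + A0 + Z t + _)%E.
have IZ0 : (0 <= \int[mI]_s Z s)%E by exact: integral_ge0.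
have X1 : (1 + A0 + Z t <= X)%E by rewrite leeDl.
have X0 : (0 <= X)%E by apply: adde_ge0 => //; rewrite !adde_ge0.
have X2 : (1 + A0 <= X)%E by apply: le_trans X1; rewrite leeDl.
have X3 : (\int[mI]_s Z s <= X)%E by rewrite leeDr// !adde_ge0.
have cI k : (0 <= k)%E -> (\int[mI]_s (cst k s) = k * T%:E)%E.
  move=> k0; transitivity (k * mI setT)%E; first exact: integral_cst.
  by rewrite lebI_setT.
have At : (A t <= errA%:E * X)%E by rewrite lee_wpmul2l// lee_fin errA_ge0.
have IA : (\int[mI]_s A s <= (errA * (T + 1))%:E * X)%E.
  rewrite ge0_integralZl//; last 3 first.
  - exact: emeasurable_funD.
  - by move=> s _; rewrite !adde_ge0.
  - by rewrite lee_fin errA_ge0.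
  apply: lee_multZ; first exact: errA_ge0.
  rewrite ge0_integralD//; last by move=> s _; rewrite adde_ge0.
  apply: lee_multD => //; first exact: ltW.
    rewrite (cI (1 + A0)%E) ?adde_ge0// muleC.
    by apply: lee_wpmul2l => //; rewrite lee_fin ltW.
  exact: lee_mult1.
have Ybt : (Yb t <= errYb%:E * X)%E.
  apply: lee_multD => //; [exact: errA_ge0|by rewrite mulr_ge0// errAT_ge0|].
  by apply: lee_multZ.
have IYb : (\int[mI]_s Yb s <= errYi%:E * X)%E.
  rewrite ge0_integralD//; last by move=> s _; rewrite mule_ge0.
  apply: lee_multD => //; first exact: errAT_ge0.
    by rewrite mulr_ge0 ?(ltW T0)// mulr_ge0// errAT_ge0.
  rewrite (cI ((errB * errK1)%:E * \int[mI]_s A s)%E) ?mule_ge0//.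
  rewrite muleC (mulrC _ T); apply: lee_multZ; first exact: ltW.
  exact: lee_multZ.
(* The second use of Gronwall, now for the error, with [N^-2 * Yb] as inhomogeneous term. Finiteness
   comes from the bounds [K] and [KN] on the two solutions. *)
have IE : (\int[mI]_s E s <= errK2%:E * \int[mI]_s ((N%:R ^- 2)%:E * Yb s))%E.
  apply: gronwall_integral => //.
  - exact: errB2_ge0.
  - exact: measurable_funeM.
  - by move=> s; rewrite mule_ge0.
  - apply: (@integrable_ae_bnd_sq _ _ _ (K + KN)); first exact: measurable_funB.
    apply: (@ae_imp _ RR R mI _ _ _ uK) => s sK.
    apply: (@ae_imp _ RR R mO _ _ _ sK) => y yK.
    by rewrite (le_trans (ler_normB _ _))// lerD.
  - have F : {ae mI, forall s, {ae mO, forall y,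
      \sum_(1 <= a < n) c a s * eigfun a y @[n --> \oo] --> u (s, y)} /\
      {ae mO, forall y, uN (s, y) = \sum_(1 <= a < N.+1) cN a s * eigfun a y}}.
      exact: (filterI u_series uN_series).
    apply: (@ae_imp _ RR R mI _ _ _ F) => s [us uNs].
    have ms : measurable_fun setT (fun y : RR => u (s, y)) by exact: measurable_fun_pair2.
    apply: le_trans (error_gronwall ms us).
    rewrite le_eqVlt; apply/orP; left; apply/eqP; apply: ae_eq_integral => //.
    + apply/measurable_EFinP; apply: measurable_funX; apply: measurable_funB => //.
      exact: measurable_fun_pair2.
    + apply/measurable_EFinP; apply: measurable_funX; apply: measurable_funB => //.
      by apply: measurable_sum => a; apply: measurable_funM => //; exact: measurable_eigfun.
    + by apply: (@ae_imp _ RR R mO _ _ _ uNs) => y yE _ /=; rewrite yE.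
rewrite ge0_integralZl// in IE.
rewrite (mulrC errC) (EFinM _ errC) -[leRHS]muleA.
apply: (@le_trans _ _ ((N%:R ^- 2)%:E * (Yb t + errB2%:E * (errK2%:E * \int[mI]_s Yb s))))%E.
  have H0 : (0 <= errB2%:E * (errK2%:E * \int[mI]_s Yb s))%E.
    by rewrite !mule_ge0 ?lee_fin ?errB2_ge0 ?errK2_ge0// integral_ge0.
  rewrite [leRHS](ge0_muleDr _ (Yb0 t) H0).
  apply: leeD => //; rewrite [leRHS]muleCA; apply: lee_wpmul2l; first by rewrite lee_fin errB2_ge0.
  apply: le_trans (upto_integral_le t mE E_ge0) _.
  by apply: le_trans IE _; rewrite muleCA.
apply: lee_wpmul2l => //.
apply: lee_multD => //; first exact: errYb_ge0.
  by rewrite mulr_ge0 ?errB2_ge0// mulr_ge0 ?errK2_ge0 ?errYi_ge0.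
apply: lee_multZ; first exact: errB2_ge0.
by apply: lee_multZ; first exact: errK2_ge0.
Qed.

End Error.

End Deterministic.

(** * Integration against a measure with a density *)

Section Density.
Context {d} {X : measurableType d} {R : realType}.
Variables (mu nu : {measure set X -> \bar R}) (f : X -> R).
Hypothesis mf : measurable_fun setT f.
Hypothesis f0 : forall x, 0 <= f x.
Hypothesis nuE : forall A, measurable A -> nu A = (\int[mu]_(x in A) (f x)%:E)%E.

Import HBNNSimple.

Let mEf : measurable_fun setT (EFin \o f). Proof. exact/measurable_EFinP. Qed.

Let integral_density_indic A : measurable A ->
  (\int[nu]_x (\1_A x)%:E = \int[mu]_x ((\1_A x)%:E * (f x)%:E))%E.
Proof.
move=> mA; rewrite integral_indic// setIT nuE// integral_mkcond.
apply: eq_integral => x _; rewrite patchE indicE.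
by case: ifPn => xA; rewrite ?mul1e ?mul0e.
Qed.

Let integral_density_nnsfun (g : {nnsfun X >-> R}) :
  (\int[nu]_x (g x)%:E = \int[mu]_x ((g x)%:E * (f x)%:E))%E.
Proof.
under [LHS]eq_integral do rewrite fimfunE -fsumEFin//.
rewrite [LHS]ge0_integral_fsum//; last 2 first.
  - by move=> r; exact/measurable_EFinP/measurableT_comp.
  - by move=> n x _; rewrite EFinM nnfun_muleindic_ge0.
under [RHS]eq_integral.
  move=> x xD; rewrite fimfunE -fsumEFin// ge0_mule_fsuml; last first.
    by move=> r; rewrite EFinM nnfun_muleindic_ge0.
  over.
rewrite [RHS]ge0_integral_fsum//; last 2 first.
  - move=> r; apply: emeasurable_funM => //.
    by apply/measurable_EFinP; exact/measurableT_comp.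
  - by move=> n x _; rewrite EFinM mule_ge0// ?nnfun_muleindic_ge0// lee_fin.
apply: eq_fsbigr => r _.
have mr : measurable (g @^-1` [set r]) by [].
rewrite integralZl_indic_nnsfun// integral_density_indic//.
have [r0|r0] := ltP r 0.
  rewrite preimage_nnfun0// !integral0_eq ?mule0//.
    by move=> x _; rewrite indic0 mulr0 mul0e.
  by move=> x _; rewrite indic0 mul0e.
rewrite -ge0_integralZl//.
- by apply: eq_integral => x _; rewrite EFinM muleA.
- by apply: emeasurable_funM => //; exact/measurable_EFinP.
- by move=> x _; rewrite mule_ge0// lee_fin.
Qed.

(** The standard induction: indicators, simple functions, then monotone limits on both sides. *)
Lemma ge0_integral_density (g : X -> \bar R) : measurable_fun setT g ->
  (forall x, 0 <= g x)%E -> (\int[nu]_x g x = \int[mu]_x (g x * (f x)%:E))%E.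
Proof.
move=> mg g0; pose g_ := nnsfun_approx measurableT mg.
transitivity (lim (\int[nu]_x (g_ n x)%:E @[n --> \oo]))%E.
  rewrite -monotone_convergence//=.
  - apply: eq_integral => x _; apply/esym/cvg_lim => //=.
    exact: cvg_nnsfun_approx.
  - by move=> n; exact/measurable_EFinP/measurable_funTS.
  - by move=> n x _; rewrite lee_fin.
  - by move=> x _ a b ab; rewrite lee_fin; exact/lefP/nd_nnsfun_approx.
transitivity (lim (\int[mu]_x ((g_ n x)%:E * (f x)%:E) @[n --> \oo]))%E.
  by apply: congr_lim; apply/funext => n /=; exact: integral_density_nnsfun.
rewrite -monotone_convergence//=.
- apply: eq_integral => x _; apply/cvg_lim => //=.
  apply: cvgeZr => //; exact: cvg_nnsfun_approx.
- move=> n; apply: emeasurable_funM => //; exact/measurable_EFinP.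
- by move=> n x _; rewrite mule_ge0// lee_fin.
- move=> x _ a b ab; apply: lee_wpmul2r; rewrite lee_fin//.
  exact/lefP/nd_nnsfun_approx.
Qed.

End Density.

(** * Moments of normal laws and of Gaussian variables *)

Section NormalMoments.
Context {R : realType}.
Local Notation RR := (measurableTypeR R).
Local Notation leb := (@lebesgue_measure R).
Implicit Types (m s p : R).

Lemma integral_normal_prob m s (g : RR -> \bar R) : measurable_fun setT g ->
  (forall x, 0 <= g x)%E ->
  (\int[normal_prob m s]_x g x = \int[leb]_x (g x * (normal_pdf m s x)%:E))%E.
Proof.
move=> mg g0; apply: (@ge0_integral_density _ RR R leb (normal_prob m s) (normal_pdf m s)) => //.
- exact: measurable_normal_pdf.
- exact: normal_pdf_ge0.
Qed.

Lemma measurable_powR_norm p : measurable_fun setT (fun x : RR => `|x| `^ p).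
Proof.
apply: (@measurableT_comp _ _ _ _ _ _ (fun y : R => y `^ p) _ (fun x : RR => `|x|)).
  exact: measurable_powR.
exact: normr_measurable.
Qed.

(** With [y = |x - m| / s] and [t = |m| + s] one has [|x| <= t * (1 + y) <= t * expR y], and
    [p * y <= p ^+ 2 + y ^+ 2 / 4] because [(y / 2 - p) ^+ 2 >= 0]. The resulting exponent is half
    of that of the normal density, and can be absorbed by it. *)
Lemma powR_norm_le p m s x : 0 <= p -> 0 < s ->
  `|x| `^ p <= (`|m| + s) `^ p * (expR (p ^+ 2) * expR ((x - m) ^+ 2 / (s ^+ 2 *+ 4))).
Proof.
move=> p0 s0; set t := `|m| + s; set y := `|x - m| / s.
have t0 : 0 < t by rewrite /t ltr_wpDl.
have y0 : 0 <= y by rewrite /y divr_ge0// ltW.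
have xy : `|x| <= t * expR y.
  apply: (@le_trans _ _ (t * (1 + y))); last by rewrite ler_wpM2l ?(ltW t0)// expR_ge1Dx.
  have -> : `|x| = `|m + (x - m)| by congr `|_|; ring.
  rewrite (le_trans (ler_normD _ _))// mulrDr mulr1 /t.
  have : s * y <= (`|m| + s) * y by rewrite ler_wpM2r// lerDr.
  have -> : s * y = `|x - m| by rewrite /y mulrC divfK// gt_eqF.
  have := normr_ge0 m; have := ltW s0; lra.
apply: (@le_trans _ _ ((t * expR y) `^ p)).
  by apply: ge0_ler_powR => //; rewrite nnegrE// mulr_ge0 ?expR_ge0 ?ltW.
rewrite powRM ?expR_ge0 ?(ltW t0)// ler_wpM2l ?powR_ge0//.
rewrite -expRD -expRM ler_expR.
have -> : (x - m) ^+ 2 / (s ^+ 2 *+ 4) = y ^+ 2 / 4.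
  by rewrite -[_ ^+ 2 in LHS]real_normK ?num_real// /y; field; rewrite gt_eqF.
have := sqr_ge0 (y / 2 - p); rewrite !expr2; lra.
Qed.

(** Half of the Gaussian exponent remains, which is a normal density with standard deviation
    enlarged by [Num.sqrt 2]; the factor in front is the ratio of the normalizing constants. *)
Lemma normal_pdf_tilt m s x : 0 < s ->
  expR ((x - m) ^+ 2 / (s ^+ 2 *+ 4)) * normal_pdf m s x =
  Num.sqrt 2 * normal_pdf m (Num.sqrt 2 * s) x.
Proof.
move=> s0; have s20 : 0 < Num.sqrt 2 * s by rewrite mulr_gt0// sqrtr_gt0.
rewrite !normal_pdfE ?gt_eqF// /normal_peak /normal_fun.
have sq2 : (Num.sqrt 2 * s) ^+ 2 = 2 * s ^+ 2 by rewrite exprMn sqr_sqrtr.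
rewrite sq2 mulrCA -expRD [in RHS]mulrA; congr (_ * expR _).
  have -> : 2 * s ^+ 2 * pi *+ 2 = 2 * (s ^+ 2 * pi *+ 2) by rewrite mulrnAr !mulrA.
  by rewrite (sqrtrM (s ^+ 2 * pi *+ 2) (_ : 0 <= 2 :> R))// invfM mulrA divff ?mul1r// gt_eqF// sqrtr_gt0.
by field; rewrite gt_eqF.
Qed.

Lemma normal_moment_le p m s : 0 <= p -> 0 < s ->
  (\int[normal_prob m s]_x (`|x| `^ p)%:E <=
   ((`|m| + s) `^ p * (expR (p ^+ 2) * Num.sqrt 2))%:E)%E.
Proof.
move=> p0 s0.
have mp : measurable_fun setT (fun x : RR => `|x| `^ p).
  exact: measurable_powR_norm.
rewrite integral_normal_prob//; last exact/measurable_EFinP.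
set t := `|m| + s; set s2 := Num.sqrt 2 * s.
have := integral_normal_pdf m s2; set J := integral _ _ _ => JE.
rewrite -[leRHS]mule1 -JE /J -ge0_integralZl//; last 3 first.
- by apply/measurable_EFinP; exact: measurable_normal_pdf.
- by move=> x _; rewrite lee_fin normal_pdf_ge0.
- by rewrite lee_fin !mulr_ge0 ?powR_ge0 ?expR_ge0.
apply: ge0_le_integral => //.
- by move=> x _; rewrite -EFinM lee_fin mulr_ge0 ?powR_ge0 ?normal_pdf_ge0.
- apply/measurable_EFinP; apply: measurable_funM => //; exact: measurable_normal_pdf.
- by apply/measurable_EFinP; apply: measurable_funM => //; exact: measurable_normal_pdf.
- move=> x _; rewrite -!EFinM lee_fin.
  apply: (@le_trans _ _ (t `^ p * (expR (p ^+ 2) * expR ((x - m) ^+ 2 / (s ^+ 2 *+ 4))) * normal_pdf m s x)).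
    by apply: ler_wpM2r; [exact: normal_pdf_ge0|exact: powR_norm_le].
  have := normal_pdf_tilt m x s0; rewrite -/s2.
  move: (expR (p ^+ 2)) (expR (_ / _)) (normal_pdf m s x) (normal_pdf m s2 x) (Num.sqrt 2) (t `^ p).
  move=> E F n1 n2 q r FE.
  by rewrite -[leLHS]mulrA -[X in _ * X]mulrA FE !mulrA.
Qed.

(* [s] times the least value of the density of [normal_prob m s] at distance at
   most [2 s] from [m].  On the interval between [m + s] and [m + 2 s] (or its
   mirror image, if [m < 0]) one has [`|x| >= `|m| + s]. *)
Definition normalq : R := expR (- 2) * (Num.sqrt (pi *+ 2))^-1.

Lemma normalq_gt0 : 0 < normalq.
Proof. by rewrite mulr_gt0 ?expR_gt0// invr_gt0 sqrtr_gt0 mulrn_wgt0// pi_gt0. Qed.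

Lemma normal_sqr_ge m s : 0 < s ->
  ((normalq * (`|m| + s) ^+ 2)%:E <= \int[normal_prob m s]_x (x ^+ 2)%:E)%E.
Proof.
move=> s0; set t := `|m| + s.
have t0 : 0 < t by rewrite /t ltr_wpDl.
have m2 : measurable_fun setT (fun x : RR => x ^+ 2) by exact: measurable_funX.
rewrite integral_normal_prob//; last 2 first.
- exact/measurable_EFinP.
- by move=> x; rewrite lee_fin sqr_ge0.
have [a [am at']] : exists a, (forall x, a <= x <= a + s -> `|x - m| <= 2 * s) /\
    (forall x, a <= x <= a + s -> t <= `|x|).
  have [m0|m0] := leP 0 m.
    exists (m + s); split => x /andP[x1 x2].
      rewrite ger0_norm; lra.
    by rewrite /t (ger0_norm m0) ger0_norm; lra.
  exists (m - 2 * s); split => x /andP[x1 x2].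
    rewrite ler0_norm; lra.
  by rewrite /t (ltr0_norm m0) ler0_norm; lra.
have as' : a < a + s by rewrite ltrDl.
pose I := (`[a, a + s]%classic : set RR).
have mI : measurable I by exact: measurable_itv.
have lI : leb I = s%:E.
  by rewrite /I lebesgue_measure_itv /= lte_fin as' -EFinD addrAC subrr add0r.
pose k := t ^+ 2 * (normal_peak s * expR (- 2)).
have k0 : 0 <= k by rewrite mulr_ge0 ?sqr_ge0// mulr_ge0 ?normal_peak_ge0 ?expR_ge0.
apply: (@le_trans _ _ (k%:E * leb I))%E.
  rewrite lI -EFinM lee_fin /k /normalq /normal_peak.
  have -> : s ^+ 2 * pi *+ 2 = s ^+ 2 * (pi *+ 2) by rewrite -mulrnAr.
  rewrite sqrtrM ?sqr_ge0// sqrtr_sqr (ger0_norm (ltW s0)) invfM.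
  rewrite le_eqVlt; apply/orP; left; apply/eqP.
  set q := (Num.sqrt _)^-1; set e := expR _.
  rewrite (_ : t ^+ 2 * (s^-1 * q * e) * s = t ^+ 2 * q * e * (s^-1 * s)); last by ring.
  by rewrite mulVf ?gt_eqF//; ring.
rewrite -(integral_cst leb mI) [leLHS]integral_mkcond.
apply: ge0_le_integral => //.
- by move=> x _; rewrite patchE; case: ifP => // _; rewrite lee_fin.
- by apply/(measurable_restrictT _ mI).
- by apply/measurable_EFinP; apply: measurable_funM => //; exact: measurable_normal_pdf.
- move=> x _; rewrite patchE; case: ifPn; last first.
    by move=> _; rewrite -EFinM lee_fin mulr_ge0 ?sqr_ge0 ?normal_pdf_ge0.
  rewrite inE /I/= in_itv/= => xa; rewrite -EFinM lee_fin /k.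
  apply: ler_pM; rewrite ?sqr_ge0 ?mulr_ge0 ?normal_peak_ge0 ?expR_ge0//.
    rewrite -[leRHS]real_normK ?num_real// lerXn2r ?nnegrE ?(ltW t0)//.
    exact: at'.
  rewrite normal_pdfE ?gt_eqF//; apply: ler_wpM2l; first exact: normal_peak_ge0.
  rewrite /normal_fun ler_expR mulNr lerN2 ler_pdivrMr; last by rewrite mulrn_wgt0// exprn_gt0.
  have := am _ xa; rewrite -[(x - m) ^+ 2]real_normK ?num_real//; set y := `|_| => y2.
  have : y ^+ 2 <= (2 * s) ^+ 2 by rewrite lerXn2r ?nnegrE ?mulr_ge0 ?(ltW s0)// /y.
  by rewrite -mulr_natr !expr2; lra.
Qed.

End NormalMoments.

Section GaussianMoments.
Context {d} {Omega : measurableType d} {R : realType} (P : probability Omega R).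
Local Notation RR := (measurableTypeR R).
Implicit Types (p : R) (X : Omega -> R).

(** The product is the ratio of the constants in [normal_moment_le] and [normal_sqr_ge], the latter
    raised to [p / 2]; the summand 1 covers the degenerate laws. *)
Definition gaussC p : R := (expR (p ^+ 2) * Num.sqrt 2) * (normalq (R := R))^-1 `^ (p / 2) + 1.

Lemma gaussC_ge0 p : 0 <= gaussC p.
Proof. by rewrite addr_ge0// !mulr_ge0 ?expR_ge0 ?powR_ge0. Qed.

Lemma gaussian_integral X m s (g : RR -> \bar R) : measurable_fun setT X ->
  (forall A : set R, measurable A -> P (X @^-1` A) = if s == 0 then \d_m A else normal_prob m s A) ->
  measurable_fun setT g -> (forall x, 0 <= g x)%E ->
  (\int[P]_w g (X w) = if (s == 0)%R then g m else \int[normal_prob m s]_x g x)%E.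
Proof.
move=> mX XE mg g0.
have mX' : measurable_fun setT (X : Omega -> RR) by exact: mX.
rewrite -[LHS](@ge0_integral_pushforward _ _ Omega RR R X mX' P setT g)//.
case: ifPn => s0.
  transitivity (\int[(\d_(m : RR) : {measure set RR -> \bar R})]_x g x)%E.
    apply: eq_measure_integral => A mA _.
    by rewrite /= /pushforward XE// s0.
  by rewrite integral_dirac// diracT mul1e.
apply: eq_measure_integral => A mA _.
by rewrite /= /pushforward XE// (negbTE s0).
Qed.

Lemma gaussian_sqr_lty X : gaussian P X -> (\int[P]_w (X w ^+ 2)%:E < +oo)%E.
Proof.
move=> [mX [m [s [s0 XE]]]].
have m2 : measurable_fun setT (fun x : RR => (x ^+ 2)%:E) by apply/measurable_EFinP; exact: measurable_funX.
rewrite (gaussian_integral mX XE m2) => [|x]; last by rewrite lee_fin sqr_ge0.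
case: ifPn => sn; first exact: ltry.
have sp : 0 < s by rewrite lt_neqAle eq_sym sn.
have := @normal_moment_le R 2 m s (ler0n _ 2) sp.
under eq_integral do rewrite (powR_mulrn 2)// real_normK ?num_real//.
by move/le_lt_trans; apply; rewrite ltry.
Qed.

(** Both moments are compared with [|m| + s]: the second moment is bounded below by a multiple of
    its square, and the moment of order [p] above by a multiple of its power [p]. *)
Lemma gaussian_moment p X V : 2 <= p -> gaussian P X ->
  (\int[P]_w (X w ^+ 2)%:E <= V%:E)%E ->
  (\int[P]_w (`|X w| `^ p)%:E <= (gaussC p * V `^ (p / 2))%:E)%E.
Proof.
move=> p2 [mX [m [s [s0 XE]]]].
have p0 : 0 <= p by rewrite (le_trans _ p2).
have m2 : measurable_fun setT (fun x : RR => (x ^+ 2)%:E) by apply/measurable_EFinP; exact: measurable_funX.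
have mp : measurable_fun setT (fun x : RR => (`|x| `^ p)%:E).
  by apply/measurable_EFinP; exact: measurable_powR_norm.
rewrite (gaussian_integral mX XE m2) => [|x]; last by rewrite lee_fin sqr_ge0.
rewrite (gaussian_integral mX XE mp) => [|x]; last by rewrite lee_fin powR_ge0.
have p20 : 0 <= p / 2 by rewrite divr_ge0.
have pE (x : R) : 0 <= x -> x `^ p = (x ^+ 2) `^ (p / 2).
  by move=> x0; rewrite -powR_mulrn// -powRrM; congr (_ `^ _); field.
case: ifPn => sn.
  rewrite !lee_fin => mV; rewrite pE// real_normK ?num_real//.
  apply: (@le_trans _ _ (V `^ (p / 2))).
    by apply: ge0_ler_powR; rewrite ?nnegrE ?sqr_ge0// (le_trans _ mV) ?sqr_ge0.
  rewrite ler_peMl ?powR_ge0// lerDr !mulr_ge0 ?expR_ge0 ?powR_ge0//.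
move=> HV; have sp : 0 < s by rewrite lt_neqAle eq_sym sn.
have t0 : 0 <= `|m| + s by rewrite addr_ge0.
have := le_trans (normal_sqr_ge m sp) HV; rewrite lee_fin => tV.
apply: le_trans (normal_moment_le m p0 sp) _; rewrite lee_fin pE//.
have t2 : (`|m| + s) ^+ 2 <= normalq^-1 * V.
  by rewrite mulrC ler_pdivlMr ?normalq_gt0// mulrC.
have V0 : 0 <= V by rewrite (le_trans _ tV)// mulr_ge0 ?sqr_ge0// ltW// normalq_gt0.
apply: (@le_trans _ _ ((normalq^-1 * V) `^ (p / 2) * (expR (p ^+ 2) * Num.sqrt 2))).
  apply: ler_wpM2r; first by rewrite mulr_ge0 ?expR_ge0.
  by apply: ge0_ler_powR; rewrite ?nnegrE ?sqr_ge0// (le_trans _ t2) ?sqr_ge0.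
rewrite powRM ?invr_ge0 ?(ltW normalq_gt0)//.
rewrite /gaussC mulrDl mul1r.
rewrite (_ : _ * (_ * _) = expR (p ^+ 2) * Num.sqrt 2 * normalq^-1 `^ (p / 2) * V `^ (p / 2)); last by ring.
by rewrite lerDl powR_ge0.
Qed.

End GaussianMoments.

(** * The linear span of the noise field and its covariances *)

Section GaussianSpan.
Context {d : measure_display} {Omega : measurableType d} {R : realType}.
Variables (P : probability Omega R) (T H : R) (W : Omega -> R -> R -> R).
Hypothesis noise : fractional_noise P T H W.
Implicit Types (X Y : Omega -> R) (s : seq (R * (R * R))).

Let D : set (R * R) := `[0, T] `*` `[0, 1].

(** A combination is a list of coefficients paired with points, so that addition is concatenation
    and nested sums stay in the span. *)
Definition comb s (w : Omega) : R := \sum_(z <- s) z.1 * W w z.2.1 z.2.2.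

Definition in_span X : Prop :=
  exists2 s, (forall z, z \in s -> D z.2) & X = comb s.

Lemma span_gaussian X : in_span X -> gaussian P X.
Proof.
move=> [s sD ->]; case: noise => + _ _ => /(_ (size s)).
move=> /(_ (fun i => (tnth (in_tuple s) i).1) (fun i => (tnth (in_tuple s) i).2)).
rewrite (_ : (fun w => _) = comb s); last first.
  by apply/funext => w; rewrite /comb [RHS]big_tnth.
by apply=> i; apply: sD; exact: mem_tnth.
Qed.

Lemma span_measurable X : in_span X -> measurable_fun setT X.
Proof. by case/span_gaussian. Qed.

Lemma spanD X Y : in_span X -> in_span Y -> in_span (fun w => X w + Y w).
Proof.
move=> [s sD ->] [s' sD' ->]; exists (s ++ s').
  by move=> z; rewrite mem_cat => /orP[/sD|/sD'].
by apply/funext => w; rewrite /comb big_cat.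
Qed.

Lemma spanZ c X : in_span X -> in_span (fun w => c * X w).
Proof.
move=> [s sD ->]; exists [seq (c * z.1, z.2) | z <- s].
  by move=> y /mapP[z zs ->]; exact: (sD z zs).
apply/funext => w; rewrite /comb big_map mulr_sumr.
by apply: eq_bigr => z _; rewrite mulrA.
Qed.

Lemma span_lincomb (I : eqType) (r : seq I) (c : I -> R) (F : I -> Omega -> R) :
  (forall i, i \in r -> in_span (F i)) -> in_span (fun w => \sum_(i <- r) c i * F i w).
Proof.
elim: r => [|i r ih] Fr.
  exists [::] => //; apply/funext => w; by rewrite /comb !big_nil.
rewrite (_ : (fun w => _) = (fun w => c i * F i w + \sum_(i <- r) c i * F i w)); last first.
  by apply/funext => w; rewrite big_cons.
apply: spanD; first by apply/spanZ/Fr; rewrite mem_head.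
by apply: ih => j jr; apply: Fr; rewrite inE jr orbT.
Qed.

Lemma span_sqr_integrable X : in_span X -> P.-integrable setT (EFin \o (fun w => X w ^+ 2)).
Proof.
move=> Xs; have mX := span_measurable Xs.
by apply: sqint_integrable_sqr => //; apply: gaussian_sqr_lty; exact: span_gaussian.
Qed.

Lemma span_integrableM X Y : in_span X -> in_span Y ->
  P.-integrable setT (EFin \o (fun w => X w * Y w)).
Proof.
move=> Xs Ys; apply: (le_integrableR (g := fun w => X w ^+ 2 + Y w ^+ 2)).
- by apply: measurable_funM; exact: span_measurable.
- move=> w; rewrite normrM -[X w ^+ 2]real_normK ?num_real// -[Y w ^+ 2]real_normK ?num_real//.
  have := sqr_ge0 (`|X w| - `|Y w|); have := sqr_ge0 (`|X w|); have := sqr_ge0 (`|Y w|).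
  by rewrite !expr2; lra.
- by apply: integrableDR; exact: span_sqr_integrable.
Qed.

Definition pairing X Y : R := \int[P]_w (X w * Y w).

Lemma pairingC X Y : pairing X Y = pairing Y X.
Proof. by apply: eq_Rintegral => w _; rewrite mulrC. Qed.

Lemma pairing_sum (I : eqType) (r : seq I) (c : I -> R) (F : I -> Omega -> R) Y :
  (forall i, i \in r -> in_span (F i)) -> in_span Y ->
  pairing (fun w => \sum_(i <- r) c i * F i w) Y = \sum_(i <- r) c i * pairing (F i) Y.
Proof.
move=> Fr Ys; rewrite /pairing.
rewrite (_ : (fun w => _) = (fun w => \sum_(i <- r) c i * (F i w * Y w))); last first.
  by apply/funext => w; rewrite mulr_suml; apply: eq_bigr => i _; rewrite mulrA.
rewrite Rintegral_sumr; last first.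
  by move=> i ir; apply: integrableZR; apply: span_integrableM => //; exact: Fr.
rewrite big_seq [RHS]big_seq; apply: eq_bigr => i ir.
by rewrite RintegralZl//; apply: span_integrableM => //; exact: Fr.
Qed.

Lemma span_point q : D q -> in_span (fun w => W w q.1 q.2).
Proof.
move=> Dq; exists [:: (1, q)]; first by move=> z; rewrite inE => /eqP ->.
by apply/funext => w; rewrite /comb big_seq1 mul1r.
Qed.

Lemma pairing_comb s s' : (forall z, z \in s -> D z.2) -> (forall z, z \in s' -> D z.2) ->
  pairing (comb s) (comb s') =
  \sum_(z <- s) z.1 * (\sum_(z' <- s') z'.1 * fractional_cov H z'.2.1 z'.2.2 z.2.1 z.2.2).
Proof.
move=> sD sD'; rewrite /comb (@pairing_sum _ s fst (fun z w => W w z.2.1 z.2.2)); last 2 first.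
- by move=> z zs; apply: span_point; exact: sD.
- by exists s'.
rewrite big_seq [RHS]big_seq; apply: eq_bigr => z zs; congr (_ * _).
rewrite pairingC (@pairing_sum _ s' fst (fun z w => W w z.2.1 z.2.2)); last 2 first.
- by move=> z' zs'; apply: span_point; exact: sD'.
- by apply: span_point; exact: sD.
rewrite big_seq [RHS]big_seq; apply: eq_bigr => z' zs'; congr (_ * _).
case: noise => _ _ /(_ z'.2.1 z'.2.2 z.2.1 z.2.2); rewrite -!surjective_pairing.
move=> /(_ (sD' _ zs') (sD _ zs)) /(congr1 fine) /= <-.
by rewrite /pairing /Rintegral unlock.
Qed.

Let corners a a' c c' : seq (R * (R * R)) :=
  [:: (1, (a', c')); (-1, (a, c')); (-1, (a', c)); (1, (a, c))].

Lemma rect_incr_comb a a' c c' :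
  (fun w => rect_incr (W w) a a' c c') = comb (corners a a' c c').
Proof.
apply/funext => w; rewrite /rect_incr /comb !big_cons big_nil /=.
by rewrite !mul1r !mulN1r addr0 !addrA.
Qed.

Let corners_D a a' c c' : D (a, c) -> D (a', c') -> forall z, z \in corners a a' c c' -> D z.2.
Proof.
by move=> [/= a1 c1] [/= a2 c2] z; rewrite !inE => /or4P[] /eqP ->; split.
Qed.

Lemma span_rect_incr a a' c c' : D (a, c) -> D (a', c') ->
  in_span (fun w => rect_incr (W w) a a' c c').
Proof.
by move=> D1 D2; exists (corners a a' c c'); [exact: corners_D|exact: rect_incr_comb].
Qed.

(** The covariance of fractional Brownian motion with Hurst parameter [H]. *)
Definition space_cov x y : R := (x `^ (2 * H) + y `^ (2 * H) - `|x - y| `^ (2 * H)) / 2.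

(** The covariance of the field is a product of a time and a space factor, so its double differences
    over two rectangles factor as well. *)
Lemma pairing_rect_incr a a' c c' b b' e e' :
  D (a, c) -> D (a', c') -> D (b, e) -> D (b', e') ->
  pairing (fun w => rect_incr (W w) a a' c c') (fun w => rect_incr (W w) b b' e e') =
  (Num.min b' a' - Num.min b' a - Num.min b a' + Num.min b a) *
  (space_cov e' c' - space_cov e' c - space_cov e c' + space_cov e c).
Proof.
move=> D1 D2 D3 D4; rewrite !rect_incr_comb pairing_comb; try exact: corners_D.
rewrite !big_cons !big_nil /= /fractional_cov -!/(space_cov _ _).
move: (space_cov e' c') (space_cov e' c) (space_cov e c') (space_cov e c).
move: (Num.min b' a') (Num.min b' a) (Num.min b a') (Num.min b a) => *.
by ring.
Qed.

End GaussianSpan.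

(** * Grid intervals in time and cells in space *)

Section GridNoise.
Context {R : realType}.
Implicit Types (k : R) (i j : nat).

(** The mixed difference of [min] over two intervals is the length of their overlap; distinct grid
    intervals do not overlap. *)
Lemma min_grid k i j : 0 <= k ->
  Num.min (j.+1%:R * k) (i.+1%:R * k) - Num.min (j.+1%:R * k) (i%:R * k)
  - Num.min (j%:R * k) (i.+1%:R * k) + Num.min (j%:R * k) (i%:R * k)
  = (i == j)%:R * k.
Proof.
move=> k0.
have le_grid (p q : nat) : (p <= q)%N -> p%:R * k <= q%:R * k.
  by move=> pq; rewrite ler_wpM2r// ler_nat.
have [ij|ji|->] := ltngtP i j.
- rewrite (min_r (le_grid i.+1 j.+1 _)) ?ltnS ?(ltnW ij)//.
  rewrite (min_r (le_grid i j.+1 _)) ?(ltnW (ltnW ij))//; last by rewrite (leq_trans (ltnW ij)).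
  rewrite (min_r (le_grid i.+1 j _))// (min_r (le_grid i j _)) ?(ltnW ij)//.
  by rewrite mul0r; ring.
- rewrite (min_l (le_grid j.+1 i.+1 _)) ?ltnS ?(ltnW ji)//.
  rewrite (min_l (le_grid j i.+1 _)); last by rewrite (leq_trans (ltnW ji)).
  rewrite (min_l (le_grid j.+1 i _))// (min_l (le_grid j i _)) ?(ltnW ji)//.
  by rewrite mul0r; ring.
- rewrite !minxx (min_r (le_grid j j.+1 _))// (min_l (le_grid j j.+1 _))//.
  by rewrite mul1r -natr1; ring.
Qed.

End GridNoise.

Section Cells.
Context {R : realType}.
Local Notation RR := (measurableTypeR R).
Local Notation leb := (@lebesgue_measure R).

Definition cell (c : R) (i : nat) : set RR := `]i%:R * c, i.+1%:R * c]%classic.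

Lemma frestr_cell (D : set RR) (mD : measurable D) (fD : (leb D < +oo)%E) (c : R) i : 0 < c ->
  (frestr mD fD (cell c i) <= c%:E)%E.
Proof.
move=> c0; have mc : measurable (cell c i) by exact: measurable_itv.
apply: (@le_trans _ _ (leb (cell c i))).
  apply: (@le_measure _ _ _ leb (cell c i `&` D)); rewrite ?inE//; exact: measurableI.
rewrite /cell lebesgue_measure_itv /= lte_fin ltr_pM2r// ltr_nat ltnSn.
by rewrite -EFinB lee_fin -mulrBl -natr1 addrAC subrr add0r mul1r.
Qed.

Lemma norm_indic (A : set RR) x : `|\1_A x : R| = \1_A x.
Proof. by rewrite ger0_norm// indicE. Qed.

Lemma norm_Rintegral_indic (mu : {finite_measure set RR -> \bar R}) (A : set RR) (g : RR -> R) M :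
  measurable A -> measurable_fun setT g -> (forall x, `|g x| <= M) ->
  `|\int[mu]_x (g x * \1_A x)| <= M * fine (mu A).
Proof.
move=> mA mg gM.
have i1 : mu.-integrable setT (EFin \o \1_A).
  by apply: (@integrable_bnd _ _ _ mu _ 1) => // x; rewrite norm_indic indicE; case: (_ \in _).
have -> : M * fine (mu A) = \int[mu]_x (M * \1_A x).
  by rewrite RintegralZl// /Rintegral integral_indic// setIT.
have gi : mu.-integrable setT (EFin \o (fun x => g x * \1_A x)).
  apply: (le_integrableR (g := fun x => M * \1_A x)).
  - by apply: measurable_funM.
  - by move=> x; rewrite normrM norm_indic ler_wpM2r// indicE.
  - exact: integrableZR.
apply: le_trans (le_normr_Rintegral _ gi) _ => //.
apply: le_Rintegral => //; [exact: integrable_norm|exact: integrableZR|].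
by move=> x _; rewrite normrM norm_indic ler_wpM2r// indicE.
Qed.

Lemma cell_inj c i j x : 0 < c -> x \in cell c i -> x \in cell c j -> i = j.
Proof.
move=> c0; rewrite !inE /cell /= !in_itv /= => /andP[i1 i2] /andP[j1 j2].
have := lt_le_trans i1 j2; have := lt_le_trans j1 i2.
rewrite !ltr_pM2r// !ltr_nat !ltnS => ji ij; apply/eqP.
by rewrite eqn_leq ij ji.
Qed.

(** The half-open cells are disjoint, so all mixed products vanish. *)
Lemma sqr_sum_cell c n (x : nat -> R) y : 0 < c ->
  (\sum_(0 <= j < n) x j * \1_(cell c j) y) ^+ 2 =
  \sum_(0 <= j < n) x j ^+ 2 * \1_(cell c j) y.
Proof.
move=> c0; rewrite expr2 mulr_suml big_nat [RHS]big_nat; apply: eq_bigr => j /andP[_ jn].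
rewrite [\1__ y]indicE; case: (boolP (y \in cell c j)) => yj; last by rewrite !mulr0 mul0r.
rewrite !mulr1 expr2; congr (_ * _).
rewrite (eq_bigr (fun j' => if j' == j then x j else 0)); last first.
  move=> j' _; rewrite indicE; case: eqVneq => [->|j'j]; first by rewrite yj mulr1.
  case: (boolP (y \in cell c j')) => yj'; last by rewrite mulr0.
  by rewrite (cell_inj c0 yj' yj) eqxx in j'j.
by rewrite -big_mkcond/= big_nat1_eq/= jn.
Qed.

End Cells.

(** * Minkowski's inequality for a series of nonnegative functions *)

Section SeriesMoment.
Context {d} {X : measurableType d} {R : realType} (mu : {measure set X -> \bar R}).
Variables (f : nat -> X -> R) (q : R).
Hypothesis q1 : 1 <= q.
Hypothesis f0 : forall a x, 0 <= f a x.
Hypothesis mf : forall a, measurable_fun setT (f a).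

Let q0 : 0 < q. Proof. exact: lt_le_trans q1. Qed.

Lemma lee_poweR r (x y : \bar R) : 0 <= r -> (0 <= x)%E -> (x <= y)%E -> (x `^ r <= y `^ r)%E.
Proof.
move=> r0 x0 xy; apply: gt0_ler_poweR => //; rewrite in_itv/= leey andbT.
- exact: x0.
- exact: le_trans xy.
Qed.

Lemma Lnorm_powR_le (g : X -> R) B : 0 <= B ->
  ('N[mu]_q%:E[EFin \o g] <= B%:E)%E <-> (\int[mu]_x (`|g x| `^ q)%:E <= (B `^ q)%:E)%E.
Proof.
move=> B0; have -> : (\int[mu]_x (`|g x| `^ q)%:E)%E = ('N[mu]_q%:E[EFin \o g] `^ q)%E.
  by rewrite poweR_Lnorm ?gt_eqF//; apply: eq_integral => x _; rewrite /= poweR_EFin.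
rewrite -poweR_EFin; split => [NB|]; first by apply: lee_poweR (ltW q0) (Lnorm_ge0 _ _ _) NB.
have qV : 0 <= q^-1 by rewrite invr_ge0 ltW.
move=> /(lee_poweR qV (poweR_ge0 _ _)); rewrite -!poweRrM divff ?gt_eqF//.
by rewrite !poweRe1// ?lee_fin// Lnorm_ge0.
Qed.

Lemma Lnorm_sum_le (c : nat -> R) m n : (forall a, 0 <= c a) ->
  (forall a, (\int[mu]_x (f a x `^ q)%:E <= (c a `^ q)%:E)%E) ->
  ('N[mu]_q%:E[EFin \o (fun x => \sum_(m <= a < n) f a x)%R] <= (\sum_(m <= a < n) c a)%:E)%E.
Proof.
move=> c0 fc; elim: n => [|n ih].
  under eq_Lnorm do rewrite /= big_geq//.
  by rewrite big_geq// Lnorm0// eqe gt_eqF.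
have [mn|nm] := leqP m n; last first.
  under eq_Lnorm do rewrite /= big_geq//.
  by rewrite big_geq// Lnorm0// eqe gt_eqF.
rewrite big_nat_recr//= EFinD; apply: le_trans _ (leeD ih _); last first.
  apply/Lnorm_powR_le; first exact: c0.
  by under eq_integral do rewrite ger0_norm//.
under eq_Lnorm do rewrite /= big_nat_recr//=.
apply: minkowski_EFin => //; exact: measurable_sum.
Qed.

(** The bounds [c a] on the single [L^q] norms add up over partial sums, and monotone convergence
    passes to the series. *)
Lemma series_moment (c : nat -> R) B m : (forall a, 0 <= c a) ->
  (forall a, (\int[mu]_x (f a x `^ q)%:E <= (c a `^ q)%:E)%E) ->
  (forall n, \sum_(m <= a < n) c a <= B) ->
  (\int[mu]_x ((\sum_(m <= a <oo) (f a x)%:E) `^ q) <= (B `^ q)%:E)%E.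
Proof.
move=> c0 fc cB; have B0 : 0 <= B by rewrite (le_trans _ (cB 0%N))// sumr_ge0.
pose g n x := \sum_(m <= a < n) f a x.
have g0 n x : 0 <= g n x by exact: sumr_ge0.
have mg n : measurable_fun setT (g n) by exact: measurable_sum.
have gnd x : {homo (fun n => (g n x `^ q)%:E) : i j / (i <= j)%N >-> (i <= j)%E}.
  move=> i j ij; rewrite lee_fin ge0_ler_powR ?nnegrE// ?(ltW q0)//.
  have [mi|im] := leqP m i; last by rewrite /g big_geq ?(ltnW im)// sumr_ge0.
  by rewrite /g (big_cat_nat mi ij)/= lerDl sumr_ge0.
have mq n : measurable_fun setT (fun x => (g n x `^ q)%:E).
  by apply/measurable_EFinP; apply: (measurableT_comp (measurable_powR q)).
have -> : (B `^ q)%:E = (B%:E `^ q)%E by rewrite poweR_EFin.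
apply: (@le_trans _ _ (\int[mu]_x (limn (fun n => (g n x `^ q)%:E)))%E).
  apply: ge0_le_integral => //.
  - by move=> x _; exact: poweR_ge0.
  - apply: (measurableT_comp (measurable_poweR q)) => //.
    exact: measurable_nneseries.
  - apply: (@emeasurable_fun_cvg _ _ _ _ (fun n x => (g n x `^ q)%:E)) => // x _.
    exact: ereal_nondecreasing_is_cvgn (gnd x).
  move=> x _; set l := limn (fun n => (g n x `^ q)%:E).
  (* Each partial sum lies below the root of order [q] of the limit [l] of the powers; hence so does
     the series, and no continuity of the power at [+oo] enters. *)
  have gl n : ((g n x)%:E <= l `^ q^-1)%E.
    have : ((g n x `^ q)%:E <= l)%E.
      rewrite /l; apply: lime_ge; first exact: ereal_nondecreasing_is_cvgn (gnd x).
      by exists n => // j /= nj; exact: gnd.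
    have qV : 0 <= q^-1 by rewrite invr_ge0 ltW.
    have pq : (0 <= (g n x `^ q)%:E)%E by rewrite lee_fin powR_ge0.
    by move=> /(lee_poweR qV pq); rewrite poweR_EFin -powRrM divff ?gt_eqF// powRr1.
  have l0 : (0 <= l)%E.
    by apply: lime_ge; [exact: ereal_nondecreasing_is_cvgn (gnd x)|near=> n; rewrite lee_fin powR_ge0].
  apply: (@le_trans _ _ ((l `^ q^-1) `^ q)%E).
    apply: lee_poweR; [exact: ltW|by apply: nneseries_ge0 => a _ _; rewrite lee_fin|].
    by apply: nneseries_le => // n; exact: gl.
  by rewrite -poweRrM mulVf ?gt_eqF// poweRe1.
rewrite monotone_convergence//; last by move=> n x _; rewrite lee_fin powR_ge0.
apply: lime_le.
  apply: ereal_nondecreasing_is_cvgn => i j ij; apply: ge0_le_integral => //.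
    by move=> x _; rewrite lee_fin powR_ge0.
  by move=> x _; exact: gnd.
near=> n; rewrite poweR_EFin.
have := Lnorm_sum_le m n c0 fc; rewrite -/(g n) => /le_trans => /(_ B%:E).
rewrite lee_fin => /(_ (cB n)) /(Lnorm_powR_le _ B0).
by under eq_integral do rewrite ger0_norm//.
Unshelve. all: by end_near.
Qed.

End SeriesMoment.

(** * The sine modes of the Wong-Zakai noise and their moments *)

Section NoiseModes.
Context {d : measure_display} {Omega : measurableType d} {R : realType}.
Variables (P : probability Omega R) (T H : R) (W : Omega -> R -> R -> R) (m n : nat).
Hypothesis T0 : 0 < T.
Hypothesis H0 : 0 < H.
Hypothesis m0 : (0 < m)%N.
Hypothesis n0 : (0 < n)%N.
Hypothesis noise : fractional_noise P T H W.
Local Notation RR := (measurableTypeR R).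
Local Notation mI := (lebI T).
Local Notation mO := (@lebO R).

Let k : R := T / m%:R.
Let h : R := n%:R^-1.
Let k0 : 0 < k. Proof. by rewrite divr_gt0// ltr0n. Qed.
Let h0 : 0 < h. Proof. by rewrite invr_gt0 ltr0n. Qed.

Definition cell_incr (i j : nat) (w : Omega) : R :=
  rect_incr (W w) (i%:R * k) (i.+1%:R * k) (j%:R * h) (j.+1%:R * h).

Let in_grid i j : (i <= m)%N -> (j <= n)%N ->
  (`[0, T] `*` `[0, 1] : set (R * R)) (i%:R * k, j%:R * h).
Proof.
move=> im jn; split; rewrite /= in_itv/=.
  rewrite mulr_ge0 ?(ltW k0)//= /k mulrA ler_pdivrMr ?ltr0n//.
  by rewrite mulrC ler_pM2l// ler_nat.
by rewrite mulr_ge0 ?(ltW h0)//= /h ler_pdivrMr ?ltr0n// mul1r ler_nat.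
Qed.

Lemma span_cell i j : (i < m)%N -> (j < n)%N -> in_span T W (cell_incr i j).
Proof. by move=> im jn; apply: span_rect_incr; apply: in_grid => //; exact: ltnW. Qed.

Definition cell_cov (j j' : nat) : R :=
  space_cov H (j'.+1%:R * h) (j.+1%:R * h) - space_cov H (j'.+1%:R * h) (j%:R * h)
  - space_cov H (j'%:R * h) (j.+1%:R * h) + space_cov H (j'%:R * h) (j%:R * h).

Lemma pairing_cell i j i' j' : (i < m)%N -> (j < n)%N -> (i' < m)%N -> (j' < n)%N ->
  pairing P (cell_incr i j) (cell_incr i' j') = (i == i')%:R * k * cell_cov j j'.
Proof.
move=> im jn im' jn'.
rewrite (pairing_rect_incr noise) ?min_grid ?(ltW k0)//; apply: in_grid => //; exact: ltnW.
Qed.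

Lemma cell_cov_diag j : cell_cov j j = h `^ (2 * H).
Proof.
rewrite /cell_cov /space_cov !subrr normr0 powR0; last by rewrite mulf_neq0// gt_eqF.
have hE : j.+1%:R * h - j%:R * h = h by rewrite -natr1 mulrDl mul1r addrAC subrr add0r.
rewrite [`|j%:R * h - _|]distrC hE gtr0_norm//.
by move: (_ `^ _) (_ `^ _) (_ `^ _) => x y z; field.
Qed.

(* [time_weight] and [space_weight] are the averages over a cell of the two
   factors of the kernel, so that [noise_mode a t] is the a-th mode of the
   stochastic convolution, rescaled by [a pi]. *)
Definition time_weight a t i : R :=
  k^-1 * \int[mI]_s (upto t s * sin (a%:R * pi * (t - s)) * \1_(`]i%:R * k, i.+1%:R * k]) s).

Definition space_weight a j : R :=
  h^-1 * \int[mO]_y (\1_(`]j%:R * h, j.+1%:R * h]) y * eigfun a y).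

Definition row_mode a i w : R := \sum_(0 <= j < n) space_weight a j * cell_incr i j w.

Definition noise_mode a t w : R := \sum_(0 <= i < m) time_weight a t i * row_mode a i w.

(** The variance of [row_mode a i] divided by the time step [k]; it is the same for all [i], see
    [pairing_row]. *)
Definition mode_var a : R :=
  \sum_(0 <= j < n) space_weight a j * \sum_(0 <= j' < n) space_weight a j' * cell_cov j' j.

Lemma span_row a i : (i < m)%N -> in_span T W (row_mode a i).
Proof.
move=> im; apply: span_lincomb => j; rewrite mem_index_iota => /andP[_ jn].
exact: span_cell.
Qed.

Lemma span_noise_mode a t : in_span T W (noise_mode a t).
Proof.
apply: span_lincomb => i; rewrite mem_index_iota => /andP[_ im].
exact: span_row.
Qed.

Lemma pairing_row a i i' : (i < m)%N -> (i' < m)%N ->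
  pairing P (row_mode a i) (row_mode a i') = (i == i')%:R * k * mode_var a.
Proof.
move=> im im'.
rewrite /row_mode (pairing_sum noise); last 2 first.
- by move=> j; rewrite mem_index_iota => /andP[_ jn]; exact: span_cell.
- exact: span_row.
rewrite /mode_var mulr_sumr big_nat [RHS]big_nat; apply: eq_bigr => j /andP[_ jn].
rewrite mulrCA; congr (_ * _).
rewrite pairingC (pairing_sum noise); last 2 first.
- by move=> j'; rewrite mem_index_iota => /andP[_ jn']; exact: span_cell.
- exact: span_cell.
rewrite mulr_sumr big_nat [RHS]big_nat; apply: eq_bigr => j' /andP[_ jn'].
by rewrite mulrCA pairing_cell// eq_sym.
Qed.

(** The summands have no definite sign; the sum is nonnegative because, multiplied by [k], it is the
    second moment of a row mode. *)
Lemma mode_var_ge0 a : 0 <= mode_var a.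
Proof.
rewrite -(pmulr_rge0 _ k0) -[k]mul1r -(_ : (0%N == 0%N)%:R = 1 :> R)// -(pairing_row a m0 m0).
by apply: Rintegral_ge0 => w _; rewrite -expr2 sqr_ge0.
Qed.

Lemma pairing_noise_mode a t :
  pairing P (noise_mode a t) (noise_mode a t) =
  \sum_(0 <= i < m) time_weight a t i ^+ 2 * (k * mode_var a).
Proof.
rewrite {1}/noise_mode (pairing_sum noise); last 2 first.
- by move=> i; rewrite mem_index_iota => /andP[_ im]; exact: span_row.
- exact: span_noise_mode.
rewrite big_nat [RHS]big_nat; apply: eq_bigr => i /andP[_ im].
rewrite expr2 -mulrA; congr (_ * _).
rewrite pairingC (pairing_sum noise); last 2 first.
- by move=> i'; rewrite mem_index_iota => /andP[_ im']; exact: span_row.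
- exact: span_row.
rewrite big_nat (eq_bigr (fun i' => if i' == i then time_weight a t i * (k * mode_var a) else 0)); last first.
  move=> i' /andP[_ im']; rewrite pairing_row//.
  by case: eqVneq => [->|_]; rewrite ?mul1r// !mul0r mulr0.
rewrite -big_nat -big_mkcond/= big_nat1_eq/= im; by [].
Qed.

Lemma norm_time_weight a t i : `|time_weight a t i| <= 1.
Proof.
rewrite normrM gtr0_norm ?invr_gt0// mulrC ler_pdivrMr// mul1r.
apply: (@le_trans _ _ (1 * fine (mI (cell k i)))).
  apply: (@norm_Rintegral_indic _ mI (cell k i) (fun s => upto t s * sin (a%:R * pi * (t - s)))).
  - exact: measurable_itv.
  - apply: measurable_funM; first exact: measurable_upto.
    by apply: continuous_measurable; exact: continuous_sin_kernel.
  - move=> s; rewrite normrM -[leRHS]mul1r ler_pM ?norm_upto//.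
    by rewrite ler_norml sin_geN1 sin_le1.
by rewrite mul1r -lee_fin fineK ?fin_num_measure//; [exact: frestr_cell|exact: measurable_itv].
Qed.

(** The number of time steps disappears here: there are [m] of them, each contributes at most
    [k * mode_var a], and [m * k = T]. *)
Lemma pairing_noise_mode_le a t :
  pairing P (noise_mode a t) (noise_mode a t) <= T * mode_var a.
Proof.
rewrite pairing_noise_mode.
apply: (@le_trans _ _ (\sum_(0 <= i < m) (k * mode_var a))).
  apply: ler_sum => i _; rewrite -[leRHS]mul1r ler_wpM2r//.
    by rewrite mulr_ge0 ?mode_var_ge0// ltW.
  by rewrite -real_normK ?num_real// expr_le1// norm_time_weight.
rewrite sumr_const_nat subn0 -[leLHS]mulr_natl mulrA.
by rewrite (_ : m%:R * k = T)// mulrC /k divfK// pnatr_eq0 -lt0n.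
Qed.

Lemma noise_mode_moment p a t : 2 <= p ->
  (\int[P]_w (`|noise_mode a t w| `^ p)%:E <=
   (gaussC p * (T * mode_var a) `^ (p / 2))%:E)%E.
Proof.
move=> p2; apply: gaussian_moment => //; first by apply: (span_gaussian noise); exact: span_noise_mode.
have zi := span_sqr_integrable noise (span_noise_mode a t).
rewrite -[leLHS]fineK; last exact: integrable_fin_num.
rewrite lee_fin (le_trans _ (pairing_noise_mode_le a t))//.
Qed.


Definition wz_field (w : Omega) (z : RR * RR) : R := wz_noise T m n (W w) z.1 z.2.

Lemma wz_fieldE w s y : wz_field w (s, y) =
  \sum_(0 <= i < m) \1_(cell k i) s *
    (k^-1 * \sum_(0 <= j < n) (h^-1 * cell_incr i j w) * \1_(cell h j) y).
Proof.
rewrite /wz_field /wz_noise /=; apply: eq_bigr => i _.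
rewrite !mulr_sumr; apply: eq_bigr => j _.
rewrite -/k -/h -/(cell_incr i j w) -/(cell k i) -/(cell h j) invfM.
have -> : \1_(cell k i `*` cell h j) (s, y) = \1_(cell k i) s * \1_(cell h j) y :> R.
  by rewrite !indicE in_setX /=; case: (_ \in _); case: (_ \in _); rewrite ?mulr1 ?mulr0.
by ring.
Qed.

Let measurable_cell_indic c i : measurable_fun setT (\1_(cell c i) : RR -> R).
Proof. by apply: measurable_indic; exact: measurable_itv. Qed.

Lemma measurable_wz_field w : measurable_fun setT (wz_field w).
Proof.
rewrite (_ : wz_field w = (fun z => wz_field w (z.1, z.2))); last first.
  by apply/funext => -[].
under eq_fun do rewrite wz_fieldE.
apply: measurable_sum => i; apply: measurable_funM.
  by apply: (measurableT_comp (measurable_cell_indic k i)); exact: measurable_fst_R.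
apply: measurable_funM => //; apply: measurable_sum => j; apply: measurable_funM => //.
by apply: (measurableT_comp (measurable_cell_indic h j)); exact: measurable_snd_R.
Qed.

Lemma wz_field_bnd w : exists K, forall z, `|wz_field w z| <= K.
Proof.
exists (\sum_(0 <= i < m) `|k^-1| * \sum_(0 <= j < n) `|h^-1 * cell_incr i j w|) => -[s y].
rewrite wz_fieldE (le_trans (ler_norm_sum _ _ _))//; apply: ler_sum => i _.
rewrite normrM -[leRHS]mul1r ler_pM//; first by rewrite norm_indic indicE lern1 leq_b1.
rewrite normrM ler_wpM2l//.
rewrite (le_trans (ler_norm_sum _ _ _))//; apply: ler_sum => j _.
by rewrite normrM -[leRHS]mulr1 ler_wpM2l// norm_indic indicE lern1 leq_b1.
Qed.

Lemma wz_field_integrable w : (mI \x mO)%E.-integrable setT (EFin \o wz_field w).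
Proof.
by have [K xK] := wz_field_bnd w; apply: integrable_prod_bnd xK => //; exact: measurable_wz_field.
Qed.

Let cell_eigfun_integrable a j : mO.-integrable setT (EFin \o (fun y => \1_(cell h j) y * eigfun a y)).
Proof.
apply: (@integrable_bnd _ _ _ mO _ 2); first by apply: measurable_funM => //; exact: measurable_eigfun.
by move=> y; rewrite normrM -[leRHS]mul1r ler_pM ?norm_eigfun// norm_indic indicE lern1 leq_b1.
Qed.

Lemma mode_wz_field a w s :
  mode a (wz_field w) s = \sum_(0 <= i < m) (k^-1 * row_mode a i w) * \1_(cell k i) s.
Proof.
rewrite /mode (_ : (fun y => _) = (fun y => \sum_(0 <= i < m) (\1_(cell k i) s * k^-1) *
    \sum_(0 <= j < n) (h^-1 * cell_incr i j w) * (\1_(cell h j) y * eigfun a y))); last first.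
  apply/funext => y; rewrite wz_fieldE mulr_suml; apply: eq_bigr => i _.
  rewrite -[LHS]mulrA -[_ * eigfun a y]mulrA mulr_suml -[RHS]mulrA; congr (_ * (_ * _)).
  by apply: eq_bigr => j _; rewrite !mulrA.
have Fi i : mO.-integrable setT (EFin \o (fun y => \sum_(0 <= j < n)
    (h^-1 * cell_incr i j w) * (\1_(cell h j) y * eigfun a y))).
  by apply: integrable_sumr => j _; apply: integrableZR.
rewrite Rintegral_sumr; last by move=> i _; exact: integrableZR.
apply: eq_bigr => i _; rewrite RintegralZl// [RHS]mulrAC [k^-1 * _]mulrC; congr (_ * _).
rewrite Rintegral_sumr; last by move=> j _; exact: integrableZR.
apply: eq_bigr => j _; rewrite RintegralZl// /space_weight -/(cell h j).
by rewrite mulrAC.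
Qed.

Lemma duhamel_wz_field a t w :
  a%:R * pi * duhamel T a (wz_field w) t = noise_mode a t w.
Proof.
rewrite duhamelE; last exact: wz_field_integrable.
have ki i : mI.-integrable setT (EFin \o (fun s => upto t s * sin (a%:R * pi * (t - s)) * \1_(cell k i) s)).
  apply: (@integrable_bnd _ _ _ mI _ 1).
    apply: measurable_funM => //; apply: measurable_funM; first exact: measurable_upto.
    by apply: continuous_measurable; exact: continuous_sin_kernel.
  move=> s; rewrite normrM -[leRHS]mul1r ler_pM//; last by rewrite norm_indic indicE lern1 leq_b1.
  rewrite normrM -[leRHS]mul1r ler_pM ?norm_upto//.
  by rewrite ler_norml sin_geN1 sin_le1.
have mf : measurable_fun setT (fun s => upto t s * wave_phi a (t - s) * mode a (wz_field w) s).
  apply: measurable_funM; last by apply: measurable_mode; exact: measurable_wz_field.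
  apply: measurable_funM; first exact: measurable_upto.
  by apply: measurable_wave_phi; apply: measurable_funB.
rewrite -RintegralZl_measurable//.
rewrite (_ : (fun s => _) = (fun s => \sum_(0 <= i < m) (k^-1 * row_mode a i w) *
   (upto t s * sin (a%:R * pi * (t - s)) * \1_(cell k i) s))); last first.
  apply/funext => s; rewrite mode_wz_field -natpi_wave_phi 2!mulr_sumr.
  by apply: eq_bigr => i _; ring.
rewrite Rintegral_sumr; last by move=> i _; exact: integrableZR.
apply: eq_bigr => i _; rewrite RintegralZl// /time_weight -/(cell k i).
by rewrite mulrAC.
Qed.

Lemma energy_wz_field t w :
  energy T (wz_field w) t = (\sum_(1 <= a <oo) (noise_mode a t w ^+ 2)%:E)%E.
Proof.
apply: eq_eseriesr => a _; congr EFin.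
by rewrite -duhamel_wz_field /eigval [RHS]exprMn.
Qed.

Lemma measurable_time_weight a i : measurable_fun setT (fun t : RR => time_weight a t i).
Proof.
apply: measurable_funM => //.
apply: (@measurable_fun_Rintegral _ _ RR RR R mI
  (fun z : RR * RR => upto z.1 z.2 * sin (a%:R * pi * (z.1 - z.2)) * \1_(cell k i) z.2)).
have m1 := @measurable_fst_R R; have m2 := @measurable_snd_R R.
apply: measurable_funM; last by apply: (measurableT_comp (measurable_cell_indic k i)).
apply: measurable_funM; first exact: measurable_upto.
under eq_fun do rewrite -natpi_wave_phi.
by apply: measurable_funM => //; apply: measurable_wave_phi; exact: measurable_funB.
Qed.

Lemma measurable_noise_mode a : measurable_fun setT (fun z : RR * Omega => noise_mode a z.1 z.2).
Proof.
(* Measurability of [row_mode a i] is known for [i < m] only, which the guard makes available term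
   by term. *)
rewrite (_ : (fun z => _) = (fun z : RR * Omega => \sum_(0 <= i < m)
  (if (i < m)%N then time_weight a z.1 i * row_mode a i z.2 else 0))); last first.
  by apply/funext => z; rewrite /noise_mode big_nat [RHS]big_nat; apply: eq_bigr => i /andP[_ ->].
apply: measurable_sum => i; case: (boolP (i < m)%N) => im //; apply: measurable_funM.
  by apply: (measurableT_comp (measurable_time_weight a i)); exact: measurable_fst.
by apply: (measurableT_comp (span_measurable noise (span_row a im))); exact: measurable_snd.
Qed.

(** Summing over [a] before taking expectations spares any estimate of the covariances between
    cells: Bessel and the disjointness of the cells leave only [n = h^-1] diagonal variances
    [k * h ^ (2H)], each weighted by [h^-1]. *)
Lemma sum_mode_var M : \sum_(1 <= a < M) mode_var a <= h `^ (2 * (H - 1)).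
Proof.
have mf w : measurable_fun setT (fun y : RR => \sum_(0 <= j < n) (h^-1 * cell_incr 0 j w) * \1_(cell h j) y).
  by apply: measurable_sum => j; exact: measurable_funM.
have bw w : \sum_(1 <= a < M) row_mode a 0 w ^+ 2 <= \sum_(0 <= j < n) h^-1 * (cell_incr 0 j w ^+ 2).
  rewrite -lee_fin; have := @bessel_eigfun R 1 M _ isT (mf w).
  rewrite (eq_bigr (fun a => row_mode a 0 w ^+ 2)); last first.
    move=> a _; congr (_ ^+ 2); rewrite (_ : (fun x => _) = (fun y => \sum_(0 <= j < n)
      (h^-1 * cell_incr 0 j w) * (\1_(cell h j) y * eigfun a y))); last first.
      by apply/funext => y; rewrite mulr_suml; apply: eq_bigr => j _; rewrite !mulrA.
    rewrite Rintegral_sumr; last by move=> j _; exact: integrableZR.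
    by apply: eq_bigr => j _; rewrite RintegralZl// /space_weight -/(cell h j) mulrAC.
  move=> /le_trans; apply; rewrite /sqint.
  rewrite (eq_integral (fun y => (\sum_(0 <= j < n) (h^-1 * cell_incr 0 j w) ^+ 2 * \1_(cell h j) y)%:E)); last first.
    by move=> y _; congr EFin; exact: sqr_sum_cell.
  have ii j : mO.-integrable setT (EFin \o \1_(cell h j)).
    by apply: (@integrable_bnd _ _ _ mO _ 1) => // x; rewrite norm_indic indicE lern1 leq_b1.
  have si : mO.-integrable setT (EFin \o (fun y => \sum_(0 <= j < n) (h^-1 * cell_incr 0 j w) ^+ 2 * \1_(cell h j) y)).
    by apply: integrable_sumr => j _; exact: integrableZR.
  rewrite -[leLHS]fineK; last exact: integrable_fin_num.
  rewrite lee_fin -/(Rintegral _ _ _) Rintegral_sumr; last by move=> j _; exact: integrableZR.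
  apply: ler_sum => j _; rewrite RintegralZl// /Rintegral integral_indic//; last exact: measurable_itv.
  rewrite setIT; set q := fine _; have qh : q <= h.
    by rewrite -lee_fin fineK ?fin_num_measure//; [exact: frestr_cell|exact: measurable_itv].
  rewrite (_ : _ * q = h^-1 * cell_incr 0 j w ^+ 2 * (h^-1 * q)); last by rewrite exprMn; ring.
  rewrite -[leRHS]mulr1 ler_wpM2l//; last by rewrite mulrC ler_pdivrMr// mul1r.
  by rewrite mulr_ge0 ?sqr_ge0// invr_ge0 ltW.
rewrite -(ler_pM2l k0) mulr_sumr.
rewrite (eq_bigr (fun a => \int[P]_w (row_mode a 0 w ^+ 2))); last first.
  move=> a _; have := pairing_row a m0 m0; rewrite eqxx mul1r => <-.
  by apply: eq_Rintegral => w _; rewrite expr2.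
have ri a : P.-integrable setT (EFin \o (fun w => row_mode a 0 w ^+ 2)).
  by apply: (span_sqr_integrable noise); exact: span_row.
have ci j : (j < n)%N -> P.-integrable setT (EFin \o (fun w => cell_incr 0 j w ^+ 2)).
  by move=> jn; apply: (span_sqr_integrable noise); exact: span_cell.
rewrite -Rintegral_sumr//.
apply: (@le_trans _ _ (\int[P]_w (\sum_(0 <= j < n) h^-1 * (cell_incr 0 j w ^+ 2)))).
  apply: le_Rintegral => //.
  - exact: integrable_sumr.
  - by apply: integrable_sumr => j; rewrite mem_index_iota => /andP[_ jn]; apply: integrableZR; exact: ci.
rewrite Rintegral_sumr; last first.
  by move=> j; rewrite mem_index_iota => /andP[_ jn]; apply: integrableZR; exact: ci.
rewrite big_nat (eq_bigr (fun=> h^-1 * (k * h `^ (2 * H)))); last first.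
  move=> j /andP[_ jn]; rewrite RintegralZl//; last exact: ci.
  rewrite -(cell_cov_diag j) -[k]mul1r -(_ : (0%N == 0%N)%:R = 1 :> R)// -(pairing_cell m0 jn m0 jn).
  by congr (_ * _); apply: eq_Rintegral => w _; rewrite expr2.
rewrite -big_nat sumr_const_nat subn0 -[leLHS]mulr_natl.
have -> : n%:R = h^-1 by rewrite invrK.
rewrite (_ : 2 * (H - 1) = 2 * H + - 2); last by ring.
rewrite powRD; last by rewrite (gt_eqF h0) implybT.
rewrite powRN (powR_mulrn 2 (ltW h0)) expr2 invfM le_eqVlt; apply/orP; left; apply/eqP.
by move: (h `^ _) => q; ring.
Qed.

Lemma measurable_wz_field_joint :
  measurable_fun setT (fun z : Omega * (RR * RR) => wz_field z.1 z.2).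
Proof.
rewrite (_ : (fun z => _) = (fun z : Omega * (RR * RR) => \sum_(0 <= i < m) \1_(cell k i) z.2.1 *
    (k^-1 * \sum_(0 <= j < n) (h^-1 *
      (if ((i < m) && (j < n))%N then cell_incr i j z.1 else 0)) * \1_(cell h j) z.2.2))); last first.
  apply/funext => -[w [s y]]; rewrite wz_fieldE /= big_nat [RHS]big_nat; apply: eq_bigr => i /andP[_ im].
  congr (_ * (_ * _)); rewrite big_nat [RHS]big_nat; apply: eq_bigr => j /andP[_ jn].
  by rewrite im jn.
have m2 : measurable_fun setT (snd : Omega * (RR * RR) -> RR * RR) by exact: measurable_snd.
have m21 : measurable_fun setT (fun z : Omega * (RR * RR) => z.2.1).
  by apply: (measurableT_comp (@measurable_fst _ _ RR RR)).
have m22 : measurable_fun setT (fun z : Omega * (RR * RR) => z.2.2).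
  by apply: (measurableT_comp (@measurable_snd _ _ RR RR)).
apply: measurable_sum => i; apply: measurable_funM.
  exact: (measurableT_comp (measurable_cell_indic k i) m21).
apply: measurable_funM => //; apply: measurable_sum => j; apply: measurable_funM; last first.
  exact: (measurableT_comp (measurable_cell_indic h j) m22).
apply: measurable_funM => //; case: (boolP ((i < m) && (j < n))%N) => // /andP[im jn].
apply: (measurableT_comp (span_measurable noise (span_cell im jn))); exact: measurable_fst.
Qed.

Lemma measurable_energy_wz_field :
  measurable_fun setT (fun z : RR * Omega => energy T (wz_field z.2) z.1).
Proof.
under eq_fun do rewrite energy_wz_field.
apply: (@measurable_nneseries _ _ (RR * Omega)%type (fun a z => noise_mode a z.1 z.2 ^+ 2)).
  by move=> a z; exact: sqr_ge0.
by move=> a; apply: measurable_funX; exact: measurable_noise_mode.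
Qed.

(** By [noise_mode_moment], the square of mode [a] has norm at most
    [gaussC p ^ (2 / p) * T * mode_var a] in [L^(p/2)]. These norms are summed by [series_moment]
    and [sum_mode_var]. *)
Lemma energy_wz_moment p t : 2 <= p ->
  (\int[P]_w (energy T (wz_field w) t `^ (p / 2)) <=
   ((gaussC p `^ (p / 2)^-1 * T * h `^ (2 * (H - 1))) `^ (p / 2))%:E)%E.
Proof.
move=> p2; under eq_integral do rewrite energy_wz_field.
have q1 : 1 <= p / 2 by rewrite ler_pdivlMr// mul1r.
have C0 := gaussC_ge0 p.
apply: (@series_moment _ _ _ P (fun a w => noise_mode a t w ^+ 2) _ q1 _ _
  (fun a => gaussC p `^ (p / 2)^-1 * T * mode_var a)).
- by move=> a w; exact: sqr_ge0.
- by move=> a; apply: measurable_funX; apply: (span_measurable noise); exact: span_noise_mode.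
- by move=> a; rewrite !mulr_ge0 ?powR_ge0 ?mode_var_ge0 ?(ltW T0).
- move=> a.
  have -> : (\int[P]_w ((noise_mode a t w ^+ 2) `^ (p / 2))%:E = \int[P]_w (`|noise_mode a t w| `^ p)%:E)%E.
    apply: eq_integral => w _; congr EFin; rewrite -[noise_mode a t w ^+ 2]real_normK ?num_real//.
    by rewrite -powR_mulrn// -powRrM mulrC divfK.
  rewrite -[_ * T * _]mulrA powRM ?powR_ge0 ?mulr_ge0 ?mode_var_ge0 ?(ltW T0)//.
  rewrite -powRrM mulVf; last by rewrite gt_eqF// (lt_le_trans ltr01).
  by rewrite powRr1//; exact: noise_mode_moment.
- move=> M; rewrite -mulr_sumr ler_wpM2l ?sum_mode_var//.
  by rewrite mulr_ge0 ?powR_ge0 ?(ltW T0).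
Qed.

End NoiseModes.

(** * Variation of constants for the scalar oscillator *)

Section ScalarWave.
Context {R : realType} (T : R).
Hypothesis T0 : 0 < T.
Local Notation RR := (measurableTypeR R).
Local Notation leb := (@lebesgue_measure R).
Local Notation mI := (lebI T).

Lemma lebI_integrable (f : RR -> R) t : t <= T -> mI.-integrable setT (EFin \o f) ->
  leb.-integrable `[0, t] (EFin \o f).
Proof.
move=> tT /integrableP[mf fi].
have mf' : measurable_fun setT (fun x : RR => `|(EFin \o f) x|%E) by exact: measurableT_comp.
apply: (@integrableS _ RR R leb `[0, T]) => //.
  by apply: subset_itvl; rewrite bnd_simp.
apply/integrableP; split; first exact: measurable_funTS.
by have := @integral_frestr _ RR R leb _ (measurable_itv `[0, T]) (lebesgue_itv_lty 0 T true false) _ mf' => ->.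
Qed.

Lemma continuous_leb_integrable (f : R -> R) (a b : R) : continuous f ->
  leb.-integrable `[a, b] (EFin \o f).
Proof.
move=> cf; apply: continuous_compact_integrable; first exact: segment_compact.
exact: continuous_subspaceT.
Qed.

(** The inner integral that Fubini leaves in [double_integral]: the two cut-offs select the interval
    from [r] to [t], on which the cosine integrates to the sine kernel. *)
Lemma Rintegral_upto_cos k r t : 0 < k -> 0 <= r <= T -> 0 <= t <= T ->
  \int[mI]_s (upto t s * upto s r * cos (- k * s + k * t)) = upto t r * (sin (k * (t - r)) / k).
Proof.
move=> k0 /andP[r0 rT] /andP[t0 tT].
have cc : continuous (fun s : R => cos (- k * s + k * t)) by exact: continuous_cos_lin.
have mf : measurable_fun setT (fun s : RR => upto t s * upto s r * cos (- k * s + k * t)).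
  by do 2?[apply: measurable_funM]; [exact: measurable_upto|exact: measurable_upto|exact: continuous_measurable].
have [rt|tr] := leP r t; last first.
  rewrite [upto t r]/upto leNgt tr mul0r (_ : (fun s => _) = cst 0); first by rewrite /Rintegral integral0.
  apply/funext => s; rewrite /upto; case: ifPn => st; last by rewrite !mul0r.
  by rewrite leNgt (le_lt_trans st tr) mulr0 mul0r.
rewrite [upto t r]/upto rt mul1r -Rintegral_lebI//.
transitivity (\int[leb]_(s in `[r, t]) cos (- k * s + k * t)).
  rewrite Rintegral_mkcond [RHS]Rintegral_mkcond; apply: eq_Rintegral => s _.
  rewrite !patchE /upto; case: ifPn => [|].
    rewrite inE/= in_itv/= => /andP[s0 sT].
    case: (boolP (s \in `[r, t]%classic)); first by rewrite inE/= in_itv/= => /andP[-> ->]; rewrite !mul1r.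
    by rewrite notin_setE/= in_itv/= => /negP; rewrite negb_and => /orP[] /negbTE ->; rewrite ?mulr0 ?mul0r.
  rewrite notin_setE/= in_itv/= => sT; rewrite ifF//; apply/negbTE; rewrite notin_setE/= in_itv/=.
  by apply: contra_not sT => /andP[rs st]; rewrite (le_trans r0 rs) (le_trans st tT).
move: rt; rewrite le_eqVlt => /predU1P[->|rt].
  by rewrite set_itv1 Rintegral_set1 subrr mulr0 sin0 mul0r.
have dF : forall x : R, is_derive x 1 (fun s : R => - k^-1 * sin (- k * s + k * t)) (cos (- k * x + k * t)); last first.
  rewrite (Rintegral_FTC2 rt cc dF) (_ : - k * t + k * t = 0); last by ring.
  rewrite sin0 mulr0 sub0r mulNr opprK mulrC; congr (sin _ / _); ring.
move=> x; have H := @is_derive_sin_lin R (- k) (k * t) x.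
apply: is_derive_eq; rewrite /GRing.scale/=; field; exact: lt0r_neq0.
Qed.

Section Equation.
Variables (k be : R) (d : R -> R) (f : RR -> R).
Hypothesis k0 : 0 < k.
Hypothesis cd : continuous d.
Hypothesis fi : mI.-integrable setT (EFin \o f).

Let mf : measurable_fun setT f.
Proof. by apply/measurable_EFinP; exact: (measurable_int _ fi). Qed.

Let F s := \int[mI]_r (upto s r * f r).

Hypothesis dE : forall s : R, 0 < s < T -> is_derive s 1 d
  (be - k ^+ 2 * (\int[leb]_(r in `[0, s]) d r) + F s).

Let D s := \int[leb]_(r in `[0, s]) d r.

Let D_derive (s : R) : 0 < s -> is_derive s 1 D (d s).
Proof.
move=> s0; have [] := @continuous_FTC1_closed R d 0 s (s + 1).
- by rewrite ltrDl.
- exact: continuous_leb_integrable.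
- exact: s0.
- exact: cd.
by move=> dD <-; rewrite derive1E; exact: derivableP.
Qed.

Let F_cont t : 0 <= t <= T -> {within `[0, t], continuous F}.
Proof.
move=> /andP[t0 tT].
have := parameterized_integral_continuous t0 (lebI_integrable tT fi).
apply: subspace_eq_continuous => x; rewrite inE/= in_itv/= => /andP[x0 xt].
change (\int[leb]_(s in `[0, x]) f s = \int[mI]_s (upto x s * f s)).
by rewrite (@Rintegral_upto _ T)// x0 (le_trans xt).
Qed.

Let sn t s := sin (- k * s + k * t) / k.
Let cs t s := cos (- k * s + k * t).

(* By [dE], the bracket is [d' - F]; with it, [r t] has the derivative
   [cs t * F], in which [d] no longer occurs. *)
Let r t s := sn t s * (be - k ^+ 2 * D s) + cs t s * d s.

Let r_derive (t s : R) : 0 < s < T -> is_derive s 1 (r t) (cs t s * F s).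
Proof.
move=> sT; have /andP[s0 _] := sT.
have dD := D_derive s0; have dd := dE sT.
have ds := @is_derive_sin_lin R (- k) (k * t) s.
have dc := @is_derive_cos_lin R (- k) (k * t) s.
rewrite /r /sn /cs; apply: is_derive_eq.
rewrite /GRing.scale/= -/(D s); move: (sin _) (cos _) (D s) (d s) (F s) => *; field.
exact: lt0r_neq0.
Qed.

Let variation t : 0 < t <= T -> \int[leb]_(s in `[0, t]) (cs t s * F s) = r t t - r t 0.
Proof.
move=> /andP[t0 tT].
have cc : continuous (cs t) by exact: continuous_cos_lin.
have cs' : continuous (sn t).
  by move=> x; apply: cvgM; [exact: continuous_sin_lin|exact: cvg_cst].
have cD : {within `[0, t], continuous D}.
  apply: (@parameterized_integral_continuous R 0 t d (ltW t0)).
  exact: continuous_leb_integrable.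
have [_ D0 Dt] := (continuous_within_itvP _ t0).1 cD.
rewrite /Rintegral (continuous_FTC2 (F := r t) t0)//.
- move=> x; apply: (@continuousM _ _ (cs t : subspace `[0, t] -> R) F); last by apply: F_cont; rewrite (ltW t0).
  exact: continuous_subspaceT.
- split.
  + move=> x; rewrite in_itv/= => /andP[x0 xt]; have := @r_derive t x; rewrite x0 (lt_le_trans xt tT).
    by move=> /(_ isT)[].
  + apply: cvgD; apply: cvgM.
    * by apply: cvg_at_right_filter; exact: cs'.
    * apply: cvgB; first exact: cvg_cst.
      by apply: cvgM => //; exact: cvg_cst.
    * by apply: cvg_at_right_filter; exact: cc.
    * by apply: cvg_at_right_filter; exact: cd.
  + apply: cvgD; apply: cvgM; last 2 first.
    * by apply: cvg_at_left_filter; exact: cc.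
    * by apply: cvg_at_left_filter; exact: cd.
    * by apply: cvg_at_left_filter; exact: cs'.
    apply: cvgB; first exact: cvg_cst.
    by apply: cvgM => //; exact: cvg_cst.
- move=> x; rewrite in_itv/= => /andP[x0 xt]; have := @r_derive t x; rewrite x0 (lt_le_trans xt tT).
  by move=> /(_ isT) H; rewrite derive1E; exact: derive_val.
Qed.

Let double_integral t : 0 <= t <= T ->
  \int[leb]_(s in `[0, t]) (cs t s * F s) = \int[mI]_s (upto t s * (sin (k * (t - s)) / k) * f s).
Proof.
move=> tT.
have mc : measurable_fun setT (cs t) by apply: continuous_measurable; exact: continuous_cos_lin.
pose G (z : RR * RR) := upto t z.1 * upto z.1 z.2 * cs t z.1 * f z.2.
have m1 := @measurable_fst_R R; have m2 := @measurable_snd_R R.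
have f2 : (mI \x mI)%E.-integrable setT (EFin \o (fun z => f z.2)).
  apply/integrable12ltyP; first by apply/measurable_EFinP; exact: (measurableT_comp mf).
  have /integrableP[_] := fi.
  set c := integral _ _ _ => cy.
  rewrite (_ : integral _ _ _ = \int[mI]_x c)%E//.
  have c0 : (0 <= c)%E by exact: integral_ge0.
  have cf : c \is a fin_num by rewrite ge0_fin_numE.
  rewrite (_ : integral _ _ _ = (c * mI setT)%E); last exact: integral_cst.
  by rewrite lebI_setT// lte_mul_pinfty// ltry.
have Gi : (mI \x mI)%E.-integrable setT (EFin \o G).
  apply: (le_integrableR (g := fun z => `|f z.2|)); last exact: integrable_norm.
    apply: measurable_funM; last exact: (measurableT_comp mf).
    apply: measurable_funM; last exact: (measurableT_comp mc).
    by apply: measurable_funM; exact: measurable_upto.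
  move=> z; rewrite /G normrM ler_piMl// normrM -[leRHS]mulr1 ler_pM//; last first.
    by rewrite ler_norml cos_geN1 cos_le1.
  by rewrite normrM -[leRHS]mulr1 ler_pM// norm_upto.
have mF : measurable_fun setT F.
  apply: (@measurable_fun_Rintegral _ _ RR RR R mI (fun z => upto z.1 z.2 * f z.2)).
  apply: measurable_funM; last exact: (measurableT_comp mf).
  exact: measurable_upto.
rewrite (Rintegral_upto tT); last exact: measurable_funM.
transitivity (\int[(mI \x mI)%E]_z G z).
  rewrite Rintegral_fubini1//; apply: eq_Rintegral => s _; rewrite /G /=.
  rewrite mulrA -RintegralZl_measurable; last first.
    by apply: measurable_funM => //; exact: measurable_upto.
  by apply: eq_Rintegral => r' _; ring.
have ms : measurable_fun setT (fun s : RR => upto t s * (sin (k * (t - s)) / k) * f s).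
  apply: measurable_funM => //; apply: measurable_funM; first exact: measurable_upto.
  by apply: measurable_funM => //; apply: continuous_measurable; exact: continuous_sin_kernel.
have mG : measurable_fun setT (fun r => \int[mI]_s G (s, r)).
  apply: (@measurable_fun_Rintegral _ _ RR RR R mI (fun z => G (z.2, z.1))).
  apply: measurable_funM; last exact: (measurableT_comp mf).
  apply: measurable_funM; last exact: (measurableT_comp mc).
  by apply: measurable_funM; exact: measurable_upto.
rewrite Rintegral_fubini2// -!Rintegral_lebI//; apply: eq_Rintegral => r'.
rewrite inE/= in_itv/= => rT; rewrite -(Rintegral_upto_cos k0 rT tT) mulrC.
rewrite -RintegralZl_measurable; last first.
  by apply: measurable_funM; [apply: measurable_funM; exact: measurable_upto|exact: mc].
by apply: eq_Rintegral => s _; rewrite /G /= mulrC.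
Qed.

(** The equation enters in its once integrated form [dE], because [f] is merely integrable and [d]
    need not have a second derivative. Integrating the derivative of [r t] from 0 to [t] yields a
    cosine kernel against the primitive [F]; exchanging the integrals turns it into the sine kernel
    against [f]. *)
Lemma wave_variation t : 0 <= t <= T ->
  d t = cos (k * t) * d 0 + sin (k * t) / k * be + \int[mI]_s (upto t s * (sin (k * (t - s)) / k) * f s).
Proof.
move=> /andP[]; rewrite le_eqVlt => /predU1P[<- _|t0 tT].
  rewrite mulr0 cos0 sin0 !mul0r mul1r addr0.
  under eq_Rintegral do rewrite -mulrA.
  rewrite -Rintegral_upto ?lexx ?(ltW T0)//; last first.
    apply: measurable_funM => //; apply: measurable_funM => //; apply: continuous_measurable.
    exact: continuous_sin_kernel.
  by rewrite set_itv1 Rintegral_set1 addr0.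
rewrite -double_integral ?(ltW t0)// variation ?t0// /r /sn /cs.
rewrite (_ : - k * t + k * t = 0); last by ring.
rewrite mulr0 add0r sin0 cos0 mul0r mul0r add0r mul1r.
by rewrite /D set_itv1 Rintegral_set1 mulr0 subr0; ring.
Qed.

End Equation.
End ScalarWave.

(** * Inner products and norms on the unit interval, and the Galerkin spaces *)

Section L2Toolkit.
Context {R : realType}.
Local Notation RR := (measurableTypeR R).
Local Notation leb := (@lebesgue_measure R).
Local Notation mO := (@lebO R).
Implicit Types (v w : R -> R) (a N : nat).

Lemma ip_lebO v w : measurable_fun dom v -> measurable_fun setT w ->
  ip v w = \int[mO]_x ((v \_ dom) x * w x).
Proof.
move=> mv mw; rewrite /ip.
have mvw : measurable_fun dom (fun x => v x * w x).
  by apply: measurable_funM => //; exact: measurable_funTS.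
have -> := @Rintegral_frestr_patch _ RR R leb _ measurable_dom (lebesgue_itv_lty 0 1 false true) _ mvw.
apply: eq_Rintegral => x _.
by rewrite !patchE; case: ifP => // _; rewrite /point/= mul0r.
Qed.

Lemma measurable_patch v : measurable_fun dom v -> measurable_fun setT (v \_ dom).
Proof. by move=> mv; apply/(measurable_restrictT v measurable_dom). Qed.

Lemma l2norm_lebO v : measurable_fun dom v -> l2norm v = (sqint mO (v \_ dom) `^ 2^-1)%E.
Proof.
move=> mv; rewrite /l2norm unlock /=; congr poweR.
have m2 : measurable_fun setT (fun x : RR => (((v \_ dom) x) ^+ 2)%:E).
  by apply/measurable_EFinP; apply: measurable_funX; exact: measurable_patch.
have := @integral_frestr _ RR R leb _ measurable_dom (lebesgue_itv_lty 0 1 false true) _ m2.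
rewrite /sqint /lebO => <-; rewrite [RHS]integral_mkcond; apply: eq_integral => x _.
rewrite /= powR_mulrn// real_normK ?num_real//.
by rewrite !patchE; case: ifP => // _; rewrite /point/= expr0n.
Qed.

Lemma l2norm_sqint v (g : RR -> R) : measurable_fun setT g -> (forall x, dom x -> v x = g x) ->
  l2norm v = (sqint mO g `^ 2^-1)%E.
Proof.
move=> mg vg; have mv : measurable_fun dom v.
  apply: (eq_measurable_fun g); first by move=> x; rewrite inE => /vg.
  exact: measurable_funTS mg.
rewrite l2norm_lebO//; congr poweR; rewrite /sqint; apply: ae_eq_integral => //.
- by apply/measurable_EFinP; apply: measurable_funX; exact: measurable_patch.
- by apply/measurable_EFinP; exact: measurable_funX.
- apply: (@ae_imp _ RR R mO _ _ _ (@lebO_ae R)) => y yd _ /=.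
  by rewrite patchE mem_set// vg.
Qed.

(** Bessel for the single index [a], in place of Cauchy-Schwarz. *)
Lemma ip_eigfun_sqr v a : (0 < a)%N -> measurable_fun dom v ->
  ((ip v (eigfun a) ^+ 2)%:E <= sqint mO (v \_ dom))%E.
Proof.
move=> a0 mv; rewrite ip_lebO//; last exact: measurable_eigfun.
by have := @bessel_eigfun R a a.+1 (v \_ dom) a0 (measurable_patch mv); rewrite big_nat1.
Qed.

Lemma ip_eigfun_le v a : (0 < a)%N -> measurable_fun dom v ->
  (`|ip v (eigfun a)|%:E <= l2norm v)%E.
Proof.
move=> a0 mv; rewrite l2norm_lebO// -sqrtr_sqr -powR12_sqrt ?sqr_ge0// -poweR_EFin.
by apply: lee_poweR; rewrite ?invr_ge0 ?lee_fin ?sqr_ge0//; exact: ip_eigfun_sqr.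
Qed.

Lemma measurable_eigfun_lincomb N (c : nat -> R) :
  measurable_fun setT (fun x : R => \sum_(1 <= a < N.+1) c a * eigfun a x).
Proof. by apply: measurable_sum => a; apply: measurable_funM => //; exact: measurable_eigfun. Qed.

Lemma measurable_VN N v : VN N v -> measurable_fun dom v.
Proof.
move=> [c vc]; apply: (eq_measurable_fun (fun x => \sum_(1 <= a < N.+1) c a * eigfun a x)).
  by move=> x; rewrite inE => /vc.
apply: measurable_funTS; exact: measurable_eigfun_lincomb.
Qed.

Lemma eigfun_integrable2 a b : mO.-integrable setT (EFin \o (fun x => eigfun b x * eigfun a x)).
Proof.
apply: (@integrable_bnd _ _ _ mO _ (2 * 2)).
  by apply: measurable_funM; exact: measurable_eigfun.
by move=> x; rewrite normrM ler_pM ?norm_eigfun.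
Qed.

Lemma eq_ip v v' w : (forall x, dom x -> v x = v' x) -> ip v w = ip v' w.
Proof. by move=> vv; apply: eq_Rintegral => x; rewrite inE => /vv ->. Qed.

Lemma ip_lincomb N v (c : nat -> R) a : (0 < a <= N)%N ->
  (forall x, dom x -> v x = \sum_(1 <= b < N.+1) c b * eigfun b x) -> ip v (eigfun a) = c a.
Proof.
move=> /andP[a0 aN] vc; rewrite (eq_ip _ vc) /ip.
rewrite Rintegral_lebO; last first.
  by apply: measurable_funM; [exact: measurable_eigfun_lincomb|exact: measurable_eigfun].
rewrite (_ : (fun x => _) = (fun x => \sum_(1 <= b < N.+1) c b * (eigfun b x * eigfun a x))); last first.
  by apply/funext => x; rewrite mulr_suml; apply: eq_bigr => b _; rewrite mulrA.
rewrite Rintegral_sumr; last by move=> b _; apply: integrableZR; exact: eigfun_integrable2.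
rewrite big_nat (eq_bigr (fun b => if b == a then c a else 0)); last first.
  move=> b /andP[b0 _]; rewrite RintegralZl//; last exact: eigfun_integrable2.
  by rewrite eigfun_orthonormal//; case: eqVneq => [->|_]; rewrite ?mulr1 ?mulr0.
by rewrite -big_nat -big_mkcond/= big_nat1_eq/= a0 ltnS aN.
Qed.

Lemma VN_coefs N v x : VN N v -> dom x ->
  v x = \sum_(1 <= a < N.+1) ip v (eigfun a) * eigfun a x.
Proof.
move=> [c vc] dx; rewrite vc// big_nat [RHS]big_nat; apply: eq_bigr => a aN.
by rewrite (ip_lincomb _ vc).
Qed.

Lemma VN_eigfun N a : (0 < a <= N)%N -> VN N (@eigfun R a).
Proof.
move=> /andP[a0 aN]; exists (fun b => (b == a)%:R) => x _.
rewrite (eq_bigr (fun b => if b == a then eigfun a x else 0)); last first.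
  by move=> b _; case: eqVneq => [->|_]; rewrite ?mul1r ?mul0r.
by rewrite -big_mkcond/= big_nat1_eq/= a0 ltnS aN.
Qed.

Lemma derive1n2_eigfun a : derive1n 2 (@eigfun R a) = (fun x => - eigval a * eigfun a x).
Proof.
have dcl (k x : R) : is_derive x 1 (fun y : R => Num.sqrt 2 * cos (k * y)) (- Num.sqrt 2 * (k * sin (k * x))).
  have := @is_derive_cos_lin R k 0 x; under eq_fun do rewrite addr0; rewrite addr0 => H.
  by apply: is_derive_eq; rewrite /GRing.scale/=; ring.
have dsl (k x : R) : is_derive x 1 (fun y : R => Num.sqrt 2 * sin (k * y)) (k * (Num.sqrt 2 * cos (k * x))).
  have := @is_derive_sin_lin R k 0 x; under eq_fun do rewrite addr0; rewrite addr0 => H.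
  by apply: is_derive_eq; rewrite /GRing.scale/=; ring.
set k := a%:R * pi : R.
have e1 : derive1 (@eigfun R a) = (fun x => k * (Num.sqrt 2 * cos (k * x))).
  apply/funext => x; rewrite derive1E (_ : eigfun a = (fun y => Num.sqrt 2 * sin (k * y))).
    by apply: derive_val; exact: dsl.
  by apply/funext => y; rewrite eigfunE.
rewrite derive1nS /= e1; apply/funext => x; rewrite derive1E.
have H := dcl k x.
have H2 : is_derive x 1 (fun x => k * (Num.sqrt 2 * cos (k * x))) (- eigval a * eigfun a x).
  by apply: is_derive_eq; rewrite /GRing.scale/= eigfunE /eigval -/k; ring.
exact: derive_val.
Qed.

Lemma is_derive_near (f : R -> R) (t l : R) :
  (forall e, 0 < e -> \forall s \near t, s != t -> `|(f s - f t) / (s - t) - l| <= e) ->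
  is_derive t 1 f l.
Proof.
move=> H.
have cf : (h^-1 *: ((f \o shift t) (h *: (1 : R)) - f t) : R) @[h --> (0 : R)^'] --> l.
  apply/cvgrPdist_le => e e0; have /nbhs_ballP[r /= r0 br] := H _ e0.
  near=> h; have h0 : h != 0 by near: h; exact: nbhs_dnbhs_neq.
  have hr : `|h| < r by near: h; exact: dnbhs0_lt.
  have := br (h + t); rewrite /= /ball/= opprD addrCA subrr addr0 normrN => /(_ hr).
  rewrite addrC -subr_eq0 addrAC subrr add0r => /(_ h0).
  rewrite distrC /GRing.scale/= mulr1 (addrC h) mulrC; congr (_ <= _); congr (`|_ - _|).
apply: DeriveDef; first exact: cvgP cf.
exact: cvg_lim cf.
Unshelve. all: by end_near.
Qed.

End L2Toolkit.

(** * Sine coefficients of the Galerkin solution *)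

Section Galerkin.
Context {R : realType} (T L : R) (b : R -> R) (N : nat) (U : R -> R -> R) (u0 v0 : R -> R).
Local Notation RR := (measurableTypeR R).
Local Notation leb := (@lebesgue_measure R).
Local Notation mI := (lebI T).
Local Notation mO := (@lebO R).
Local Notation mP := (mI \x mO)%E.
Variable xi : RR * RR -> R.
Hypothesis T0 : 0 < T.
Hypothesis L0 : 0 <= L.
Hypothesis bL : forall x y, `|b x - b y| <= L * `|x - y|.
Hypothesis xii : mP.-integrable setT (EFin \o xi).
Hypothesis VU : forall t, 0 <= t <= T -> VN N (U t) /\ l2_continuous_at `[0, T] U t.
Hypothesis U0 : forall x, dom x -> U 0 x = projN N u0 x.
Hypothesis DU : forall t, 0 < t <= T -> exists duN : R -> R,
  [/\ VN N duN, l2_derive_at `[0, T] U t duN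
    & forall v, VN N v -> ip duN v = ip (projN N v0) v
        + \int[leb]_(s in `[0, t]) ip (U s) (derive1n 2 v)
        + \int[leb]_(s in `[0, t]) ip (fun x => b (U s x) + xi (s, x)) v].

(* Times outside [[0, T]] are projected to it: the coefficients then become
   continuous on the whole line. *)
Definition clamp (t : R) : R := Num.max 0 (Num.min t T).

Lemma clamp_itv t : 0 <= clamp t <= T.
Proof. by rewrite /clamp le_max lexx/= ge_max (ltW T0)/= ge_min lexx orbT. Qed.

Lemma clamp_id t : 0 <= t <= T -> clamp t = t.
Proof. by move=> /andP[t0 tT]; rewrite /clamp min_l// max_r. Qed.

Lemma continuous_clamp : continuous clamp.
Proof.
move=> t; apply: (@continuous_max R R (fun=> 0) (fun t => Num.min t T)); first exact: cvg_cst.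
by apply: continuous_min; [exact: cvg_id|exact: cvg_cst].
Qed.

Definition gcoef a t : R := ip (U (clamp t)) (eigfun a).

(** The Galerkin path rebuilt from its clamped coefficients. It agrees with [U] for times in
    [[0, T]] and points of [dom], and is measurable and bounded on the whole plane. *)
Definition gfield (z : RR * RR) : R := \sum_(1 <= a < N.+1) gcoef a z.1 * eigfun a z.2.

Lemma gfieldE t x : 0 <= t <= T -> dom x -> U t x = gfield (t, x).
Proof.
move=> tT dx; have [VUt _] := VU tT.
by rewrite (VN_coefs VUt dx); apply: eq_bigr => a _; rewrite /gcoef clamp_id.
Qed.

Lemma gcoef_cont a : (0 < a <= N)%N -> continuous (gcoef a).
Proof.
move=> aN t; have [VUt cU] := VU (clamp_itv t).
apply/cvgrPdist_le => e e0.
have e0' : nbhs (0%E : \bar R) [set y | y < e%:E]%E.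
  by apply: open_nbhs_nbhs; split; [exact: open_ereal_lt_ereal|rewrite /= lte_fin].
have H1 : \forall y \near clamp t, `[0, T]%classic y ->
  (l2norm (fun x => (U y x - U (clamp t) x)%R) < e%:E)%E := cU _ e0'.
have H2 : \forall s \near t, `[0, T]%classic (clamp s) ->
  (l2norm (fun x => (U (clamp s) x - U (clamp t) x)%R) < e%:E)%E := @continuous_clamp t _ H1.
near=> s.
have Us : (l2norm (fun x => (U (clamp s) x - U (clamp t) x)%R) < e%:E)%E.
  have cT : `[0, T]%classic (clamp s) by rewrite /= in_itv/= clamp_itv.
  by move: cT; near: s; exact: H2.
have [VUs _] := VU (clamp_itv s).
have mU : measurable_fun dom (fun x => U (clamp s) x - U (clamp t) x).
  by apply: measurable_funB; [exact: measurable_VN VUs|exact: measurable_VN VUt].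
have := le_lt_trans (ip_eigfun_le (proj1 (andP aN)) mU) Us; rewrite lte_fin.
rewrite (@ip_lincomb _ N _ (fun b => gcoef b s - gcoef b t) _ aN); first by rewrite distrC => /ltW.
move=> x dx; rewrite (VN_coefs VUs dx) (VN_coefs VUt dx) -sumrB.
by apply: eq_bigr => c _; rewrite mulrBl.
Unshelve. all: by end_near.
Qed.

Lemma gcoef_bnd a : (0 < a <= N)%N -> exists K, forall t, `|gcoef a t| <= K.
Proof.
move=> aN; have cn : {within `[0, T], continuous (fun t => `|gcoef a t|)}.
  apply: continuous_subspaceT => t; apply: (@continuous_comp _ _ _ (gcoef a) Num.norm).
    exact: gcoef_cont.
  exact: norm_continuous.
have [c cT cmax] := EVT_max (ltW T0) cn.
exists `|gcoef a c| => t; have := cmax (clamp t); rewrite in_itv/= clamp_itv => /(_ isT).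
by rewrite /gcoef (clamp_id (clamp_itv t)).
Qed.

Lemma measurable_gfield : measurable_fun setT gfield.
Proof.
rewrite (_ : gfield = (fun z => \sum_(1 <= a < N.+1) (if (0 < a <= N)%N then gcoef a z.1 else 0) * eigfun a z.2)); last first.
  apply/funext => z; rewrite /gfield big_nat [RHS]big_nat; apply: eq_bigr => a aN.
  by rewrite -ltnS aN.
apply: measurable_sum => a; apply: measurable_funM.
  case: (boolP (0 < a <= N)%N) => // aN.
  apply: (measurableT_comp (f := gcoef a)); last exact: measurable_fst_R.
  by apply: continuous_measurable; exact: gcoef_cont.
by apply: measurable_eigfun_comp; exact: measurable_snd_R.
Qed.

Lemma gfield_bnd : exists K, forall z, `|gfield z| <= K.
Proof.
have /choice[K gK] : forall a, exists K, (0 < a <= N)%N -> forall t, `|gcoef a t| <= K.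
  move=> a; case: (boolP (0 < a <= N)%N) => aN; last by exists 0.
  by have [K gK] := gcoef_bnd aN; exists K.
exists (\sum_(1 <= a < N.+1) K a * 2) => z.
rewrite (le_trans (ler_norm_sum _ _ _))// big_nat [leRHS]big_nat; apply: ler_sum => a aN.
by rewrite normrM ler_pM ?norm_eigfun// gK// -ltnS.
Qed.

Lemma gfield_integrable : mP.-integrable setT (EFin \o gfield).
Proof.
by have [K gK] := gfield_bnd; apply: integrable_prod_bnd gK => //; exact: measurable_gfield.
Qed.

Let F z := b (gfield z) + xi z.

Let Fi : mP.-integrable setT (EFin \o F).
Proof. have bi : mP.-integrable setT (EFin \o (fun z => b (gfield z))) by exact: (integrable_bcomp L0 bL gfield_integrable).
exact: (integrableDR bi xii). Qed.

Let mF : measurable_fun setT F := measurable_integrableR Fi.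

Let force a t : 0 <= t <= T ->
  \int[leb]_(s in `[0, t]) ip (fun x => b (U s x) + xi (s, x)) (eigfun a) =
  \int[mI]_s (upto t s * mode a F s).
Proof.
move=> /andP[t0 tT].
transitivity (\int[leb]_(s in `[0, t]) mode a F s); last first.
  by apply: Rintegral_upto; [rewrite t0|exact: measurable_mode].
apply: eq_Rintegral => s; rewrite inE/= in_itv/= => /andP[s0 st].
rewrite (@eq_ip _ _ (fun x => F (s, x))); last first.
  by move=> x dx; rewrite /F -gfieldE// s0 (le_trans st).
rewrite /ip Rintegral_lebO//; apply: measurable_funM; last exact: measurable_eigfun.
exact: measurable_fun_pair2.
Qed.

Let stiffness a t : (0 < a <= N)%N -> 0 <= t <= T ->
  \int[leb]_(s in `[0, t]) ip (U s) (derive1n 2 (eigfun a)) =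
  - eigval a * \int[leb]_(s in `[0, t]) gcoef a s.
Proof.
move=> aN /andP[t0 tT]; rewrite derive1n2_eigfun -RintegralZl//; last first.
  by apply: continuous_leb_integrable; exact: gcoef_cont.
apply: eq_Rintegral => s; rewrite inE/= in_itv/= => /andP[s0 st].
have sT : 0 <= s <= T by rewrite s0 (le_trans st).
have [/measurable_VN mU _] := VU sT.
rewrite /gcoef clamp_id// !ip_lebO//; last 2 first.
- exact: measurable_eigfun.
- by apply: measurable_funM => //; exact: measurable_eigfun.
rewrite -RintegralZl_measurable; last first.
  by apply: measurable_funM; [exact: measurable_patch|exact: measurable_eigfun].
by apply: eq_Rintegral => x _; rewrite mulrCA.
Qed.

(** Testing with [eigfun a] makes the Laplacian act as [- eigval a], and the [L^2] derivative passes
    to coefficients by [ip_eigfun_le]. The times are strictly inside, where the derivative within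
    [[0, T]] is two-sided. *)
Let gcoef_derive a t : (0 < a <= N)%N -> 0 < t < T ->
  is_derive t 1 (gcoef a) (ip v0 (eigfun a) - eigval a * (\int[leb]_(s in `[0, t]) gcoef a s)
    + \int[mI]_s (upto t s * mode a F s)).
Proof.
move=> aN /andP[t0 tT]; have tT' : 0 < t <= T by rewrite t0 ltW.
have tT0 : 0 <= t <= T by rewrite !ltW.
have [du [Vdu ddu /(_ _ (VN_eigfun aN))]] := DU tT'.
rewrite (stiffness aN tT0) (force _ tT0).
rewrite (@ip_lincomb _ N (projN N v0) (fun a => ip v0 (eigfun a)) a aN)// mulNr => <-.
apply: is_derive_near => e e0.
have e0' : nbhs (0%E : \bar R) [set y | y < e%:E]%E.
  by apply: open_nbhs_nbhs; split; [exact: open_ereal_lt_ereal|rewrite /= lte_fin].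
have H : \forall s \near t, s != t -> `[0, T]%classic s ->
  (l2norm (fun x => ((U s x - U t x) / (s - t) - du x)%R) < e%:E)%E := ddu _ e0'.
have sT : \forall s \near t, 0 < s < T.
  have : open_nbhs t (`]0, T[%classic : set R) by split; [exact: interval_open|rewrite /= in_itv/= t0 tT].
  by move=> /open_nbhs_nbhs; apply: filterS => s; rewrite /= in_itv.
near=> s => st.
have sT' : 0 < s < T by near: s.
have sT0 : 0 <= s <= T by case/andP: sT' => *; rewrite !ltW.
have Us : (l2norm (fun x => ((U s x - U t x) / (s - t) - du x)%R) < e%:E)%E.
  have cT : `[0, T]%classic s by rewrite /= in_itv.
  by move: st cT; near: s; exact: H.
have [VUs _] := VU sT0; have [VUt _] := VU tT0.
have mU : measurable_fun dom (fun x => (U s x - U t x) / (s - t) - du x).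
  apply: measurable_funB; last exact: measurable_VN Vdu.
  apply: measurable_funM => //; apply: measurable_funB.
    exact: measurable_VN VUs.
  exact: measurable_VN VUt.
have := le_lt_trans (ip_eigfun_le (proj1 (andP aN)) mU) Us; rewrite lte_fin => /ltW.
rewrite (@ip_lincomb _ N _ (fun c => (gcoef c s - gcoef c t) / (s - t) - ip du (eigfun c)) _ aN)//.
move=> x dx; rewrite (VN_coefs VUs dx) (VN_coefs VUt dx) (VN_coefs Vdu dx).
rewrite -sumrB mulr_suml -sumrB.
apply: eq_bigr => c _; rewrite /gcoef !clamp_id//; ring.
Unshelve. all: by end_near.
Qed.

(** An implicit representation, since the forcing depends on the coefficients through
    [b (gfield z)]. It has the same form as that of the mild solution, so the two can be subtracted
    mode by mode. *)
Lemma gcoef_wave a t : (0 < a <= N)%N -> 0 <= t <= T ->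
  gcoef a t = wave_coef T (fun a => ip u0 (eigfun a)) (fun a => ip v0 (eigfun a)) F a t.
Proof.
move=> aN tT; have a0 := proj1 (andP aN).
have k0 : 0 < a%:R * pi :> R by rewrite mulr_gt0 ?pi_gt0// ltr0n.
have mi : mI.-integrable setT (EFin \o mode a F).
  apply: (@integrable_fubini_Rintegral _ _ RR RR R mI mO (fun z => F z * eigfun a z.2)).
  apply: (integrableM_bnd (M := 2)); first exact: Fi.
    by apply: measurable_eigfun_comp; exact: measurable_snd_R.
  by move=> z; exact: norm_eigfun.
have dE s : 0 < s < T -> is_derive s 1 (gcoef a) (ip v0 (eigfun a)
    - (a%:R * pi) ^+ 2 * (\int[leb]_(s in `[0, s]) gcoef a s) + \int[mI]_r (upto s r * mode a F r)).
  exact: gcoef_derive.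
rewrite (wave_variation T0 k0 (gcoef_cont aN) mi dE tT).
rewrite /wave_coef duhamelE//.
congr (_ + _ + _).
- congr (_ * _); rewrite /gcoef clamp_id ?lexx ?(ltW T0)//.
  exact: (@ip_lincomb _ N _ (fun a => ip u0 (eigfun a)) a aN).
- by rewrite wave_phiE.
- by apply: eq_Rintegral => s _; rewrite wave_phiE.
Qed.

End Galerkin.

(** * Sine coefficients of the mild solution *)

Section AbsoluteSeries.
Context {R : realType}.
Implicit Types (f : nat -> R).

Lemma cvg_abs_sum1 f B : (forall n, \sum_(1 <= a < n) `|f a| <= B) ->
  cvgn (fun n => \sum_(1 <= a < n) f a) /\ `|limn (fun n => \sum_(1 <= a < n) f a)| <= B.
Proof.
move=> fB; pose g a := if a is _.+1 then f a else 0.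
have sE h : h 0%N = 0 -> series h = (fun n => \sum_(1 <= a < n) h a) :> (nat -> R).
  move=> h0; apply/funext => -[|n]; first by rewrite /series /= !big_geq.
  by rewrite /series /= big_ltn// h0 add0r.
have gE n : \sum_(1 <= a < n) g a = \sum_(1 <= a < n) f a.
  by rewrite big_nat [RHS]big_nat; apply: eq_bigr => -[].
have gNE n : \sum_(1 <= a < n) `|g a| = \sum_(1 <= a < n) `|f a|.
  by rewrite big_nat [RHS]big_nat; apply: eq_bigr => -[].
have cv : cvgn (fun n => \sum_(1 <= a < n) f a).
  rewrite (_ : (fun n => _) = series g); last first.
    by rewrite sE//; apply/funext => n; rewrite gE.
  apply: normed_cvg; apply: nondecreasing_is_cvgn.
    by apply: nondecreasing_series => n _ _; exact: normr_ge0.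
  exists B => _ [n _ <-]; change (series (fun a => `|g a|) n <= B).
  rewrite (sE (fun a => `|g a|)) ?normr0//.
  by rewrite gNE; exact: fB.
split => //; rewrite -lim_norm//; apply: limr_le; first exact: is_cvg_norm.
by near=> n; exact: le_trans (ler_norm_sum _ _ _) (fB n).
Unshelve. all: by end_near.
Qed.

(** The induction carries the sharper bound [2 - 1 / n]: as [pi >= 2], the term of index [x] is at
    most [1 / (2 x^2)], hence at most [1 / x - 1 / (x + 1)]. *)
Lemma sum_invr_eigval n : \sum_(1 <= a < n) (@eigval R a)^-1 <= 2.
Proof.
case: n => [|n]; first by rewrite big_geq.
suff : \sum_(1 <= a < n.+1) (@eigval R a)^-1 <= 2 - n.+1%:R^-1.
  by move=> /le_trans; apply; rewrite gerBl.
elim: n => [|n ih]; first by rewrite big_geq// invr1; lra.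
rewrite big_nat_recr//=; apply: (le_trans (lerD ih (lexx _))).
rewrite -(natr1 n.+1); set x := n.+1%:R : R; have x1 : 1 <= x by rewrite ler1n.
have x0 : 0 < x by rewrite (lt_le_trans ltr01).
have e0 : 2 * x ^+ 2 <= @eigval R n.+1.
  rewrite /eigval exprMn -/x mulrC ler_wpM2l ?sqr_ge0//.
  by have := @pi_ge2 R; rewrite expr2; nra.
have xx : 0 < 2 * x ^+ 2 by rewrite mulr_gt0// exprn_gt0.
apply: (@le_trans _ _ (2 - x^-1 + (2 * x ^+ 2)^-1)).
  by rewrite lerD2l lef_pV2// posrE (lt_le_trans xx).
rewrite -subr_ge0 (_ : _ - _ = (x - 1) / (2 * x ^+ 2 * (x + 1))).
  by rewrite divr_ge0 ?subr_ge0// mulr_ge0 ?(ltW xx)// addr_ge0// ltW.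
by field; rewrite !gt_eqF// addr_gt0.
Qed.

End AbsoluteSeries.

Section Mild.
Context {R : realType} (T L : R) (b : R -> R) (u0 v0 : R -> R).
Local Notation RR := (measurableTypeR R).
Local Notation leb := (@lebesgue_measure R).
Local Notation mI := (lebI T).
Local Notation mO := (@lebO R).
Local Notation mP := (mI \x mO)%E.
Hypothesis T0 : 0 < T.
Hypothesis u0H : Hdot 1 u0.
Hypothesis v0L : L2 v0.

Let al a := ip u0 (eigfun a).
Let be a := ip v0 (eigfun a).

Lemma hnorm_sum_lty : (\sum_(1 <= a <oo) (eigval a * al a ^+ 2)%:E < +oo)%E.
Proof.
case: u0H => _; rewrite /hnorm => /lty_poweRy; rewrite invr_eq0 pnatr_eq0 => /(_ isT).
by under eq_eseriesr do rewrite powRr1 ?eigval_ge0//.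
Qed.

(** With [l = eigval a], the inequality [|al a| <= l * al a ^+ 2 + 1 / l] follows from a completed
    square. Both terms on its right are summable for data in [Hdot 1]. *)
Lemma sum_norm_al : exists B, forall n, \sum_(1 <= a < n) `|al a| <= B.
Proof.
have S := hnorm_sum_lty; exists (fine (\sum_(1 <= a <oo) (eigval a * al a ^+ 2)%:E)%E + 2) => n.
apply: (@le_trans _ _ (\sum_(1 <= a < n) (eigval a * al a ^+ 2 + (eigval a)^-1))).
  rewrite big_nat [leRHS]big_nat; apply: ler_sum => a /andP[a1 _].
  have := @eigval_ge1 R a a1; set l := eigval a => l1; have l0 : 0 < l by rewrite (lt_le_trans ltr01).
  rewrite -[al a ^+ 2]real_normK ?num_real//; have := normr_ge0 (al a).
  set x := `|al a| => x0.
  rewrite -(ler_pM2r l0) mulrDl mulVf ?gt_eqF//.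
  have := sqr_ge0 (l * x - 1); have : 0 <= l * x by rewrite mulr_ge0// ltW.
  by rewrite !expr2; nra.
rewrite big_split/= lerD ?sum_invr_eigval//.
rewrite -lee_fin fineK; last first.
  by rewrite ge0_fin_numE// nneseries_ge0// => a _ _; rewrite lee_fin mulr_ge0 ?eigval_ge0 ?sqr_ge0.
apply: (@le_nneseries _ (fun a => eigval a * al a ^+ 2)).
by move=> a; rewrite mulr_ge0 ?eigval_ge0 ?sqr_ge0.
Qed.

Lemma wave_phi_derive1 a t : (0 < a)%N -> derive1 (@wave_phi R a) t = cos (a%:R * pi * t).
Proof.
move=> a0; have k0 : a%:R * pi != 0 :> R by rewrite mulf_neq0 ?gt_eqF ?pi_gt0 ?ltr0n.
rewrite derive1E (_ : wave_phi a = (fun t => (a%:R * pi)^-1 * sin (a%:R * pi * t))); last first.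
  by apply/funext => x; rewrite wave_phiE mulrC.
have := @is_derive_sin_lin R (a%:R * pi) 0 t; under eq_fun do rewrite addr0; rewrite addr0 => H.
have H2 : is_derive t 1 (fun t : R => (a%:R * pi)^-1 * sin (a%:R * pi * t)) (cos (a%:R * pi * t)).
  by apply: is_derive_eq; rewrite /GRing.scale/= mulKf.
exact: derive_val.
Qed.

Let v0' := v0 \_ dom.

Let mv0' : measurable_fun setT v0'.
Proof. by apply: measurable_patch; case: v0L. Qed.

Lemma L2_sqint_lty (v : R -> R) : L2 v -> (sqint mO (v \_ dom) < +oo)%E.
Proof.
by move=> [mv]; rewrite l2norm_lebO// => /lty_poweRy; rewrite invr_eq0 pnatr_eq0; apply.
Qed.

Let v0i : mO.-integrable setT (EFin \o v0').
Proof. by apply: sqint_integrable => //; exact: L2_sqint_lty. Qed.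

(** The partial sums are integrals of [green_sum] against [v0], dominated by [6 * |v0|]; dominated
    convergence gives the limit together with its identification as an integral of [wave_green]. *)
Lemma cvg_velocity t x :
  \sum_(1 <= a < n) (wave_phi a t * be a) * eigfun a x @[n --> \oo] -->
    \int[leb]_(y in dom) (wave_green t x y * v0 y) /\
  `|\int[leb]_(y in dom) (wave_green t x y * v0 y)| <= 6 * \int[mO]_y `|v0' y|.
Proof.
have IE : \int[leb]_(y in dom) (wave_green t x y * v0 y) = \int[mO]_y (wave_green t x y * v0' y).
  have := @ip_lebO R v0 (wave_green t x); rewrite /ip => H.
  rewrite -[RHS](_ : \int[mO]_y (v0' y * wave_green t x y) = _); last by apply: eq_Rintegral => y _; rewrite mulrC.
  rewrite -H; [by apply: eq_Rintegral => y _; rewrite mulrC|by case: v0L|exact: measurable_wave_green].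
have mg : measurable_fun setT (fun y : RR => wave_green t x y) by exact: measurable_wave_green.
have [||||gi H] := @Rintegral_dominated _ RR R mO (fun n y => green_sum n t x y * v0' y)
  (fun y => wave_green t x y * v0' y) (fun y => 6 * `|v0' y|).
- by move=> n; apply: measurable_funM => //; exact: measurable_green_sum.
- by move=> y; apply: cvgM; [exact: cvg_green_sum|exact: cvg_cst].
- by apply: integrableZR; exact: integrable_norm.
- by move=> n y; rewrite normrM ler_wpM2r// norm_green_sum.
rewrite IE; split; last first.
  rewrite -RintegralZl//; last exact: integrable_norm.
  apply: le_trans (le_normr_Rintegral _ gi) _ => //.
  apply: le_Rintegral => //; [exact: integrable_norm|by apply: integrableZR; exact: integrable_norm|].
  by move=> y _; rewrite normrM ler_wpM2r// norm_wave_green.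
apply: cvg_trans H; apply: near_eq_cvg; near=> n.
rewrite (_ : (fun x => _) = (fun y => \sum_(1 <= a < n) (wave_phi a t * eigfun a x) * (v0' y * eigfun a y))); last first.
  by apply/funext => y; rewrite /green_sum mulr_suml; apply: eq_bigr => a _; ring.
have vi a : mO.-integrable setT (EFin \o (fun y => v0' y * eigfun a y)).
  apply: (integrableM_bnd (M := 2)) => //; [exact: measurable_eigfun|exact: norm_eigfun].
rewrite Rintegral_sumr; last by move=> a _; exact: integrableZR.
apply: eq_bigr => a _; rewrite RintegralZl// /be ip_lebO; [|by case: v0L|exact: measurable_eigfun].
by rewrite mulrAC.
Unshelve. all: by end_near.
Qed.

(** The time derivative of the Green function is not a bounded kernel, so this series is summed
    absolutely by means of [sum_norm_al]; the factor 2 bounds the eigenfunctions. *)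
Lemma cvg_position t x B : (forall n, \sum_(1 <= a < n) `|al a| <= B) ->
  \sum_(1 <= a < n) (cos (a%:R * pi * t) * al a) * eigfun a x @[n --> \oo] --> wave_dgreen t u0 x /\
  `|wave_dgreen t u0 x| <= 2 * B.
Proof.
move=> alB.
have E : (fun n => \sum_(1 <= a < n) (derive1 (wave_phi a) t * ip u0 (eigfun a) * eigfun a x)) =
    (fun n => \sum_(1 <= a < n) (cos (a%:R * pi * t) * al a) * eigfun a x).
  by apply/funext => n; rewrite big_nat [RHS]big_nat; apply: eq_bigr => a /andP[a0 _]; rewrite wave_phi_derive1.
rewrite /wave_dgreen E.
have [] := @cvg_abs_sum1 R (fun a => (cos (a%:R * pi * t) * al a) * eigfun a x) (2 * B).
  move=> n; apply: le_trans (ler_wpM2l (ler0n _ 2) (alB n)); rewrite mulr_sumr; apply: ler_sum => a _.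
  have := norm_eigfun a x; move: (eigfun a x) => e e2.
  rewrite !normrM [leRHS]mulrC; apply: ler_pM; rewrite ?mulr_ge0//.
  by rewrite ler_piMl// ler_norml cos_geN1 cos_le1.
by [].
Qed.

Section Solution.
Variables (u : R -> R -> R) (xi : RR * RR -> R).

(** The values of [u] outside [[0, T]] and [dom] are arbitrary; replacing them by 0 makes [u] a
    measurable function on the plane. *)
Definition zext (z : RR * RR) : R := if (0 <= z.1 <= T) && (z.2 \in dom) then u z.1 z.2 else 0.

Let F z := b (zext z) + xi z.

Hypothesis Fi : mP.-integrable setT (EFin \o F).

Lemma mild_forcing t x : 0 <= t <= T ->
  \int[leb]_(s in `[0, t]) \int[leb]_(y in dom) (wave_green (t - s) x y * (b (u s y) + xi (s, y)))
  = green_duhamel T F t x.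
Proof.
move=> /andP[t0 tT]; rewrite green_duhamelE//.
have mF := measurable_integrableR Fi.
have mG : measurable_fun setT (fun s : RR => \int[mO]_y (wave_green (t - s) x y * F (s, y))).
  apply: (@measurable_fun_Rintegral _ _ RR RR R mO (fun z => wave_green (t - z.1) x z.2 * F z)).
  apply: measurable_funM => //; apply: measurable_wave_green => //.
  by apply: measurable_funB => //; exact: measurable_fst_R.
transitivity (\int[leb]_(s in `[0, t]) \int[mO]_y (wave_green (t - s) x y * F (s, y))); last first.
  by apply: Rintegral_upto; [rewrite t0|exact: mG].
apply: eq_Rintegral => s; rewrite inE/= in_itv/= => /andP[s0 st].
rewrite -Rintegral_lebO; last first.
  by apply: measurable_funM; [exact: measurable_wave_green|exact: measurable_fun_pair2].
by apply: eq_Rintegral => y yd; rewrite /F /zext /= yd s0 (le_trans st).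
Qed.

Definition mild_rhs t x : R := \int[leb]_(y in dom) (wave_green t x y * v0 y) + wave_dgreen t u0 x
  + \int[leb]_(s in `[0, t]) \int[leb]_(y in dom) (wave_green (t - s) x y * (b (u s y) + xi (s, y))).

Lemma cvg_mild t x : 0 <= t <= T ->
  \sum_(1 <= a < n) wave_coef T al be F a t * eigfun a x @[n --> \oo] --> mild_rhs t x.
Proof.
move=> tT; have [B alB] := sum_norm_al.
have [c1 _] := cvg_velocity t x; have [c2 _] := cvg_position t x alB.
have c3 := @cvg_green_duhamel R T F t x Fi.
rewrite /mild_rhs mild_forcing//.
rewrite (_ : (fun n => _) = (fun n => \sum_(1 <= a < n) (wave_phi a t * be a) * eigfun a x +
    \sum_(1 <= a < n) (cos (a%:R * pi * t) * al a) * eigfun a x +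
    \sum_(1 <= a < n) duhamel T a F t * eigfun a x)); last first.
  apply/funext => n; rewrite -!big_split/=; apply: eq_bigr => a _.
  by rewrite /wave_coef /al /be; ring.
exact: cvgD (cvgD c1 c2) c3.
Qed.

(** Upgrades the integrability contained in [mild_solution] to boundedness, and thus provides the
    finite integral of squares that Gronwall requires. *)
Lemma mild_bnd : exists K, forall t x, 0 <= t <= T -> `|mild_rhs t x| <= K.
Proof.
have [B alB] := sum_norm_al.
exists (6 * \int[mO]_y `|v0' y| + 2 * B + 6 * \int[mP]_z `|F z|) => t x tT.
have [_ b1] := cvg_velocity t x; have [_ b2] := cvg_position t x alB.
rewrite /mild_rhs mild_forcing//.
by rewrite (le_trans (ler_normD _ _))// lerD ?norm_green_duhamel// (le_trans (ler_normD _ _))// lerD.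
Qed.

End Solution.

End Mild.

(** * The error estimate along one path *)

Section Pathwise.
Context {R : realType} (T L : R) (b : R -> R) (N : nat) (u0 v0 : R -> R) (u U : R -> R -> R).
Local Notation RR := (measurableTypeR R).
Local Notation leb := (@lebesgue_measure R).
Local Notation mI := (lebI T).
Local Notation mO := (@lebO R).
Local Notation mP := (mI \x mO)%E.
Variable xi : RR * RR -> R.
Hypothesis T0 : 0 < T.
Hypothesis N0 : (0 < N)%N.
Hypothesis L0 : 0 <= L.
Hypothesis bL : forall x y, `|b x - b y| <= L * `|x - y|.
Hypothesis xii : mP.-integrable setT (EFin \o xi).
Hypothesis u0H : Hdot 1 u0.
Hypothesis v0L : L2 v0.
Hypothesis VU : forall t, 0 <= t <= T -> VN N (U t) /\ l2_continuous_at `[0, T] U t.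
Hypothesis U0 : forall x, dom x -> U 0 x = projN N u0 x.
Hypothesis DU : forall t, 0 < t <= T -> exists duN : R -> R,
  [/\ VN N duN, l2_derive_at `[0, T] U t duN
    & forall v, VN N v -> ip duN v = ip (projN N v0) v
        + \int[leb]_(s in `[0, t]) ip (U s) (derive1n 2 v)
        + \int[leb]_(s in `[0, t]) ip (fun x => b (U s x) + xi (s, x)) v].

Local Notation al := (fun a => ip u0 (eigfun a)).
Local Notation be := (fun a => ip v0 (eigfun a)).
Local Notation ue := (zext T u).

Definition mild_coef a t : R := wave_coef T al be (fun z => b (ue z) + xi z) a t.

Hypothesis mu : measurable_fun setT ue.
Hypothesis ui : mP.-integrable setT (EFin \o ue).
Hypothesis u_series : {ae mI, forall s, {ae mO, forall y,
  \sum_(1 <= a < n) mild_coef a s * eigfun a y @[n --> \oo] --> ue (s, y)}}.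

Let Fi : mP.-integrable setT (EFin \o (fun z => b (ue z) + xi z)).
Proof.
have bi : mP.-integrable setT (EFin \o (fun z => b (ue z))) by exact: (integrable_bcomp L0 bL ui).
exact: (integrableDR bi xii).
Qed.

Lemma pathwise_sqint t : 0 <= t <= T ->
  {ae mO, forall y, \sum_(1 <= a < n) mild_coef a t * eigfun a y @[n --> \oo] --> ue (t, y)} ->
  (sqint mO (fun y => (ue (t, y) - gfield T N U (t, y))%R) <=
   (errC T b L * N%:R ^- 2)%:E * (1 + data_energy al be + energy T xi t + \int[mI]_s energy T xi s))%E.
Proof.
move=> tT cut.
have [K uK] := mild_bnd u0H v0L Fi; have [KN UK] := gfield_bnd T0 VU.
(* For almost all [s] and [y] the same series converges to [ue (s, y)] and to [mild_rhs]; uniqueness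
   of limits transfers the bound of the latter. *)
have uK' : {ae mI, forall s, {ae mO, forall y, `|ue (s, y)| <= K}}.
  have /= sT := @lebI_ae R T.
  have both : {ae mI, forall s, 0 <= s <= T /\ {ae mO, forall y,
      \sum_(1 <= a < n) mild_coef a s * eigfun a y @[n --> \oo] --> ue (s, y)}}.
    exact: filterI sT u_series.
  apply: (@ae_imp _ RR R mI _ _ _ both) => s [s0T cs].
  apply: (@ae_imp _ RR R mO _ _ _ cs) => y cy.
  rewrite -(cvg_lim (@norm_hausdorff _ R) cy).
  by rewrite (cvg_lim (@norm_hausdorff _ R) (cvg_mild u0H v0L Fi s0T)); exact: uK.
have mt : measurable_fun setT (fun y : RR => ue (t, y)) by exact: measurable_fun_pair2.
have gE s y : 0 <= s <= T -> gfield T N U (s, y) =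
    \sum_(1 <= a < N.+1) wave_coef T al be (fun z => b (gfield T N U z) + xi z) a s * eigfun a y.
  move=> sT; rewrite /gfield big_nat [RHS]big_nat; apply: eq_bigr => a aN; congr (_ * _).
  exact: (gcoef_wave T0 L0 bL xii VU U0 DU aN sT).
have UN : {ae mI, forall s, {ae mO, forall y, gfield T N U (s, y) =
    \sum_(1 <= a < N.+1) wave_coef T al be (fun z => b (gfield T N U z) + xi z) a s * eigfun a y}}.
  apply: (@ae_imp _ RR R mI _ _ _ (@lebI_ae R T)) => s sT.
  by apply: (@ae_imp _ RR R mO _ _ _ (@lebO_ae R)) => y _; exact: gE.
have := @error_bound R T T0 b L L0 bL al be ue (gfield T N U) xi N K KN N0 mu
  (measurable_gfield T0 VU) ui (gfield_integrable T0 VU) xii uK' (fun s y => UK (s, y)) u_series UN t _ mt cut.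
congr (_ <= _)%E; congr sqint; apply/funext => y.
by rewrite gE.
Qed.

Lemma l2norm_error t : 0 <= t <= T ->
  l2norm (fun x => (u t x - U t x)%R) = (sqint mO (fun y => (ue (t, y) - gfield T N U (t, y))%R) `^ 2^-1)%E.
Proof.
move=> tT; have E x : dom x -> u t x - U t x = ue (t, x) - gfield T N U (t, x).
  by move=> dx; rewrite -(gfieldE VU tT dx) /zext /= tT mem_set.
have mt : measurable_fun setT (fun y : RR => ue (t, y) - gfield T N U (t, y)).
  by apply: measurable_funB; apply: measurable_fun_pair2 => //; exact: measurable_gfield.
exact: l2norm_sqint mt E.
Qed.

End Pathwise.

(** * The Lipschitz constant and coefficient functionals *)

Section Preliminaries.
Context {R : realType}.
Local Notation mO := (@lebO R).

Lemma lipschitz_const (b : R -> R) : lipschitz b ->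
  exists2 L, 0 <= L & forall x y, `|b x - b y| <= L * `|x - y|.
Proof.
(* [lipschitz] grants the estimate for all constants beyond some [M]; the maximum with 0 makes the
   constant nonnegative, and [+ 1] puts it strictly beyond [M]. *)
move=> [M [_ bM]]; exists (Num.max M 0 + 1); first by rewrite addr_ge0// le_max lexx orbT.
move=> x y; apply: (bM (Num.max M 0 + 1) _ (x, y)); last by [].
by rewrite (@le_lt_trans _ _ (Num.max M 0)) ?ltrDl// le_max lexx.
Qed.

(* No measurability is needed: the integral of a nonnegative function is a supremum
   over the simple functions below it. *)
Lemma le_ge0_integralT d (X : measurableType d) (mu : {measure set X -> \bar R}) (f g : X -> \bar R) :
  (forall x, 0 <= f x)%E -> (forall x, f x <= g x)%E -> (\int[mu]_x f x <= \int[mu]_x g x)%E.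
Proof.
move=> f0 fg; rewrite !ge0_integralTE//; last by move=> x; exact: le_trans (fg x).
apply: ereal_sup_le => _ [h hf <-]; exists h => // x; exact: le_trans (fg x).
Qed.

Lemma L2_integrable (v : R -> R) : L2 v -> mO.-integrable setT (EFin \o (v \_ dom)).
Proof.
move=> vL; apply: sqint_integrable; last exact: L2_sqint_lty.
by apply: measurable_patch; case: vL.
Qed.

Lemma ip_eigfunB (v w : R -> R) a : L2 v -> L2 w ->
  ip (fun x => w x - v x) (eigfun a) = ip w (eigfun a) - ip v (eigfun a).
Proof.
move=> vL wL; have [mv _] := vL; have [mw _] := wL.
have vi := L2_integrable vL; have wi := L2_integrable wL.
have ei f : mO.-integrable setT (EFin \o f) -> mO.-integrable setT (EFin \o (fun x => f x * eigfun a x)).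
  by move=> fi; apply: (integrableM_bnd (M := 2)) => //; [exact: measurable_eigfun|exact: norm_eigfun].
rewrite !ip_lebO//; try exact: measurable_eigfun; last exact: measurable_funB.
rewrite -RintegralB//; try exact: ei.
apply: eq_Rintegral => x _; rewrite !patchE; case: ifP => _; first by rewrite mulrBl.
by rewrite /point/= !mul0r subrr.
Qed.

Lemma hnorm_term_ge0 (v : R -> R) a : 0 <= eigval a * ip v (eigfun a) ^+ 2.
Proof. by rewrite mulr_ge0 ?eigval_ge0 ?sqr_ge0. Qed.

Lemma hnorm1E (v : R -> R) :
  hnorm 1 v = ((\sum_(1 <= a <oo) (eigval a * ip v (eigfun a) ^+ 2)%:E) `^ 2^-1)%E.
Proof. by rewrite /hnorm; under eq_eseriesr do rewrite powRr1 ?eigval_ge0//. Qed.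

Lemma ip_eigfun_hnorm (v : R -> R) a : (0 < a)%N -> (`|ip v (eigfun a)|%:E <= hnorm 1 v)%E.
Proof.
move=> a0; rewrite hnorm1E -sqrtr_sqr -powR12_sqrt ?sqr_ge0// -poweR_EFin.
apply: lee_poweR; rewrite ?invr_ge0 ?lee_fin ?sqr_ge0//.
apply: le_trans (le_nneseries 1 a.+1 (hnorm_term_ge0 v)).
rewrite lee_fin big_nat_recr//= -[leLHS]add0r lerD ?sumr_ge0// => [? _|].
  exact: hnorm_term_ge0.
by rewrite ler_peMl ?sqr_ge0// eigval_ge1.
Qed.

End Preliminaries.

(** * Measurability and moments of the random data *)

Section RandomData.
Context {d : measure_display} {Omega : measurableType d} {R : realType}.
Variables (P : probability Omega R) (T p : R).
Hypothesis T0 : 0 < T.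
Local Notation RR := (measurableTypeR R).
Local Notation leb := (@lebesgue_measure R).
Local Notation mI := (lebI T).
Local Notation mO := (@lebO R).
Local Notation mP := (mI \x mO)%E.
Implicit Types (X : Omega -> R -> R).

(** A coefficient is 1-Lipschitz for the norm, so [[set v | c < ip v (eigfun a)]] is open relative
    to [S] and has a measurable preimage by [LpOmega]. *)
Lemma measurable_coef (S : set (R -> R)) nrm X a :
  S `<=` L2 -> (forall v w, S v -> S w ->
    `|ip (fun x => w x - v x) (eigfun a)|%:E <= nrm (fun x => (w x - v x)%R))%E ->
  LpOmega P p S nrm X -> measurable_fun setT (fun w => ip (X w) (eigfun a)).
Proof.
move=> SL nl [XS XU _] mD; apply: (measurability _ (RGenOInfty.measurableE R)) => //.
move=> /= _ [_ [c ->] <-]; rewrite setTI preimage_itvoy.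
apply: (XU [set v | c < ip v (eigfun a)]) => v Sv /= cv.
exists (ip v (eigfun a) - c); first by rewrite subr_gt0.
move=> w Sw wv; have := le_lt_trans (nl _ _ Sv Sw) wv.
rewrite lte_fin ip_eigfunB; [|exact: SL|exact: SL].
by rewrite /= ltr_norml => /andP[]; lra.
Qed.

Lemma LpOmega_moment S nrm X : 0 < p -> (forall v, 0 <= nrm v)%E -> LpOmega P p S nrm X ->
  (\int[P]_w (nrm (X w) `^ p) < +oo)%E.
Proof.
move=> p0 n0 [_ _]; rewrite unlock /= => /lty_poweRy; rewrite invr_eq0 gt_eqF// => /(_ isT).
by under eq_integral do rewrite gee0_abs//.
Qed.

Lemma measurable_zext (u : Omega -> R -> R -> R) : measurable_field T u ->
  measurable_fun setT (fun z : Omega * (RR * RR) => zext T (u z.1) z.2).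
Proof.
move=> mu; pose D : set (Omega * (RR * RR)) := [set: Omega] `*` (`[0, T] `*` dom).
have mD : measurable D.
  by apply: measurableX => //; apply: measurableX => //; exact: measurable_dom.
have := (measurable_restrictT (fun z : Omega * (RR * RR) => u z.1 z.2.1 z.2.2) mD).1 mu.
congr (measurable_fun _ _); apply/funext => -[w [s y]]; rewrite patchE /zext /=.
rewrite /D !in_setX in_setT /= [s \in _](_ : _ = (0 <= s <= T)); first by case: ifP.
by apply/idP/idP; rewrite inE /= in_itv.
Qed.

Lemma measurable_zext_path (u : Omega -> R -> R -> R) w : measurable_field T u ->
  measurable_fun setT (zext T (u w)).
Proof.
move=> /measurable_zext mu.
exact: (@measurable_fun_pair2 _ _ _ Omega (RR * RR)%type R (fun z => zext T (u z.1) z.2) w mu).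
Qed.

Lemma le_integral_frestr dX (X : measurableType dX) (mu : {measure set X -> \bar R}) D
    (mD : measurable D) (fD : (mu D < +oo)%E) (f : X -> \bar R) :
  measurable_fun setT f -> (forall x, 0 <= f x)%E ->
  (\int[frestr mD fD]_x f x <= \int[mu]_x f x)%E.
Proof.
move=> mf f0; rewrite -integral_frestr//.
by apply: ge0_subset_integral.
Qed.

Lemma integrable_zext (u : Omega -> R -> R -> R) w : measurable_field T u ->
  (lebesgue_measure \x lebesgue_measure)%E.-integrable (`[0, T] `*` dom)
    (fun z : R * R => (u w z.1 z.2)%:E) ->
  mP.-integrable setT (EFin \o zext T (u w)).
Proof.
move=> mu /integrableP[_ ui]; have mz := measurable_zext_path w mu.
have mn : measurable_fun setT (fun z : RR * RR => `|(zext T (u w) z)%:E|)%E.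
  by apply: measurableT_comp => //; exact/measurable_EFinP.
apply/integrable12ltyP; first exact/measurable_EFinP.
have zE (z : RR * RR) : `|(zext T (u w) z)%:E|%E =
    ((fun z : R * R => `|(u w z.1 z.2)%:E|%E) \_ (`[0, T] `*` dom)) z.
  rewrite patchE in_setX /zext /= [z.1 \in _](_ : _ = (0 <= z.1 <= T)); first by case: ifP => //; rewrite normr0.
  by apply/idP/idP; rewrite inE /= in_itv.
apply: le_lt_trans ui; rewrite [leRHS]integral_mkcond.
under [leRHS]eq_integral do rewrite -zE.
rewrite (@fubini_tonelli1 _ _ RR RR R leb leb (fun z => `|(zext T (u w) z)%:E|%E) mn)//.
have ms s : measurable_fun setT (fun y : RR => `|(zext T (u w) (s, y))%:E|)%E.
  by apply: measurableT_comp => //; apply/measurable_EFinP; exact: measurable_fun_pair2.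
have mFl : measurable_fun setT (fun s : RR => \int[leb]_y `|(zext T (u w) (s, y))%:E|)%E.
  exact: (@measurable_fun_fubini_tonelli_F _ _ RR RR R leb (fun z => `|(zext T (u w) z)%:E|%E)).
have mFo : measurable_fun setT (fun s : RR => \int[mO]_y `|(zext T (u w) (s, y))%:E|)%E.
  exact: (@measurable_fun_fubini_tonelli_F _ _ RR RR R mO (fun z => `|(zext T (u w) z)%:E|%E)).
apply: (@le_trans _ _ (\int[mI]_s \int[leb]_y `|(zext T (u w) (s, y))%:E|)%E).
  apply: ge0_le_integral => //.
  - by move=> s _; exact: integral_ge0.
  - by move=> s _; apply: (@le_integral_frestr _ RR leb dom measurable_dom _ _ (ms s)) => y; exact: abse_ge0.
apply: le_integral_frestr => //.
by move=> s; exact: integral_ge0.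
Qed.

End RandomData.

(** * Exchange of null sets: the sine series along almost every path *)

Section ConvergenceSet.
Context {R : realType}.

Lemma cvg_limn_esupP (x : nat -> R) (l : R) :
  (limn_esup (fun n => `|x n - l|%:E) = 0)%E <-> (x n @[n --> \oo] --> l).
Proof.
split=> [x0|xl].
  have [_ c0] : limn_esup (fun n => `|x n - l|%:E) = 0%E /\ (fun n => `|x n - l|%:E) @ \oo --> 0%E.
    by split => //; apply: limn_esup_le_cvg; [rewrite x0|move=> n; rewrite lee_fin].
  apply/cvgrPdist_lt => e e0.
  have e0' : nbhs (0%E : \bar R) [set y | y < e%:E]%E.
    by apply: open_nbhs_nbhs; split; [exact: open_ereal_lt_ereal|rewrite /= lte_fin].
  have H : \forall n \near \oo, (`|x n - l|%:E < e%:E)%E := c0 _ e0'.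
  by near=> n; rewrite distrC -lte_fin; near: n; exact: H.
have c0 : (fun n => `|x n - l|%:E) @ \oo --> 0%E.
  apply: cvg_EFin; first exact: nearW.
  apply/cvgrPdist_lt => e e0; move: xl => /cvgrPdist_lt /(_ _ e0); apply: filterS => n.
  by rewrite /= sub0r normrN normr_id distrC.
rewrite is_cvg_limn_esupE; first exact: cvg_lim c0.
by apply/cvg_ex; exists 0%E.
Unshelve. all: by end_near.
Qed.

End ConvergenceSet.

Lemma ae_and d (X : measurableType d) (R : realType) (mu : {measure set X -> \bar R}) (P Q : X -> Prop) :
  {ae mu, forall x, P x} -> {ae mu, forall x, Q x} -> {ae mu, forall x, P x /\ Q x}.
Proof. exact: filterI. Qed.

Section MildSeries.
Context {d : measure_display} {Omega : measurableType d} {R : realType}.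
Variables (P : probability Omega R) (T p L : R) (b : R -> R) (u0 v0 : Omega -> R -> R).
Local Notation RR := (measurableTypeR R).
Local Notation mI := (lebI T).
Local Notation mO := (@lebO R).
Local Notation mP := (mI \x mO)%E.
Hypothesis T0 : 0 < T.
Hypothesis L0 : 0 <= L.
Hypothesis bL : forall x y, `|b x - b y| <= L * `|x - y|.
Hypothesis u0_Lp : LpOmega P p (Hdot 1) (hnorm 1) u0.
Hypothesis v0_Lp : LpOmega P p L2 l2norm v0.

Let u0H w : Hdot 1 (u0 w). Proof. by case: u0_Lp. Qed.
Let v0L w : L2 (v0 w). Proof. by case: v0_Lp. Qed.

Lemma measurable_coef_u0 a : (0 < a)%N -> measurable_fun setT (fun w => ip (u0 w) (eigfun a)).
Proof.
move=> a0; apply: (measurable_coef _ _ u0_Lp) => [v []//|v w _ _].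
exact: ip_eigfun_hnorm.
Qed.

Lemma measurable_coef_v0 a : (0 < a)%N -> measurable_fun setT (fun w => ip (v0 w) (eigfun a)).
Proof.
move=> a0; apply: (measurable_coef _ _ v0_Lp) => // v w [mv _] [mw _].
by apply: ip_eigfun_le => //; exact: measurable_funB.
Qed.

Variables (u : Omega -> R -> R -> R) (xi : Omega -> RR * RR -> R).
Hypothesis xi_joint : measurable_fun setT (fun z : Omega * (RR * RR) => xi z.1 z.2).
Hypothesis xii : forall w, mP.-integrable setT (EFin \o xi w).
Hypothesis u_mild : mild_solution P T b u0 v0 (fun w s y => xi w (s, y)) u.

Let F w z := b (zext T (u w) z) + xi w z.

(* Unlike [mild_coef], which integrates over the product, this iterated form is
   measurable in [w] without integrability of the forcing. *)
Definition iter_coef a w t : R := cos (a%:R * pi * t) * ip (u0 w) (eigfun a)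
  + wave_phi a t * ip (v0 w) (eigfun a)
  + \int[mI]_s (upto t s * wave_phi a (t - s) * mode a (F w) s).

Lemma iter_coefE a w t : mP.-integrable setT (EFin \o F w) ->
  iter_coef a w t = mild_coef T b (u0 w) (v0 w) (u w) (xi w) a t.
Proof. by move=> Fi; rewrite /mild_coef /wave_coef duhamelE. Qed.

Let m1 : measurable_fun setT (fst : Omega * RR -> Omega). Proof. exact: measurable_fst. Qed.
Let m2 : measurable_fun setT (snd : Omega * RR -> R). Proof. exact: measurable_snd. Qed.

Let measurable_F : measurable_fun setT (fun z : Omega * (RR * RR) => F z.1 z.2).
Proof.
apply: measurable_funD => //; apply: (measurableT_comp (measurable_b L0 bL)).
by apply: measurable_zext; case: u_mild.
Qed.

Lemma measurable_iter_mode a : measurable_fun setT (fun z : Omega * RR => mode a (F z.1) z.2).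
Proof.
apply: (@measurable_fun_Rintegral _ _ (Omega * RR)%type RR R mO
  (fun z => F z.1.1 (z.1.2, z.2) * eigfun a z.2)).
apply: measurable_funM; last by apply: measurable_eigfun_comp; exact: measurable_snd.
have mf : measurable_fun setT (fst : (Omega * RR) * RR -> Omega * RR) by exact: measurable_fst.
have ms : measurable_fun setT (snd : (Omega * RR) * RR -> RR) by exact: measurable_snd.
apply: (measurableT_comp measurable_F (g := fun z : (Omega * RR) * RR => (z.1.1, (z.1.2, z.2)))).
apply: measurable_fun_pair; first exact: (measurableT_comp measurable_fst mf).
by apply: measurable_fun_pair => //; exact: (measurableT_comp measurable_snd mf).
Qed.

Lemma measurable_iter_coef a : (0 < a)%N -> measurable_fun setT (fun z : Omega * RR => iter_coef a z.1 z.2).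
Proof.
move=> a0; apply: measurable_funD; first apply: measurable_funD.
- apply: measurable_funM; last exact: (measurableT_comp (measurable_coef_u0 a0)).
  apply: (measurableT_comp (f := fun t : R => cos (a%:R * pi * t))) => //.
  apply: continuous_measurable; have := @continuous_cos_lin R (a%:R * pi) 0.
  by under eq_fun do rewrite addr0.
- apply: measurable_funM; last exact: (measurableT_comp (measurable_coef_v0 a0)).
  exact: measurable_wave_phi.
apply: (@measurable_fun_Rintegral _ _ (Omega * RR)%type RR R mI
  (fun z => upto z.1.2 z.2 * wave_phi a (z.1.2 - z.2) * mode a (F z.1.1) z.2)).
have mf : measurable_fun setT (fst : (Omega * RR) * RR -> Omega * RR) by exact: measurable_fst.
have ms : measurable_fun setT (snd : (Omega * RR) * RR -> R) by exact: measurable_snd.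
have m12 : measurable_fun setT (fun z : (Omega * RR) * RR => z.1.2 : R).
  exact: (measurableT_comp m2 mf).
apply: measurable_funM.
  by apply: measurable_funM; [exact: measurable_upto|apply: measurable_wave_phi; exact: measurable_funB].
apply: (measurableT_comp (measurable_iter_mode a) (g := fun z : (Omega * RR) * RR => (z.1.1, z.2))).
by apply: measurable_fun_pair => //; exact: (measurableT_comp m1 mf).
Qed.

(* A limes superior, because it is measurable in all variables and detects the
   convergence of the series to [u] by its vanishing. *)
Definition series_gap (z : (Omega * RR) * RR) : \bar R :=
  limn_esup (fun n => `|\sum_(1 <= a < n) (if (0 < a)%N then iter_coef a z.1.1 z.1.2 else 0) * eigfun a z.2
    - zext T (u z.1.1) (z.1.2, z.2)|%:E).

Lemma measurable_series_gap : measurable_fun setT series_gap.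
Proof.
have mf : measurable_fun setT (fst : (Omega * RR) * RR -> Omega * RR) by exact: measurable_fst.
have ms : measurable_fun setT (snd : (Omega * RR) * RR -> R) by exact: measurable_snd.
apply: (@measurable_fun_limn_esup _ _ R setT (fun n (z : (Omega * RR) * RR) =>
  `|\sum_(1 <= a < n) (if (0 < a)%N then iter_coef a z.1.1 z.1.2 else 0) * eigfun a z.2
    - zext T (u z.1.1) (z.1.2, z.2)|%:E)) => n.
apply/measurable_EFinP; apply: (measurableT_comp (@normr_measurable R setT)).
apply: measurable_funB; last first.
  have mz : measurable_fun setT (fun z : Omega * (RR * RR) => zext T (u z.1) z.2).
    by apply: measurable_zext; case: u_mild.
  apply: (measurableT_comp mz (g := fun z : (Omega * RR) * RR => (z.1.1, (z.1.2, z.2)))).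
  apply: measurable_fun_pair; first exact: (measurableT_comp measurable_fst mf).
  by apply: measurable_fun_pair => //; exact: (measurableT_comp measurable_snd mf).
apply: measurable_sum => a; apply: measurable_funM; last exact: measurable_eigfun_comp.
case: (boolP (0 < a)%N) => a0 //.
exact: (measurableT_comp (measurable_iter_coef a0) mf).
Qed.

Lemma series_gap0 w t y : series_gap ((w, t), y) = 0%E <->
  \sum_(1 <= a < n) iter_coef a w t * eigfun a y @[n --> \oo] --> zext T (u w) (t, y).
Proof.
rewrite -cvg_limn_esupP /series_gap /=.
rewrite (_ : (fun n => _) = (fun n => `|\sum_(1 <= a < n) iter_coef a w t * eigfun a y - zext T (u w) (t, y)|%:E)) //.
apply/funext => n; congr (`|_ - _|%:E); rewrite big_nat [RHS]big_nat.
by apply: eq_bigr => a /andP[-> _].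
Qed.

(** The triples at which the series fails to converge to [u]. Its measurability in all variables at
    once is what allows null sections to be exchanged. *)
Definition bad_set : set ((Omega * RR) * RR) :=
  [set z | [/\ 0 <= z.1.2 <= T, dom z.2 & series_gap z != 0%E]].

Lemma measurable_bad_set : measurable bad_set.
Proof.
have mf : measurable_fun setT (fst : (Omega * RR) * RR -> Omega * RR) by exact: measurable_fst.
have ms : measurable_fun setT (snd : (Omega * RR) * RR -> R) by exact: measurable_snd.
have m12 : measurable_fun setT (fun z : (Omega * RR) * RR => z.1.2 : R).
  exact: (measurableT_comp m2 mf).
rewrite (_ : bad_set = ((fun z => z.1.2) @^-1` `[0, T]) `&` (snd @^-1` dom) `&`
    (series_gap @^-1` (~` [set 0%E]))); last first.
  apply/seteqP; split => [z [z1 z2 /eqP z3]|z [[/=]]].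
    by split => //; split => //=; rewrite in_itv.
  by rewrite in_itv/= => z1 z2 /eqP z3; split.
rewrite -[X in measurable X]setTI; apply: measurableI => //; apply: measurableI; first apply: measurableI.
- by rewrite -[X in measurable X]setTI; apply: m12 => //; exact: measurable_itv.
- by rewrite -[X in measurable X]setTI; apply: ms => //; exact: measurable_dom.
- rewrite -[X in measurable X]setTI; apply: measurable_series_gap => //.
  by apply: measurableC; exact: emeasurable_set1.
Qed.

Lemma F_integrable : {ae P, forall w, mP.-integrable setT (EFin \o zext T (u w)) /\
   mP.-integrable setT (EFin \o F w)}.
Proof.
case: u_mild => mu ui _; move: ui; apply: filterS => w uw.
have zi : mP.-integrable setT (EFin \o zext T (u w)) by exact: integrable_zext.
split => //.
have bi : mP.-integrable setT (EFin \o (fun z => b (zext T (u w) z))) by exact: (integrable_bcomp L0 bL zi).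
exact: (integrableDR bi (xii w)).
Qed.

Lemma measurable_bad_section t y : measurable [set w | bad_set ((w, t), y)].
Proof.
have mw : measurable_fun setT (fun w : Omega => ((w, t), y) : (Omega * RR) * RR).
  by apply: measurable_fun_pair => //; apply: measurable_fun_pair.
by have := mw measurableT _ measurable_bad_set; rewrite setTI.
Qed.

(** At a fixed point the mild equation holds for almost every path, and for almost every path the
    forcing is integrable; [cvg_mild] then gives convergence to the right-hand side of that
    equation. *)
Lemma bad_section t y : P [set w | bad_set ((w, t), y)] = 0%E.
Proof.
have ms := measurable_bad_section t y.
have [[tT yd]|ty] := pselect (0 <= t <= T /\ dom y); last first.
  rewrite (_ : [set w | _] = set0) ?measure0//.
  by apply/seteqP; split => // w [] /= tT yd; exfalso; apply: ty.
apply/negligibleP => //.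
suff : {ae P, forall w, ~ bad_set ((w, t), y)}.
  by move=> [A [mA A0 AB]]; exists A; split => // w wb; apply: AB => /(_ wb).
case: u_mild => _ _ /(_ t y tT yd) uE.
have both : {ae P, forall w, (mP.-integrable setT (EFin \o zext T (u w)) /\
    mP.-integrable setT (EFin \o F w)) /\ u w t y = mild_rhs b (u0 w) (v0 w) (u w) (xi w) t y}.
  exact: filterI F_integrable uE.
apply: (@ae_imp _ Omega R P _ _ _ both) => w [[_ Fi] uw] [_ _ /eqP]; apply.
apply/series_gap0; rewrite /zext /= tT mem_set//= uw.
have E : (fun n => \sum_(1 <= a < n) iter_coef a w t * eigfun a y) =
    (fun n => \sum_(1 <= a < n) mild_coef T b (u0 w) (v0 w) (u w) (xi w) a t * eigfun a y).
  by apply/funext => n; apply: eq_bigr => a _; rewrite iter_coefE.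
rewrite E; exact: (@cvg_mild R T b (u0 w) (v0 w) (u0H w) (v0L w) (u w) (xi w) Fi t y tT).
Qed.

Lemma mild_series_at t : 0 <= t <= T -> {ae P, forall w, {ae mO, forall y,
  \sum_(1 <= a < n) mild_coef T b (u0 w) (v0 w) (u w) (xi w) a t * eigfun a y @[n --> \oo]
    --> zext T (u w) (t, y)}}.
Proof.
move=> tT; pose A : set (Omega * RR) := [set z | bad_set ((z.1, t), z.2)].
have mA : measurable A.
  have mz : measurable_fun setT (fun z : Omega * RR => ((z.1, t), z.2) : (Omega * RR) * RR).
    by apply: measurable_fun_pair => //; apply: measurable_fun_pair.
  by have := mz measurableT _ measurable_bad_set; rewrite setTI.
have A0 : {ae mO, forall y, P (ysection A y) = 0%E}.
  apply: (@ae_imp _ RR R mO _ _ _ (@lebO_ae R)) => y _.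
  rewrite (_ : ysection A y = [set w | bad_set ((w, t), y)]); first exact: bad_section.
  by apply/seteqP; split => w; rewrite /ysection /= inE.
have good := @ae_prod1 _ _ Omega RR R P mO A mA A0.
have both : {ae P, forall w, (mP.-integrable setT (EFin \o zext T (u w)) /\
    mP.-integrable setT (EFin \o F w)) /\ {ae mO, forall y, ~ A (w, y)}}.
  exact: filterI F_integrable good.
apply: (@ae_imp _ Omega R P _ _ _ both) => w [[_ Fi] wA].
have wA0 : {ae mO, forall y, ~ bad_set ((w, t), y)} := wA.
have wA' : {ae mO, forall y, ~ bad_set ((w, t), y) /\ dom y} by exact: (@ae_and _ RR R mO (fun y => ~ bad_set ((w, t), y)) dom wA0 (@lebO_ae R)).
apply: (@ae_imp _ RR R mO _ _ _ wA') => y [nA yd].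
have : series_gap ((w, t), y) = 0%E.
  by apply/eqP; apply/negPn/negP => gap; apply: nA; split.
move=> /series_gap0.
have E : (fun n => \sum_(1 <= a < n) iter_coef a w t * eigfun a y) =
    (fun n => \sum_(1 <= a < n) mild_coef T b (u0 w) (v0 w) (u w) (xi w) a t * eigfun a y).
  by apply/funext => n; apply: eq_bigr => a _; rewrite iter_coefE.
by rewrite E.
Qed.

(** Null sets are exchanged twice: between path and [y] at fixed [s], as in [mild_series_at], then
    between path and [s] for the set [B] of pairs whose [y]-section is not null. *)
Lemma mild_series : {ae P, forall w, {ae mI, forall s, {ae mO, forall y,
  \sum_(1 <= a < n) mild_coef T b (u0 w) (v0 w) (u w) (xi w) a s * eigfun a y @[n --> \oo]
    --> zext T (u w) (s, y)}}}.
Proof.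
pose B : set (Omega * RR) := [set z | mO (xsection bad_set z) != 0%E].
have mB : measurable B.
  have mx := measurable_fun_xsection mO measurable_bad_set.
  rewrite (_ : B = (fun z => mO (xsection bad_set z)) @^-1` (~` [set 0%E])); last first.
    by apply/seteqP; split => z /= /eqP.
  rewrite -[X in measurable X]setTI; apply: mx => //.
  by apply: measurableC; exact: emeasurable_set1.
have B0 : {ae mI, forall s, P (ysection B s) = 0%E}.
  apply: (@ae_imp _ RR R mI _ _ _ (@lebI_ae R T)) => s sT.
  apply/negligibleP; first exact: measurable_ysection.
  suff : {ae P, forall w, ~ B (w, s)}.
    move=> [A [mA A0 AB]]; exists A; split => // w wb; apply: AB => /=.
    by move: wb; rewrite /ysection /= inE => wb /(_ wb).
  pose A : set (Omega * RR) := [set z | bad_set ((z.1, s), z.2)].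
  have mA : measurable A.
    have mz : measurable_fun setT (fun z : Omega * RR => ((z.1, s), z.2) : (Omega * RR) * RR).
      by apply: measurable_fun_pair => //; apply: measurable_fun_pair.
    by have := mz measurableT _ measurable_bad_set; rewrite setTI.
  have A0 : {ae mO, forall y, P (ysection A y) = 0%E}.
    apply: (@ae_imp _ RR R mO _ _ _ (@lebO_ae R)) => y _.
    rewrite (_ : ysection A y = [set w | bad_set ((w, s), y)]); first exact: bad_section.
    by apply/seteqP; split => w; rewrite /ysection /= inE.
  have good := @ae_prod1 _ _ Omega RR R P mO A mA A0.
  apply: (@ae_imp _ Omega R P _ _ _ good) => w wA /eqP; apply.
  have mx : measurable (xsection bad_set (w, s)) by apply: measurable_xsection; exact: measurable_bad_set.
  apply/negligibleP => //.
  case: wA => C [mC C0 CA]; exists C; split => // y yx; apply: CA => /=.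
  by move: yx; rewrite /xsection /= inE => yx /(_ yx).
have good := @ae_prod1 _ _ Omega RR R P mI B mB B0.
have both : {ae P, forall w, (mP.-integrable setT (EFin \o zext T (u w)) /\
    mP.-integrable setT (EFin \o F w)) /\ {ae mI, forall s, ~ B (w, s)}}.
  exact: filterI F_integrable good.
apply: (@ae_imp _ Omega R P _ _ _ both) => w [[_ Fi] wB].
have wB' : {ae mI, forall s, ~ B (w, s) /\ 0 <= s <= T} by exact: filterI wB (@lebI_ae R T).
apply: (@ae_imp _ RR R mI _ _ _ wB') => s [nB sT].
have mx : measurable (xsection bad_set (w, s)) by apply: measurable_xsection; exact: measurable_bad_set.
have x0 : mO (xsection bad_set (w, s)) = 0%E by apply/eqP/negPn/negP.
have ng : {ae mO, forall y, ~ bad_set ((w, s), y)}.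
  exists (xsection bad_set (w, s)); split => // y /= /contrapT yb.
  by rewrite /xsection /= inE.
have wA' : {ae mO, forall y, ~ bad_set ((w, s), y) /\ dom y} by exact: (@ae_and _ RR R mO (fun y => ~ bad_set ((w, s), y)) dom ng (@lebO_ae R)).
apply: (@ae_imp _ RR R mO _ _ _ wA') => y [nA yd].
have : series_gap ((w, s), y) = 0%E.
  by apply/eqP; apply/negPn/negP => gap; apply: nA; split.
move=> /series_gap0.
have E : (fun n => \sum_(1 <= a < n) iter_coef a w s * eigfun a y) =
    (fun n => \sum_(1 <= a < n) mild_coef T b (u0 w) (v0 w) (u w) (xi w) a s * eigfun a y).
  by apply/funext => n; apply: eq_bigr => a _; rewrite iter_coefE.
by rewrite E.
Qed.

End MildSeries.

(** * Powers of sums and of time integrals *)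

Section PowerBounds.
Context {R : realType}.
Implicit Types (q T : R).
Local Notation RR := (measurableTypeR R).
Local Open Scope ereal_scope.

(** Each summand is at most the root of order [q] of [S], so the sum is at most 5 times that root.
    The grouping of [x2] and [x3] is that of the data energy. *)
Lemma poweR_sum5 q (x1 x2 x3 x4 x5 : \bar R) : (0 < q)%R ->
  0 <= x1 -> 0 <= x2 -> 0 <= x3 -> 0 <= x4 -> 0 <= x5 ->
  (x1 + (x2 + x3) + x4 + x5) `^ q <=
  (5 `^ q)%:E * (x1 `^ q + (x2 `^ q + x3 `^ q) + x4 `^ q + x5 `^ q).
Proof.
move=> q0 p1 p2 p3 p4 p5; set S := _ `^ q + _ + _ + _.
have [h1 h2 h3 h4 h5] : [/\ x1 `^ q <= S, x2 `^ q <= S, x3 `^ q <= S, x4 `^ q <= S & x5 `^ q <= S].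
  rewrite /S; move: (poweR_ge0 x1 q) (poweR_ge0 x2 q) (poweR_ge0 x3 q) (poweR_ge0 x4 q) (poweR_ge0 x5 q).
  move: (x1 `^ q) (x2 `^ q) (x3 `^ q) (x4 `^ q) (x5 `^ q) => y1 y2 y3 y4 y5 z1 z2 z3 z4 z5.
  have z23 : 0 <= y2 + y3 by exact: adde_ge0.
  have z123 : 0 <= y1 + (y2 + y3) by exact: adde_ge0.
  have z1234 : 0 <= y1 + (y2 + y3) + y4 by exact: adde_ge0.
  have a1 : y1 <= y1 + (y2 + y3) by rewrite leeDl.
  have a23 : y2 + y3 <= y1 + (y2 + y3) by rewrite leeDr.
  have a123 : y1 + (y2 + y3) <= y1 + (y2 + y3) + y4 by rewrite leeDl.
  have a4 : y4 <= y1 + (y2 + y3) + y4 by rewrite leeDr.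
  have a1234 : y1 + (y2 + y3) + y4 <= y1 + (y2 + y3) + y4 + y5 by rewrite leeDl.
  have a5 : y5 <= y1 + (y2 + y3) + y4 + y5 by rewrite leeDr.
  have a2 : y2 <= y2 + y3 by rewrite leeDl.
  have a3 : y3 <= y2 + y3 by rewrite leeDr.
  split => //.
  - exact: le_trans a1 (le_trans a123 a1234).
  - exact: le_trans a2 (le_trans a23 (le_trans a123 a1234)).
  - exact: le_trans a3 (le_trans a23 (le_trans a123 a1234)).
  - exact: le_trans a4 a1234.
have qV : (0 <= q^-1)%R by rewrite invr_ge0 ltW.
have S0 : 0 <= S by exact: le_trans (poweR_ge0 _ _) h1.
have root x : 0 <= x -> x `^ q <= S -> x <= S `^ q^-1.
  move=> x0 /(lee_poweR qV (poweR_ge0 _ _)); rewrite -poweRrM divff ?gt_eqF//.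
  by rewrite poweRe1.
have Sr0 : 0 <= S `^ q^-1 by exact: poweR_ge0.
have -> : (5 `^ q)%:E * S = (5%:E * S `^ q^-1) `^ q.
  rewrite poweRM ?lee_fin// poweR_EFin; congr (_ * _).
  by rewrite -poweRrM mulVf ?gt_eqF// poweRe1.
apply: lee_poweR; [exact: ltW|by do ?[apply: adde_ge0]|].
rewrite (_ : 5%R = (1 + (1 + 1) + 1 + 1)%R); last by ring.
rewrite !EFinD !ge0_muleDl ?lee_fin ?mul1e//.
by do ?[apply: leeD]; exact: root.
Qed.

(** A crude Jensen inequality. With [a] the integral of the powers and [c] the root of order [q] of
    [a + 1], one has [f <= c + c / (a + 1) * f ^ q] pointwise, by distinguishing [f <= c] from
    [f > c]; integrating gives at most [c * (T + 1)]. The summand 1 keeps [c] positive. *)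
Lemma integral_poweR_le q T (f : RR -> \bar R) : (0 < T)%R -> (1 <= q)%R ->
  measurable_fun setT f -> (forall x, 0 <= f x) ->
  (\int[lebI T]_x f x) `^ q <= ((T + 1) `^ q)%:E * (1 + \int[lebI T]_x (f x `^ q)).
Proof.
move=> T0 q1 mf f0; have q0 : (0 < q)%R by exact: lt_le_trans q1.
set A := \int[lebI T]_x (f x `^ q).
have A0 : 0 <= A by apply: integral_ge0 => x _; exact: poweR_ge0.
have T1 : (0 < (T + 1) `^ q)%R by rewrite powR_gt0// addr_gt0.
have [Ay|] := ltP A +oo; last first.
  rewrite leye_eq => /eqP ->; rewrite addey// gt0_muley ?lte_fin// leey//.
have Af : A \is a fin_num by rewrite ge0_fin_numE.
pose a := fine A; have AE : A = a%:E by rewrite fineK.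
have a0 : (0 <= a)%R by rewrite fine_ge0.
have a1 : (0 < a + 1)%R by rewrite ltr_wpDl.
pose c := ((a + 1) `^ q^-1)%R; have c0 : (0 < c)%R by rewrite powR_gt0.
have cq : (c `^ q = a + 1)%R by rewrite -powRrM mulVf ?gt_eqF// powRr1// ltW.
have pt x : f x <= c%:E + (c / (a + 1))%:E * f x `^ q.
  have := f0 x; case: (f x) => [y||]//; last first.
    by rewrite poweRyr ?gt_eqF// gt0_muley ?addey// lte_fin divr_gt0.
  rewrite lee_fin => y0; rewrite poweR_EFin -EFinM -EFinD lee_fin.
  have [yc|cy] := leP y c; first by rewrite ler_wpDr// mulr_ge0 ?powR_ge0// divr_ge0 ?ltW.
  rewrite ler_wpDl ?(ltW c0)// mulrAC -mulrA -cq.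
  have -> : (y `^ q / c `^ q = (y / c) `^ q)%R.
    have yc0 : (0 <= y / c)%R by rewrite divr_ge0// ltW.
    rewrite -{1}[y](divfK (lt0r_neq0 c0)) (powRM _ yc0 (ltW c0)) mulfK//.
    by rewrite gt_eqF// powR_gt0.
  have yc1 : (1 <= y / c)%R by rewrite ler_pdivlMr// mul1r ltW.
  have : (y / c <= (y / c) `^ q)%R.
    by rewrite -[leLHS]powRr1 ?(le_trans ler01)//; apply: ler_powR.
  move=> /(ler_wpM2l (ltW c0)); by rewrite mulrCA divff ?gt_eqF// mulr1.
have mq : measurable_fun setT (fun x => f x `^ q).
  by apply: (measurableT_comp (measurable_poweR q)).
have ca0 : (0 <= c / (a + 1))%R by rewrite divr_ge0// ltW.
have I1 : \int[lebI T]_x f x <= (c * (T + 1))%:E.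
  apply: (@le_trans _ _ (\int[lebI T]_x (c%:E + (c / (a + 1))%:E * f x `^ q))).
    apply: ge0_le_integral => //.
    by apply: emeasurable_funD => //; apply: emeasurable_funM.
  rewrite ge0_integralD//; last 3 first.
  - by move=> x _; rewrite lee_fin ltW.
  - by move=> x _; rewrite mule_ge0 ?lee_fin// poweR_ge0.
  - by apply: emeasurable_funM.
  rewrite ge0_integralZl//; last by move=> x _; exact: poweR_ge0.
  rewrite -/A AE (_ : integral _ _ _ = c%:E * lebI T setT); last exact: integral_cst.
  rewrite lebI_setT// -!EFinM -EFinD lee_fin mulrDr mulr1 lerD2l.
  by rewrite -mulrA ler_piMr ?(ltW c0)// mulrC ler_pdivrMr// mul1r lerDl.
rewrite AE -EFinD -EFinM.
apply: (@le_trans _ _ ((c * (T + 1))%:E `^ q)).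
  by apply: lee_poweR; [exact: ltW|exact: integral_ge0|].
rewrite poweR_EFin lee_fin powRM ?(ltW c0) ?addr_ge0 ?(ltW T0)// cq.
by rewrite mulrC (addrC a).
Qed.

End PowerBounds.

(** * The moment of order [p / 2] of the total energy *)

Section MomentBound.
Context {d : measure_display} {Omega : measurableType d} {R : realType}.
Variables (P : probability Omega R) (T H p : R) (u0 v0 : Omega -> R -> R).
Local Notation RR := (measurableTypeR R).
Local Notation mI := (lebI T).
Hypothesis T0 : 0 < T.
Hypothesis H0 : 0 < H.
Hypothesis H1 : H <= 1 / 2.
Hypothesis p2 : 2 <= p.
Hypothesis u0_Lp : LpOmega P p (Hdot 1) (hnorm 1) u0.
Hypothesis v0_Lp : LpOmega P p L2 l2norm v0.

Let q := p / 2.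
Let q1 : 1 <= q. Proof. by rewrite /q ler_pdivlMr// mul1r. Qed.
Let q0 : 0 < q. Proof. exact: lt_le_trans q1. Qed.
Let p0 : 0 < p. Proof. exact: lt_le_trans p2. Qed.

Let al a w := ip (u0 w) (eigfun a).
Let be a w := ip (v0 w) (eigfun a).

Definition pos_energy w : \bar R := (\sum_(1 <= a <oo) (eigval a * ip (u0 w) (eigfun a) ^+ 2)%:E)%E.
Definition vel_energy w : \bar R := (\sum_(1 <= a <oo) (ip (v0 w) (eigfun a) ^+ 2)%:E)%E.

Lemma pos_energy_ge0 w : (0 <= pos_energy w)%E.
Proof. by apply: nneseries_ge0 => a _ _; rewrite lee_fin hnorm_term_ge0. Qed.

Lemma vel_energy_ge0 w : (0 <= vel_energy w)%E.
Proof. by apply: nneseries_ge0 => a _ _; rewrite lee_fin sqr_ge0. Qed.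

Lemma data_energyE w : data_energy (al^~ w) (be^~ w) = (pos_energy w + vel_energy w)%E.
Proof.
rewrite /data_energy /pos_energy /vel_energy -nneseriesD.
- by apply: eq_eseriesr => a _; rewrite EFinD.
- by move=> a _ _; rewrite lee_fin hnorm_term_ge0.
- by move=> a _ _; rewrite lee_fin sqr_ge0.
Qed.

Let guarded (f : nat -> Omega -> R) : (forall a, (0 < a)%N -> measurable_fun setT (f a)) ->
  (forall a w, 0 <= f a w) ->
  measurable_fun setT (fun w => \sum_(1 <= a <oo) (f a w)%:E)%E.
Proof.
move=> mf f0.
rewrite (_ : (fun w => _) = (fun w => \sum_(1 <= a <oo) (if (0 < a)%N then f a w else 0)%:E)%E).
  apply: (@measurable_nneseries R _ Omega (fun a w => if (0 < a)%N then f a w else 0)).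
    by move=> a w; case: ifP.
  by move=> a; case: (boolP (0 < a)%N) => a0 //; exact: mf.
apply/funext => w; congr (limn _); apply/funext => n.
by rewrite big_nat [RHS]big_nat; apply: eq_bigr => a /andP[-> _].
Qed.

Lemma measurable_pos_energy : measurable_fun setT pos_energy.
Proof.
apply: guarded => [a a0|a w]; last exact: hnorm_term_ge0.
by apply: measurable_funM => //; apply: measurable_funX; exact: measurable_coef_u0 u0_Lp _ a0.
Qed.

Lemma measurable_vel_energy : measurable_fun setT vel_energy.
Proof.
apply: guarded => [a a0|a w]; last exact: sqr_ge0.
by apply: measurable_funX; exact: measurable_coef_v0 v0_Lp _ a0.
Qed.

Lemma pos_energy_moment : (\int[P]_w (pos_energy w `^ q) < +oo)%E.
Proof.
have := LpOmega_moment p0 _ u0_Lp; under eq_integral do rewrite hnorm1E -poweRrM mulrC.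
by apply => v; rewrite hnorm1E; exact: poweR_ge0.
Qed.

Lemma vel_energy_moment : (\int[P]_w (vel_energy w `^ q) < +oo)%E.
Proof.
have n0 (v : R -> R) : (0 <= l2norm v)%E by exact: Lnorm_ge0.
apply: le_lt_trans (LpOmega_moment p0 n0 v0_Lp).
apply: le_ge0_integralT => w; first exact: poweR_ge0.
have vL : L2 (v0 w) by case: v0_Lp.
have mv : measurable_fun dom (v0 w) by case: vL.
rewrite l2norm_lebO// -poweRrM (mulrC _ p); apply: lee_poweR; [exact: ltW|exact: vel_energy_ge0|].
apply: nneseries_le => [a|n]; first exact: sqr_ge0.
have := @bessel_eigfun R 1 n (v0 w \_ dom) isT (measurable_patch mv).
rewrite (eq_bigr (fun a => ip (v0 w) (eigfun a) ^+ 2))// => a _.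
by rewrite ip_lebO//; exact: measurable_eigfun.
Qed.

(** One contribution for each of the five terms of [poweR_sum5], with the common noise scale [r ^ q]
    taken out: 1, position, velocity, noise at time [t], and integrated noise through
    [integral_poweR_le]. Neither [W] nor [m] nor [n] occurs in it. *)
Definition moment_const : R :=
  let G := (gaussC p `^ q^-1 * T) `^ q in
  1 + fine (\int[P]_w (pos_energy w `^ q))%E + fine (\int[P]_w (vel_energy w `^ q))%E
  + G + (T + 1) `^ q * (1 + T * G).

Lemma moment_const_ge0 : 0 <= moment_const.
Proof.
have TG : 0 <= T * (gaussC p `^ q^-1 * T) `^ q by rewrite mulr_ge0 ?powR_ge0// ltW.
rewrite /moment_const !addr_ge0 ?powR_ge0 ?mulr_ge0 ?powR_ge0 ?addr_ge0//.
- by apply: fine_ge0; apply: integral_ge0 => w _; exact: poweR_ge0.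
- by apply: fine_ge0; apply: integral_ge0 => w _; exact: poweR_ge0.
Qed.

Section Noise.
Variables (W : Omega -> R -> R -> R) (m n : nat).
Hypothesis m0 : (0 < m)%N.
Hypothesis n0 : (0 < n)%N.
Hypothesis noise : fractional_noise P T H W.

Let Z w t := energy T (wz_field T W m n w) t.
Let h : R := n%:R^-1.
Let r := h `^ (2 * (H - 1)).

(** The exponent is negative and [h <= 1]. This allows the terms free of noise to be absorbed into
    the noise scale [r]. *)
Lemma wz_scale_ge1 : 1 <= r.
Proof.
rewrite /r -[2 * (H - 1)]opprK powRN invf_ge1 ?powR_gt0 ?invr_gt0 ?ltr0n//.
have h01 : 0 < h <= 1 by rewrite /h invr_gt0 ltr0n n0/= invf_le1 ?ltr0n// ler1n.
by rewrite -[leRHS](powRr0 h) ger_powR//; move: H1; lra.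
Qed.

Let Z0 w s : (0 <= Z w s)%E. Proof. exact: energy_ge0. Qed.

Let mZ : measurable_fun setT (fun z : RR * Omega => Z z.2 z.1).
Proof. exact: (measurable_energy_wz_field T0 m0 n0 noise). Qed.

Let mZt s : measurable_fun setT (fun w => Z w s).
Proof. exact: (@measurable_fun_pair2 _ _ _ RR Omega (\bar R) (fun z => Z z.2 z.1) s mZ). Qed.

Let mZw w : measurable_fun setT (fun s : RR => Z w s).
Proof. exact: (@measurable_fun_pair1 _ _ _ RR Omega (\bar R) (fun z => Z z.2 z.1) w mZ). Qed.

Let mJ : measurable_fun setT (fun w => \int[mI]_s Z w s)%E.
Proof. exact: (@measurable_fun_fubini_tonelli_G _ _ RR Omega R mI (fun z => Z z.2 z.1)). Qed.

Let J0 w : (0 <= \int[mI]_s Z w s)%E.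
Proof. exact: integral_ge0. Qed.

Let mq (f : Omega -> \bar R) : measurable_fun setT f -> measurable_fun setT (fun w => f w `^ q)%E.
Proof. by move=> mf; apply: (measurableT_comp (measurable_poweR q)). Qed.

Lemma measurable_energy_total E t : measurable_fun setT
  (fun w => (E%:E * (1 + data_energy (al^~ w) (be^~ w) + Z w t + \int[mI]_s Z w s)) `^ q)%E.
Proof.
apply: mq; apply: emeasurable_funM => //; apply: emeasurable_funD => //.
apply: emeasurable_funD => //; apply: emeasurable_funD => //.
under eq_fun do rewrite data_energyE.
by apply: emeasurable_funD; [exact: measurable_pos_energy|exact: measurable_vel_energy].
Qed.

Lemma energy_total_moment E t : 0 <= E ->
  (\int[P]_w ((E%:E * (1 + data_energy (al^~ w) (be^~ w) + Z w t + \int[mI]_s Z w s)) `^ q) <=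
   ((5 * E * r) `^ q * moment_const)%:E)%E.
Proof.
move=> E0.
have mp := mq measurable_pos_energy; have mv := mq measurable_vel_energy.
set G0 := (gaussC p `^ q^-1 * T) `^ q.
have G00 : 0 <= G0 by exact: powR_ge0.
have r0 : 0 <= r by exact: powR_ge0.
have Zm s : (\int[P]_w (Z w s `^ q) <= (G0 * r `^ q)%:E)%E.
  rewrite -powRM ?mulr_ge0 ?powR_ge0 ?(ltW T0)//; exact: (energy_wz_moment T0 H0 m0 n0 noise s p2).
have Jm : (\int[P]_w ((\int[mI]_s Z w s) `^ q) <= ((T + 1) `^ q * (1 + T * (G0 * r `^ q)))%:E)%E.
  have mZq : measurable_fun setT (fun z : RR * Omega => Z z.2 z.1 `^ q)%E.
    by apply: (measurableT_comp (measurable_poweR q)).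
  have mA : measurable_fun setT (fun w => \int[mI]_s (Z w s `^ q))%E.
    apply: (@measurable_fun_fubini_tonelli_G _ _ RR Omega R mI (fun z => Z z.2 z.1 `^ q)%E) => // z.
    exact: poweR_ge0.
  have A0 w : (0 <= \int[mI]_s (Z w s `^ q))%E by apply: integral_ge0 => s _; exact: poweR_ge0.
  have T1 : (0 <= ((T + 1) `^ q)%:E)%E by rewrite lee_fin powR_ge0.
  apply: (@le_trans _ _ (\int[P]_w (((T + 1) `^ q)%:E * (1 + \int[mI]_s (Z w s `^ q))))%E).
    apply: le_ge0_integralT => w; first exact: poweR_ge0.
    exact: (@integral_poweR_le R q T (Z w) T0 q1 (mZw w) (Z0 w)).
  rewrite ge0_integralZl//; last 2 first.
  - exact: emeasurable_funD.
  - by move=> w _; rewrite adde_ge0.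
  have one : (\int[P]_w 1 = 1)%E.
    by transitivity (1 * P setT)%E; [exact: integral_cst|rewrite probability_setT mul1e].
  rewrite EFinM lee_wpmul2l// ge0_integralD// one EFinD leeD//.
  (* Tonelli moves the expectation inside the time integral, where the moment bound [Zm] is uniform
     in [s]. *)
  have <- : (\int[mI]_s \int[P]_w (Z w s `^ q) = \int[P]_w \int[mI]_s (Z w s `^ q))%E.
    apply: (@fubini_tonelli _ _ RR Omega R mI P (fun z => Z z.2 z.1 `^ q)%E) => // z.
    exact: poweR_ge0.
  apply: (@le_trans _ _ (\int[mI]_s (G0 * r `^ q)%:E)%E).
    apply: le_ge0_integralT => // s; apply: integral_ge0 => w _; exact: poweR_ge0.
  rewrite (_ : integral _ _ _ = ((G0 * r `^ q)%:E * mI setT)%E); last exact: integral_cst.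
  by rewrite lebI_setT// -EFinM mulrC.
have r1 : 1 <= r `^ q.
  have := @ge0_ler_powR R q (ltW q0) 1 r; rewrite !nnegrE ler01 r0 powR1; apply => //.
  exact: wz_scale_ge1.
have Eq0 : (0 <= (E `^ q * 5 `^ q)%:E)%E by rewrite lee_fin mulr_ge0 ?powR_ge0.
apply: (@le_trans _ _ (\int[P]_w ((E `^ q * 5 `^ q)%:E *
    (1 + (pos_energy w `^ q + vel_energy w `^ q) + Z w t `^ q + (\int[mI]_s Z w s) `^ q)))%E).
  apply: le_ge0_integralT => w; first exact: poweR_ge0.
  have d0 := pos_energy_ge0 w; have e0 := vel_energy_ge0 w.
  have s0 : (0 <= 1 + (pos_energy w + vel_energy w) + Z w t + \int[mI]_s Z w s)%E.
    apply: adde_ge0; last exact: J0.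
    apply: adde_ge0; last exact: Z0.
    by apply: adde_ge0 => //; exact: adde_ge0.
  rewrite data_energyE poweRM ?lee_fin// poweR_EFin EFinM -muleA lee_wpmul2l ?lee_fin ?powR_ge0//.
  by have := @poweR_sum5 R q 1%E _ _ _ _ q0 lee01 d0 e0 (Z0 w t) (J0 w); rewrite poweR1r.
have mpv := emeasurable_funD mp mv.
have m1pv : measurable_fun setT (fun w => 1 + (pos_energy w `^ q + vel_energy w `^ q))%E.
  exact: emeasurable_funD.
have mq1 := mq (mZt t); have mq2 := mq mJ.
have m1z : measurable_fun setT (fun w => 1 + (pos_energy w `^ q + vel_energy w `^ q) + Z w t `^ q)%E.
  exact: emeasurable_funD.
have g1 w : (0 <= pos_energy w `^ q + vel_energy w `^ q)%E by rewrite adde_ge0 ?poweR_ge0.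
have g2 w : (0 <= 1 + (pos_energy w `^ q + vel_energy w `^ q))%E by rewrite adde_ge0.
have g3 w : (0 <= 1 + (pos_energy w `^ q + vel_energy w `^ q) + Z w t `^ q)%E by rewrite adde_ge0 ?poweR_ge0.
have pq (x : \bar R) : (0 <= x `^ q)%E by exact: poweR_ge0.
rewrite ge0_integralZl//; last 2 first.
- exact: emeasurable_funD.
- by move=> w _; rewrite adde_ge0.
rewrite ge0_integralD// ge0_integralD// ge0_integralD// ge0_integralD//.
have one : (\int[P]_w 1 = 1)%E.
  by transitivity (1 * P setT)%E; [exact: integral_cst|rewrite probability_setT mul1e].
rewrite one.
have fin1 : (\int[P]_w (pos_energy w `^ q))%E \is a fin_num.
  by rewrite ge0_fin_numE ?pos_energy_moment//; exact: integral_ge0.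
have fin2 : (\int[P]_w (vel_energy w `^ q))%E \is a fin_num.
  by rewrite ge0_fin_numE ?vel_energy_moment//; exact: integral_ge0.
set M1 := fine (\int[P]_w (pos_energy w `^ q))%E; set M2 := fine (\int[P]_w (vel_energy w `^ q))%E.
have M10 : 0 <= M1 by rewrite fine_ge0//; exact: integral_ge0.
have M20 : 0 <= M2 by rewrite fine_ge0//; exact: integral_ge0.
set K := (T + 1) `^ q; have K0 : 0 <= K by exact: powR_ge0.
apply: (@le_trans _ _ ((E `^ q * 5 `^ q) *
    (1 + (M1 + M2) + G0 * r `^ q + K * (1 + T * (G0 * r `^ q))))%:E).
  rewrite [leRHS]EFinM; apply: lee_wpmul2l => //; rewrite !EFinD; apply: leeD => //.
  by apply: leeD => //; rewrite !fineK.
rewrite lee_fin /moment_const -/q -/G0 -/M1 -/M2 -/K.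
rewrite powRM ?mulr_ge0// powRM//.
move: (powR_ge0 E q) (powR_ge0 5 q) r1; set e := E `^ q; set f := 5 `^ q; set rr := r `^ q => e0 f0 r1.
(* Both sides are regrouped so that they differ only in the factor in front of the noise-free terms,
   [rr] against 1. *)
rewrite (_ : f * e * rr * _ = e * f * (rr * (1 + M1 + M2 + G0 + K * (1 + T * G0)))); last by ring.
rewrite ler_wpM2l ?mulr_ge0//.
have TG : 0 <= T * G0 by rewrite mulr_ge0// ltW.
rewrite (_ : rr * _ = rr * (1 + M1 + M2 + K) + G0 * rr + K * (T * (G0 * rr))); last by ring.
rewrite (_ : 1 + (M1 + M2) + _ + _ = 1 * (1 + M1 + M2 + K) + G0 * rr + K * (T * (G0 * rr))); last by ring.
by rewrite !lerD2r ler_wpM2r// !addr_ge0.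
Qed.

End Noise.
End MomentBound.

(** * From the pathwise estimate to the norm in [L^p(Omega)] *)

Lemma measurable_l2norm_diff d (Omega : measurableType d) (R : realType) (T t : R)
    (u v : Omega -> R -> R -> R) : measurable_field T u -> measurable_field T v -> 0 <= t <= T ->
  measurable_fun setT (fun w => l2norm (fun x => (u w t x - v w t x)%R)).
Proof.
move=> mu mv tT; pose RR := measurableTypeR R.
pose g (z : Omega * RR) := zext T (u z.1) (t, z.2) - zext T (v z.1) (t, z.2).
have mt : measurable_fun setT (fun z : Omega * RR => (z.1, (t : RR, z.2)) : Omega * (RR * RR)).
  apply: measurable_fun_pair; first exact: measurable_fst.
  by apply: measurable_fun_pair => //; exact: measurable_snd.
have mg : measurable_fun setT g.
  by apply: measurable_funB; [exact: (measurableT_comp (measurable_zext mu) mt)|exact: (measurableT_comp (measurable_zext mv) mt)].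
rewrite (_ : (fun w => _) = (fun w => sqint (@lebO R) (fun y => g (w, y)) `^ 2^-1)%E).
  apply: (measurableT_comp (measurable_poweR 2^-1)).
  apply: (@measurable_fun_fubini_tonelli_F _ _ Omega RR R (@lebO R) (fun z => (g z ^+ 2)%:E)).
    by apply/measurable_EFinP; exact: measurable_funX.
  by move=> z; rewrite lee_fin sqr_ge0.
apply/funext => w; have mw : measurable_fun setT (fun y : RR => g (w, y)) by exact: measurable_fun_pair2.
have E x : dom x -> u w t x - v w t x = g (w, x).
  by move=> dx; rewrite /g /zext /= tT mem_set.
exact: l2norm_sqint mw E.
Qed.

Theorem theorem4p2 (R : realType) (d : measure_display)
    (Omega : measurableType d) (P : probability Omega R)
    (T H p : R) (b : R -> R) (u0 v0 : Omega -> R -> R)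
    (T_gt0 : 0 < T) (H_gt0 : 0 < H) (H_le : H <= 1 / 2) (p_ge2 : 2 <= p)
    (b_lip : lipschitz b)
    (u0_Lp : LpOmega P p (Hdot 1) (hnorm 1) u0)
    (v0_Lp : LpOmega P p L2 l2norm v0) :
  exists C : R,
    forall W : Omega -> R -> R -> R, fractional_noise P T H W ->
    forall m n N : nat, (0 < m)%N -> (0 < n)%N -> (0 < N)%N ->
    forall u uN : Omega -> R -> R -> R,
      mild_solution P T b u0 v0 (fun w => wz_noise T m n (W w)) u ->
      galerkin_solution P T b N u0 v0 (fun w => wz_noise T m n (W w)) uN ->
      (ereal_sup [set 'N[P]_p%:E[(fun w => l2norm (fun x => (u w t x - uN w t x)%R))]
                  | t in (`[0%R, T] : set R)]
       <= (C * N%:R^-1 * n%:R^-1 `^ (H - 1))%:E)%E.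
Proof.
have [L L0 bL] := lipschitz_const b_lip.
pose K := moment_const P T p u0 v0.
(* The square root comes from the estimate of the squared error: [errC] is its constant and 5 the
   number of terms in [poweR_sum5]. The factor in [K] is the root of order [p] of the moment. The
   choice precedes [W], [m], [n] and [N]. *)
exists ((5 * errC T b L) `^ 2^-1 * K `^ p^-1).
move=> W noise m n N m0 n0 N0 u uN u_mild [muN gal].
have p0 : 0 < p by rewrite (lt_le_trans _ p_ge2).
have q0 : 0 < p / 2 by rewrite divr_gt0.
pose mO := @lebO R; pose xi := wz_field T W m n.
have xi_joint : measurable_fun setT (fun z : Omega * (measurableTypeR R * measurableTypeR R) => xi z.1 z.2).
  exact: (measurable_wz_field_joint T_gt0 m0 n0 noise).
have xii w : (lebI T \x mO)%E.-integrable setT (EFin \o xi w) by exact: wz_field_integrable.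
have mu : measurable_field T u by case: u_mild.
have C0 := errC_ge0 T_gt0 b L0.
have K0 : 0 <= K by exact: moment_const_ge0.
set h := n%:R^-1; have h0 : 0 < h by rewrite invr_gt0 ltr0n.
set E := errC T b L * N%:R ^- 2; have E0 : 0 <= E by rewrite mulr_ge0// invr_ge0 sqr_ge0.
apply: ge_ereal_sup => _ [t tT <-].
have {}tT : 0 <= t <= T by move: tT; rewrite /= in_itv.
pose err w := l2norm (fun x => u w t x - uN w t x).
have err0 w : (0 <= err w)%E by exact: Lnorm_ge0.
(* The pathwise estimate of the squared error raised to the power [p / 2]; the path has to satisfy
   the Galerkin equation, integrability of [u], and convergence of the series both at this [t] and
   at almost every time. *)
have bound : {ae P, forall w, (err w `^ p <= (E%:E * (1 + data_energy (fun a => ip (u0 w) (eigfun a)) (fun a => ip (v0 w) (eigfun a))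
    + energy T (xi w) t + \int[lebI T]_s energy T (xi w) s)) `^ (p / 2))%E}.
  have s1 := mild_series_at L0 bL u0_Lp v0_Lp xi_joint xii u_mild tT.
  have s2 := mild_series L0 bL u0_Lp v0_Lp xi_joint xii u_mild.
  have s3 := F_integrable L0 bL xii u_mild.
  have all := ae_and (ae_and s1 s2) (ae_and s3 gal).
  apply: (@ae_imp _ Omega R P _ _ _ all) => w [[c1 c2] [[ui _] [VU U0 DU]]].
  have muw := measurable_zext_path w mu.
  have u0H : Hdot 1 (u0 w) by case: u0_Lp.
  have v0L : L2 (v0 w) by case: v0_Lp.
  rewrite /err (l2norm_error T_gt0 VU muw tT) -poweRrM (mulrC _ p).
  apply: lee_poweR; [exact: ltW|exact: sqint_ge0|].
  exact: (pathwise_sqint T_gt0 N0 L0 bL (xii w) u0H v0L VU U0 DU muw ui c2 tT c1).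
have merr : measurable_fun setT err.
  exact: (measurable_l2norm_diff mu muN tT).
rewrite unlock /=.
have moment : (\int[P]_w (err w `^ p) <= ((5 * E * h `^ (2 * (H - 1))) `^ (p / 2) * K)%:E)%E.
  apply: le_trans (energy_total_moment T_gt0 H_gt0 H_le p_ge2 u0_Lp v0_Lp m0 n0 noise t E0).
  apply: ae_ge0_le_integral => //.
  - by move=> w _; exact: poweR_ge0.
  - by apply: (measurableT_comp (measurable_poweR p)).
  - by move=> w _; exact: poweR_ge0.
  - exact: (measurable_energy_total T_gt0 u0_Lp v0_Lp m0 n0 noise E t).
  - by apply: (@ae_imp _ Omega R P _ _ _ bound) => w + _.
rewrite (eq_integral (fun w => err w `^ p)%E); last by move=> w _; rewrite gee0_abs//; exact: err0.
apply: le_trans (lee_poweR (_ : 0 <= p^-1) _ moment) _.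
  by rewrite invr_ge0 ltW.
  by apply: integral_ge0 => w _; exact: poweR_ge0.
rewrite poweR_EFin lee_fin powRM ?powR_ge0// -powRrM.
have -> : p / 2 / p = 2^-1 by field; rewrite gt_eqF.
have NN : (0 : R) <= N%:R ^- 2 by rewrite invr_ge0 sqr_ge0.
(* The factor [N^-2] hidden in [E] and the noise scale [h ^ (2 * (H - 1))] form a perfect square,
   whose root is the rate. *)
have -> : 5 * E * h `^ (2 * (H - 1)) = 5 * errC T b L * (N%:R^-1 * h `^ (H - 1)) ^+ 2.
  rewrite exprMn -[(h `^ _) ^+ 2]powR_mulrn ?powR_ge0// -powRrM (mulrC _ 2) /E.
  by rewrite exprVn; ring.
have y0 : 0 <= N%:R^-1 * h `^ (H - 1) by rewrite mulr_ge0 ?invr_ge0 ?powR_ge0.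
rewrite (powRM _ _ (sqr_ge0 _)) ?mulr_ge0//.
have -> : ((N%:R^-1 * h `^ (H - 1)) ^+ 2) `^ 2^-1 = N%:R^-1 * h `^ (H - 1).
  by rewrite powR12_sqrt ?sqr_ge0// sqrtr_sqr ger0_norm.
by rewrite le_eqVlt; apply/orP; left; apply/eqP; ring.
Qed.
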